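(* Let $G$ be an $xy$-sum of connected graphs $G_1$ and $G_2$. If both $G_1$ and $G_2$ are minor-tight in $G$, then the following statements hold: (i) $G_1$ and $G_2$ both belong to $\mathcal{C}^\circ(g)\cup\mathcal{C}^\circ(g^+)\cup\mathcal{C}^\circ(g_a)\cup\mathcal{C}^\circ(g_a^+)\cup\mathcal{D}$. (ii) If $\epsilon^+(G_2)=0$, then $G_1\in\mathcal{C}^\circ(g)\cup\mathcal{C}^\circ(g^+)$. (iii) At least one of $G_1$, $G_2$ belongs to $\mathcal{C}^\circ(g)\cup\mathcal{C}^\circ(g^+)$.
   Context: Graphs are finite and simple. $g(G)$ is the orientable genus of $G$ (minimum genus of an orientable embedding, i.e. of a rotation system, computed by Euler's formula); for disconnected graphs an embedding is an embedding of each component and genera of components are added. $\mathcal{G}_{xy}$ is the class of graphs with two distinct distinguished vertices $x,y$ (terminals), and $\mathcal{G}^\circ_{xy}$ is the subclass of those graphs in which $xy$ is not an edge. $G^+$ is $G$ with the edge $xy$ added if absent. An embedding of $G\in\mathcal{G}_{xy}$ is $xy$-alternating if some facial walk contains $(x,y,x,y)$ as a cyclic subsequence. $\epsilon(G)=1$ if $G$ has a minimum genus embedding that is $xy$-alternating, and $\epsilon(G)=0$ otherwise. Parameters: $g^+(G)=g(G^+)$, $\epsilon^+(G)=\epsilon(G^+)$, $\theta(G)=g^+(G)-g(G)$, $g_a(G)=g(G)-\epsilon(G)$, $g_a^+(G)=g_a(G^+)=g^+(G)-\epsilon^+(G)$. For $G\in\mathcal{G}_{xy}$, the set $\mathcal{M}(G)$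 of minor-operations consists of the deletions $(e,-)$ of edges $e\in E(G)$ and the contractions $(e,/)$ of edges $e\in E(G)$, $e\neq xy$; when contracting an edge incident with a terminal the new vertex becomes that terminal, and multiple edges are replaced by single edges. $\mu G$ is the result of applying $\mu$. For a parameter $\mathcal{P}$, $\Delta_k(\mathcal{P})=\{\mu\in\mathcal{M}(G):\mathcal{P}(\mu G)\le\mathcal{P}(G)-k\}$, and $\mathcal{C}^\circ(\mathcal{P})$ is the class of $G\in\mathcal{G}^\circ_{xy}$ with $\mathcal{M}(G)=\Delta_1(\mathcal{P})$. A dumbbell with bar $b$ is a graph $H\in\mathcal{G}^\circ_{xy}$ with a cut-edge $b$ whose deletion separates $x$ from $y$. $\mathcal{D}$ is the class of dumbbells $H$ with bar $b$ such that $\theta(H)=0$, $\mu\in\Delta_1(g)$ for each $\mu\in\mathcal{M}(H)\setminus\{(b,-),(b,/)\}$, and $\epsilon^+(H/b)=1$. Given $G_1,G_2\in\mathcal{G}^\circ_{xy}$ with $V(G_1)\cap V(G_2)=\{x,y\}$, each of the graphs $(V(G_1)\cup V(G_2),E(G_1)\cup E(G_2))$ and this graph plus the edge $xy$ is an $xy$-sum of $G_1$ and $G_2$. A subgraph $H$ of $G$ is minor-tight in $G$ if $g(G-e)<g(G)$ and $g(G/e)<g(G)$ for every $e\in E(H)$. *)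

(* Defs.v *)
From mathcomp Require Import all_boot all_order fingroup perm.
From mathcomp Require Import ssralg ssrnum ssrint.

Set Implicit Arguments.
Unset Strict Implicit.
Unset Printing Implicit Defensive.

Import Order.TTheory GRing.Theory Num.Theory.

(* A finite graph whose vertices are taken from an ambient finite type, so that
   deletions, contractions and unions all stay in the same type.  An edge is the
   set of its two ends; [simple_graph] says that the data is a simple graph. *)
Record graph (T : finType) := Graph { vset : {set T}; eset : {set {set T}} }.

Section Graphs.
Variable T : finType.
Implicit Types (G H : graph T) (e : {set T}) (C : {set T}).

Definition simple_graph G :=
  [forall e in eset G, (#|e| == 2) && (e \subset vset G)].

Definition adj G : rel T := [rel u v | [set u; v] \in eset G].

Definition connected_graph G :=
  (vset G != set0) &&
  [forall u in vset G, forall v in vset G, connect (adj G) u v].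

Definition components G : {set {set T}} :=
  [set [set v in vset G | connect (adj G) u v] | u in vset G].

Definition del_edge G e := Graph (vset G) (eset G :\ e).

Definition cut_edge G e :=
  (e \in eset G) && (#|components G| < #|components (del_edge G e)|).

Definition nbrs G (v : T) : {set T} := [set u | adj G v u].

(* rho v is the rotation at v: it permutes the neighbours of v in a single
   cycle (its values elsewhere are irrelevant). *)
Definition rotation_system G (rho : {ffun T -> {perm T}}) :=
  [forall v in vset G, forall u in nbrs G v, porbit (rho v) u == nbrs G v].

Definition darts G : {set T * T} := [set d | adj G d.1 d.2].

(* Face tracing: after traversing u -> v, leave v along the edge that follows
   vu in the rotation at v.  The facial walks are the orbits of darts. *)
Definition face_step (rho : {ffun T -> {perm T}}) (d : T * T) : T * T :=
  (d.2, rho d.2 d.1).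

Definition face rho (d : T * T) : {set T * T} :=
  [set d' in orbit (face_step rho) d].

Definition comp_edges G C := [set e in eset G | e \subset C].

(* A component without edges is a single vertex, embedded with one face. *)
Definition comp_faces G rho C : nat :=
  if comp_edges G C == set0 then 1
  else #|[set face rho d | d in darts G & d.1 \in C]|.

(* Euler's formula |V| - |E| + |F| = 2 - 2g on the component C. *)
Definition comp_genus G rho C : nat :=
  (2 + #|comp_edges G C| - (#|C| + comp_faces G rho C))./2.

Definition emb_genus G rho : nat :=
  \sum_(C in components G) comp_genus G rho C.

Definition embeds_in_genus G (k : nat) :=
  [exists rho, rotation_system G rho && (emb_genus G rho == k)].

Lemma genus_exists G : exists k, embeds_in_genus G k.
Proof.
have injN v : injective (next (enum (nbrs G v))).
  exact: can_inj (prev_next (enum_uniq _)).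
pose rho := [ffun v => perm (injN v)].
exists (emb_genus G rho); apply/existsP; exists rho; rewrite eqxx andbT.
apply/forall_inP => v _; apply/forall_inP => u uN; apply/eqP/setP => w.
have uE : u \in enum (nbrs G v) by rewrite mem_enum.
have cyc := cycle_next (enum_uniq (mem (nbrs G v))).
have itE i z : (rho v ^+ i)%g z = iter i (next (enum (nbrs G v))) z.
  rewrite permX; elim: i => //= i ->.
  by rewrite ffunE permE.
have -> : (w \in nbrs G v) = (w \in enum (nbrs G v)) by rewrite mem_enum.
rewrite -(fconnect_cycle cyc uE w).
apply/idP/idP.
  by case/porbitP => i ->; rewrite itE fconnect_iter.
by move/iter_findex => <-; rewrite -itE; apply/porbitP; eexists.
Qed.

Definition genus G : nat := ex_minn (genus_exists G).

Section Terminals.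
Variables x y : T.

(* Some facial walk contains (x, y, x, y) as a cyclic subsequence; the choice
   of the starting dart d accounts for the cyclic shift. *)
Definition alternating G rho :=
  [exists d in darts G,
     subseq [:: x; y; x; y] [seq d'.1 | d' <- orbit (face_step rho) d]].

Definition epsilon G : nat :=
  [exists rho, [&& rotation_system G rho, emb_genus G rho == genus G
                 & alternating G rho]].

Definition Gxy G := [&& simple_graph G, x != y, x \in vset G & y \in vset G].

Definition Gxy0 G := Gxy G && ([set x; y] \notin eset G).

Definition add_xy G := Graph (vset G) ([set x; y] |: eset G).

(* The parameters are integer-valued so that subtraction is not truncated *)

Definition par_g G : int := Posz (genus G).
Definition par_gp G : int := par_g (add_xy G).
Definition theta G : int := (par_gp G - par_g G)%R.
Definition epsilonp G : nat := epsilon (add_xy G).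
Definition par_ga G : int := (par_g G - Posz (epsilon G))%R.
Definition par_gap G : int := par_ga (add_xy G).

(* The vertex of G / e that replaces e: the terminal in e if there is one,
   and an arbitrary end of e otherwise. *)
Definition contr_rep e : T :=
  if x \in e then x else if y \in e then y else odflt x [pick v in e].

Definition contr_map e (v : T) : T := if v \in e then contr_rep e else v.

(* Keeping the images of cardinality 2 removes the loop coming from e itself;
   parallel edges are identified because edges are sets. *)
Definition contr_edge G e :=
  Graph (contr_map e @: vset G)
        [set a in [set contr_map e @: a' | a' : {set T} in eset G] | #|a| == 2].

(* inl e is the deletion (e,-) and inr e is the contraction (e,/). *)
Definition minor_op := ({set T} + {set T})%type.

Definition app_op (mu : minor_op) G :=
  match mu with inl e => del_edge G e | inr e => contr_edge G e end.

Definition minor_ops G : {set minor_op} :=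
  [set mu | match mu with
            | inl e => e \in eset G
            | inr e => (e \in eset G) && (e != [set x; y])
            end].

Definition Delta (k : nat) (P : graph T -> int) G : {set minor_op} :=
  [set mu in minor_ops G | (P (app_op mu G) <= P G - Posz k)%R].

Definition C0 (P : graph T -> int) G : Prop :=
  Gxy0 G /\ minor_ops G = Delta 1 P G.

Definition dumbbell H (b : {set T}) :=
  [&& Gxy0 H, cut_edge H b, connect (adj H) x y
    & ~~ connect (adj (del_edge H b)) x y].

Definition classD H : Prop :=
  exists b, [/\ dumbbell H b, theta H = 0%R,
    minor_ops H :\: [set inl b; inr b] \subset Delta 1 par_g H
    & epsilonp (contr_edge H b) = 1].

Definition xy_sum G1 G2 G : Prop :=
  [/\ Gxy0 G1, Gxy0 G2, vset G1 :&: vset G2 = [set x; y] &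
      let S := Graph (vset G1 :|: vset G2) (eset G1 :|: eset G2) in
      G = S \/ G = add_xy S].

(* For a subgraph H of G. *)
Definition minor_tight H G : Prop :=
  forall e, e \in eset H ->
    genus (del_edge G e) < genus G /\ genus (contr_edge G e) < genus G.

End Terminals.
End Graphs.

(* Main.v *)
(** Tracing faces of G amounts to composing the rotations with the reversal of
    darts, so Euler's formula reads 2g + |V| + |E| = 2 + plen f, where plen f is
    the least number of transpositions whose product is the face permutation f.
    Fix the rotations away from x and y and replace f by its first return map k
    to the darts at x and y.  The best choice of the rotations at x and y then
    depends only on the cycles of k inside X and inside Y, on the number of
    passages of k from X to Y, and on a parity, where X and Y are the sets of
    darts at x and y; the parity also decides whether the best embedding is
    alternating.  Since all of these add up over an xy-sum, one gets
      g(G1 u G2) = min(g(G1) + g(G2) + 1, g+(G1) + g+(G2) - eps+(G1) eps+(G2)).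
    A minor operation on G1 which lowers the genus of the sum therefore lowers
    g(G1) or g+(G1) - eps+(G1) eps+(G2).  Comparing g with g+ and looking at the
    values of eps+ gives the classes, except when an edge b of G1 separates x
    from y, since deleting b disconnects G1: then either this deletion lowers
    g+(G1), or g(G1) = g+(G1) and G1 is in D.  Contracting a cut-edge never
    lowers the genus, so no other edge of G1 is a cut-edge of G1. *)

Require Import Defs.
From mathcomp Require Import all_boot all_order fingroup perm morphism action.
From mathcomp Require Import ssralg ssrnum ssrint.
From mathcomp Require Import zify.

Set Implicit Arguments.
Unset Strict Implicit.
Unset Printing Implicit Defensive.

(** * Length of permutations *)

(** First return maps are handled through lengths only: [k] is pinned down by the lengths of its
    products, and whether two points share a cycle, hence alternation, is read off from lengths,
    since a transposition shortens a permutation exactly when it cuts a cycle. The lower bound for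
    the completed length is reached by the classical fact that a permutation of even sign is a
    product of two full cycles. When parity forbids the bound itself, the leftover transposition of
    the odd case joins two cycles into one that alternates; this is why parity alone decides
    alternation. Two units of length make one handle. Two sides that both miss their bound by one
    unit do not miss it together, whence the term eps+ eps+. A side without a face at both terminals
    beats its bound by two units and loses this gain in the sum, whence the term 1 in g(G1) + g(G2)
    + 1. The formula requires connected sides, while a deletion may disconnect one. For an edge
    separating the terminals the missing information is only about g+, where the edge xy reconnects
    the graph: the separating edge is moved to xy without raising the genus. *)

Section PermLength.
Local Open Scope group_scope.
Variable T : finType.
Implicit Types (s t r : {perm T}) (a b u v z : T) (S Z X Y : {set T}).

Lemma porbit_stable s S z :
  (forall u, u \in S -> s u \in S) -> z \in S -> porbit s z \subset S.
Proof.
move=> stab zS; apply/subsetP => u /porbitP[i ->] {u}.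
by elim: i => [|i IH]; rewrite ?perm1 // expgSr permM; apply: stab.
Qed.

Lemma porbit_trans s a b c :
  a \in porbit s b -> b \in porbit s c -> a \in porbit s c.
Proof. by rewrite -!eq_porbit_mem => /eqP -> /eqP ->. Qed.

Lemma mem_porbit1 s a b : (s a \in porbit s b) = (a \in porbit s b).
Proof. by rewrite -!eq_porbit_mem -[in LHS](expg1 s) porbit_perm. Qed.

Lemma porbit_sub s t z :
  (forall u, s u \in porbit t u) -> porbit s z \subset porbit t z.
Proof.
move=> st; apply: porbit_stable (porbit_id _ _) => u uz.
exact: porbit_trans (st u) uz.
Qed.

Lemma porbit_eq_in s t S z :
  (forall u, u \in S -> s u = t u) -> (forall u, u \in S -> s u \in S) ->
  z \in S -> porbit s z = porbit t z.
Proof.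
move=> st stab zS.
have E i : (s ^+ i) z = (t ^+ i) z /\ (s ^+ i) z \in S.
  elim: i => [|i [E ES]]; first by rewrite !expg0 !perm1.
  by rewrite !expgSr !permM -E st // -st // stab.
by apply/setP => u; apply/porbitP/porbitP => -[i ->]; exists i; case: (E i).
Qed.

Lemma porbit_eq_id s z : s z = z -> porbit s z = [set z].
Proof.
move=> sz; apply/eqP; rewrite eqEsubset sub1set porbit_id andbT.
by apply: porbit_stable; rewrite ?inE // => u /set1P ->; rewrite sz inE.
Qed.

(* The least number of transpositions whose product is s. *)
Definition plen s : nat := #|T| - #|porbits s|.

Lemma card_porbits_le s : #|porbits s| <= #|T|.
Proof. exact: leq_imset_card. Qed.

Lemma card_porbits s : #|porbits s| = #|T| - plen s.
Proof. by rewrite /plen subKn ?card_porbits_le. Qed.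

Lemma plen_le s : plen s <= #|T|. Proof. exact: leq_subr. Qed.

Lemma plen_merge a b s :
  a \notin porbit s b -> plen (tperm a b * s) = (plen s).+1.
Proof.
move=> ab; have := porbits_mul_tperm s a b; rewrite /= ab.
have -> : a != b by apply: contraNneq ab => ->; rewrite porbit_id.
have := card_porbits_le s; have := card_porbits_le (tperm a b * s).
rewrite /plen; set n1 := #|porbits _|; set n2 := #|porbits _|; lia.
Qed.

Lemma plen_split a b s : a \in porbit s b -> a != b ->
  plen s = (plen (tperm a b * s)).+1.
Proof.
move=> ab ne; have := porbits_mul_tperm s a b; rewrite /= ab ne.
have := card_porbits_le s; have := card_porbits_le (tperm a b * s).
rewrite /plen; set n1 := #|porbits _|; set n2 := #|porbits _|; lia.
Qed.

Lemma plen_tperm_le a b s : plen (tperm a b * s) <= (plen s).+1.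
Proof.
have [ab|ab] := boolP (a \in porbit s b); last by rewrite plen_merge.
have [->|ne] := eqVneq a b; first by rewrite tperm1 mul1g.
by rewrite (plen_split ab ne) leqW // leqW.
Qed.

(** Sharing a cycle becomes an inequality between lengths. First return maps are known only through
    lengths, so this is what carries cycles over to them. *)
Lemma mem_porbit_plen a b s : a != b ->
  (a \in porbit s b) = (plen (tperm a b * s) < plen s).
Proof.
move=> ne; have [ab|ab] := boolP (a \in porbit s b).
  by rewrite (plen_split ab ne) ltnSn.
by rewrite plen_merge // ltnNge leqnSn.
Qed.

Lemma porbits1 : porbits (1 : {perm T}) = [set [set z] | z : T].
Proof.
by apply: eq_imset => z; rewrite porbit_eq_id // perm1.
Qed.

Lemma plen1 : plen 1 = 0.
Proof.
by rewrite /plen porbits1 card_imset ?subnn //; apply: set1_inj.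
Qed.

(** Induction along a minimal factorization into transpositions: a moved point and its image lie on
    one cycle, cutting there lowers the length by one, and every factor put back joins two
    cycles. *)
Lemma plen_ind (P : {perm T} -> Prop) :
  P 1 ->
  (forall a b s, a \notin porbit s b -> P s -> P (tperm a b * s)) ->
  forall s, P s.
Proof.
move=> P1 PS s; have [n] := ubnP (plen s); elim: n s => // n IH s ltn.
have [->//|/eqP s1] := eqVneq s 1.
have [a sa] : exists a, s a != a.
  apply/existsP; apply: contraT; rewrite negb_exists => /forallP fix_s.
  by case: s1; apply/permP => z; rewrite perm1; apply/eqP; rewrite -[_ == _]negbK.
have asa : a \in porbit s (s a) by rewrite porbit_sym mem_porbit1 porbit_id.
have := plen_split asa; rewrite eq_sym => /(_ sa) E.
rewrite -(tpermKg a (s a) s) -/(_ * _); apply: PS; last first.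
  by apply: IH; rewrite -ltnS -E.
by rewrite mem_porbit_plen 1?eq_sym // tpermKg E ltnNge leqnSn.
Qed.

Lemma plenM s t : plen (s * t) <= plen s + plen t.
Proof.
elim/plen_ind: s => [|a b s ab IH]; first by rewrite mul1g plen1.
rewrite -mulgA plen_merge //; apply: leq_trans (plen_tperm_le _ _ _) _.
by rewrite addSn ltnS.
Qed.

Lemma porbitJ s t z : porbit (s ^ t) (t z) = t @: porbit s z.
Proof.
apply/setP => u; apply/porbitP/imsetP => [[i ->]|[v /porbitP[i ->] ->]].
  by exists ((s ^+ i) z); rewrite ?mem_porbit // -conjXg permJ.
by exists i; rewrite -conjXg permJ.
Qed.

Lemma plenJ s t : plen (s ^ t) = plen s.
Proof.
rewrite /plen; congr subn.
rewrite -(card_imset (porbits s) (imset_inj (@perm_inj _ t))).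
congr #|pred_of_set _|; rewrite /porbits -imset_comp.
apply/setP => A; apply/imsetP/imsetP => -[z _ ->].
  by exists (t^-1 z) => //=; rewrite -porbitJ permKV.
by exists (t z) => //=; rewrite porbitJ.
Qed.

Lemma plenC s t : plen (s * t) = plen (t * s).
Proof. by rewrite -(plenJ (s * t) s) conjgE mulgA mulKg. Qed.

Lemma plenV s : plen s^-1 = plen s.
Proof. by rewrite /plen porbitsV. Qed.

Lemma plen_triangle s t : plen s <= plen (s * t) + plen t.
Proof. by rewrite -{1}(mulgK t s) -[in leqRHS](plenV t) plenM. Qed.

Lemma plen_eq0 s : plen s = 0 -> s = 1.
Proof. by elim/plen_ind: s => // a b s ab _; rewrite plen_merge. Qed.

Lemma odd_plen s : odd_perm s = odd (plen s).
Proof. by rewrite /plen oddB ?card_porbits_le. Qed.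

Lemma plen_merge_r a b s :
  a \notin porbit s b -> plen (s * tperm a b) = (plen s).+1.
Proof. by move=> ab; rewrite plenC plen_merge. Qed.

Lemma porbit_merge_sub a b s z : a \notin porbit s b ->
  porbit s z \subset porbit (tperm a b * s) z.
Proof.
move=> ab; set t := _ * s.
have ne : a != b by apply: contraNneq ab => ->; rewrite porbit_id.
have tab : a \in porbit t b.
  by rewrite mem_porbit_plen // tpermKg /t plen_merge // ltnSn.
apply: porbit_sub => u.
have tu : t (tperm a b u) = s u by rewrite /t permM tpermK.
rewrite -tu mem_porbit1; case: tpermP => [->|->|_ _]; rewrite ?porbit_id //.
by rewrite porbit_sym.
Qed.

Lemma porbit_merge a b s : a \notin porbit s b ->
  porbit (tperm a b * s) a = porbit s a :|: porbit s b.
Proof.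
move=> ab; set t := _ * s.
have ne : a != b by apply: contraNneq ab => ->; rewrite porbit_id.
have tab : a \in porbit t b.
  by rewrite mem_porbit_plen // tpermKg /t plen_merge // ltnSn.
apply/eqP; rewrite eqEsubset subUset porbit_merge_sub //=; apply/andP; split.
  apply: porbit_stable; last by rewrite inE porbit_id.
  move=> u; rewrite /t permM !inE !mem_porbit1.
  by case: tpermP => // _ _; rewrite !porbit_id ?orbT.
rewrite -eq_porbit_mem in tab; rewrite (eqP tab).
exact: porbit_merge_sub.
Qed.

Lemma porbit_merge_out a b s z : z \notin porbit s a -> z \notin porbit s b ->
  porbit (tperm a b * s) z = porbit s z.
Proof.
move=> za zb; symmetry; apply: (@porbit_eq_in _ _ (~: (porbit s a :|: porbit s b))).
- move=> u; rewrite !inE negb_or permM => /andP[ua ub].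
  by rewrite tpermD //; [apply: contraNneq ua => <- | apply: contraNneq ub => <-];
    rewrite porbit_id.
- by move=> u; rewrite !inE !mem_porbit1.
- by rewrite !inE negb_or za.
Qed.

Lemma perm_on_sub S Z s : S \subset Z -> perm_on S s -> perm_on Z s.
Proof. by move=> SZ sS; apply: subset_trans sS SZ. Qed.

Lemma perm_on_tperm S a b : a \in S -> b \in S -> perm_on S (tperm a b).
Proof.
by move=> aS bS; apply: perm_on_sub (tperm_on _ _); rewrite subUset !sub1set aS.
Qed.

Lemma porbit_on_sub S s z : perm_on S s -> z \in S -> porbit s z \subset S.
Proof. by move=> sS; apply: porbit_stable => u; rewrite perm_closed. Qed.

Lemma plen_on Z s : perm_on Z s -> plen s + #|porbit s @: Z| = #|Z|.
Proof.
move=> sZ; have E : #|porbits s| = #|porbit s @: Z| + #|~: Z|.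
  have -> : porbits s = porbit s @: Z :|: porbit s @: (~: Z).
    rewrite -imsetU setUCr; apply/setP => A.
    by apply/imsetP/imsetP => -[u _ ->]; exists u.
  rewrite cardsU; have -> : porbit s @: Z :&: porbit s @: (~: Z) = set0.
    apply/setP => A; rewrite !inE; apply/negP => /andP[/imsetP[u uZ ->]].
    case/imsetP => v /setCP vZ /eqP; rewrite eq_porbit_mem porbit_sym => vu.
    by case: vZ; apply: subsetP vu; apply: porbit_on_sub.
  rewrite cards0 subn0; congr addn.
  rewrite card_in_imset // => u v /setCP uZ /setCP vZ.
  rewrite !porbit_eq_id; [exact: set1_inj|apply: (out_perm sZ); exact/negP..].
have := card_porbits_le s; have := cardsC Z; rewrite /plen E .
set n1 := #|porbit s @: Z|; set n2 := #|Z|; set n3 := #|~: Z|; lia.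
Qed.

(** For empty [X] this forces [r = 1]; that case occurs at an end of a bridge which has no other
    edge. *)
Definition full_cycle X r : Prop :=
  perm_on X r /\ forall u, u \in X -> porbit r u = X.

Lemma plen_full X r u : u \in X -> full_cycle X r -> (plen r).+1 = #|X|.
Proof.
move=> uX [rX pX]; rewrite -(plen_on rX) -addn1; congr (_ + _).
rewrite (_ : _ @: X = [set X]) ?cards1 //; apply/setP => A; rewrite inE.
by apply/imsetP/eqP => [[v vX ->]|->]; [apply: pX|exists u; rewrite ?pX].
Qed.

Lemma full1 a : full_cycle [set a] 1.
Proof.
split; first by apply/subsetP => u; rewrite !inE perm1 eqxx.
by move=> u /set1P ->; rewrite porbit_eq_id // perm1.
Qed.

Lemma fullV X r : full_cycle X r -> full_cycle X r^-1.
Proof. by move=> [rX pX]; split; [rewrite perm_onV | move=> u uX; rewrite porbitV pX]. Qed.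

Lemma fullJ X r s : full_cycle X r -> full_cycle (s @: X) (r ^ s).
Proof.
move=> [rX pX]; split.
  apply/subsetP => u; rewrite !inE; apply: contraR => uX.
  rewrite -[u](permKV s) permJ (out_perm rX) //.
  apply: contra uX => ?; by rewrite -[u](permKV s) imset_f.
by move=> _ /imsetP[u uX ->]; rewrite porbitJ pX.
Qed.

Lemma full_insert X r a b : full_cycle X r -> a \notin X -> b \in X ->
  full_cycle (a |: X) (tperm a b * r).
Proof.
move=> [rX pX] aX bX; have abr : a \notin porbit r b by rewrite pX.
have pa : porbit r a = [set a] by rewrite porbit_eq_id // (out_perm rX).
have E := porbit_merge abr; rewrite pa pX // in E.
split; last first.
  move=> u uX; rewrite -E -eq_porbit_mem in uX; first by rewrite (eqP uX).
apply: perm_onM; last by apply: perm_on_sub rX; rewrite subsetUr.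
by apply: perm_on_sub (tperm_on _ _); rewrite setUS // sub1set.
Qed.

Lemma full_insert_r X r a b : full_cycle X r -> a \notin X -> b \in X ->
  full_cycle (a |: X) (r * tperm a b).
Proof.
move=> fX aX bX; rewrite -[r * _]invgK invMg tpermV.
by apply/fullV/full_insert => //; apply: fullV.
Qed.

End PermLength.

(** * Products of two full cycles *)

Section TwoCycles.
Local Open Scope group_scope.
Variable T : finType.
Implicit Types (s t r k : {perm T}) (a b u v z : T) (S Z X Y O : {set T}).

Lemma porbit_merge_r a b s : a \notin porbit s b ->
  porbit (s * tperm a b) a = porbit s a :|: porbit s b.
Proof.
move=> ab; rewrite -porbitV invMg tpermV porbit_merge ?porbitV //.
Qed.

Lemma mem_porbit_split_r a b s : a != b -> a \in porbit s b ->
  a \notin porbit (s * tperm a b) b.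
Proof.
move=> ne ab; rewrite -porbitV invMg tpermV mem_porbit_plen // tpermKg.
by rewrite -porbitV in ab; rewrite (plen_split ab ne) ltnNge leqnSn.
Qed.

Lemma full_intro X s u : perm_on X s -> u \in X -> porbit s u = X -> full_cycle X s.
Proof.
move=> sX uX E; split=> // v; rewrite -[in v \in X]E -eq_porbit_mem => /eqP ->.
exact: E.
Qed.

Lemma perm_onD1 X s a : perm_on X s -> s a = a -> perm_on (X :\ a) s.
Proof.
move=> sX sa; apply/subsetP => u us; rewrite !inE (subsetP sX) // andbT.
by apply: contraTneq us => ->; rewrite inE sa eqxx.
Qed.

(** The classical fact that a permutation of even sign is a product of two full cycles; for odd sign
    one transposition is left over. A point [p] is removed from [X], and the work lies in inserting
    it back into [r]. *)
Lemma full_cycle_product X k : X != set0 -> perm_on X k ->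
  exists2 r, full_cycle X r & full_cycle X (k * r) \/
    exists a b, [/\ a \in X, b \in X, a != b & full_cycle X (k * r * tperm a b)].
Proof.
have [n] := ubnP #|X|; elim: n X k => // n IH X k ltn /set0Pn[p pX] kX.
have [X1|/set0Pn[c cX]] := eqVneq (X :\ p) set0; last first.
- pose X' := X :\ p; have X'X : p |: X' = X by rewrite setD1K.
  have pX' : p \notin X' by rewrite !inE eqxx.
  have X'0 : X' != set0 by apply/set0Pn; exists c.
  have ltX' : #|X'| < n by move: ltn; rewrite -X'X cardsU1 pX'.
  have [kp|kp] := eqVneq (k p) p.
    have [r fr cr] := IH X' k ltX' X'0 (perm_onD1 kX kp).
    exists (r * tperm p c); first by rewrite -X'X; apply: full_insert_r.
    case: cr => [fkr|[a [b [aX bX ab fkr]]]].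
      by left; rewrite mulgA -X'X; apply: full_insert_r.
    right; exists a, b; rewrite -X'X !in_setU1 aX bX !orbT; split=> //; rewrite X'X.
    have tpab : tperm a b p = p.
      by rewrite tpermD //; [apply: contraNneq pX' => <- | apply: contraNneq pX' => <-].
    suff -> : k * (r * tperm p c) * tperm a b =
              k * r * tperm a b * tperm p (tperm a b c).
      rewrite -X'X; apply: full_insert_r => //.
      by case: tpermP => // ->.
    have -> : tperm p (tperm a b c) = tperm p c ^ tperm a b by rewrite tpermJ tpab.
    by rewrite conjgE tpermV -!mulgA tpermKg.
  pose q := k p; have qX' : q \in X' by rewrite !inE kp perm_closed.
  pose k' := k * tperm p q.
  have k'p : k' p = p by rewrite permM tpermR.
  have k'X : perm_on X' k'.
    apply: perm_onD1 k'p; apply: perm_onM kX _.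
    apply: perm_on_sub (tperm_on _ _); rewrite -X'X setUS // sub1set //.
  have kE : k = k' * tperm p q by rewrite -mulgA tperm2 mulg1.
  have [r fr [fkr|[a [b [aX bX ab fkr]]]]] := IH X' k' ltX' X'0 k'X.
    (* This insertion cancels [tperm p q], so the product is [k' * r], which misses only [p]; one
       transposition takes [p] in. *)
    exists (tperm p q * r); first by rewrite -X'X; apply: full_insert.
    right; exists p, q; rewrite pX -X'X in_setU1 qX' orbT eq_sym kp; split=> //.
    rewrite kE -!mulgA !tpermKg mulgA.
    have -> : k' * (r * tperm p q) = k' * r * tperm p q by rewrite mulgA.
    exact: full_insert_r.
  (* Two cycles of [s] fill [X']. The point [p] is inserted so that the product joins it to a point
     of each: [q1], which is imposed by [k], and [c1], chosen on the other cycle by means of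
     [b0]. *)
  pose s := k' * r; have sX : perm_on X' s by apply: perm_onM k'X fr.1.
  have rp : r p = p by apply: (out_perm fr.1).
  have abs : a \notin porbit s b.
    have := @mem_porbit_split_r a b (s * tperm a b) ab.
    by rewrite -!mulgA tperm2 mulg1 !mulgA; apply; rewrite fkr.2.
  have sU : porbit s a :|: porbit s b = X'.
    by rewrite -porbit_merge_r // fkr.2.
  pose q1 := r q; have q1X : q1 \in X' by rewrite perm_closed ?fr.1.
  have [c1 c1X [c1q cU]] : exists2 c1, c1 \in X' &
      c1 \notin porbit s q1 /\ porbit s q1 :|: porbit s c1 = X'.
    have := q1X; rewrite -[in X in X -> _]sU inE => /orP[] qa.
      exists b => //; rewrite -eq_porbit_mem in qa; rewrite (eqP qa) sU.
      by rewrite porbit_sym.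
    exists a => //; rewrite -eq_porbit_mem in qa; rewrite (eqP qa) setUC sU.
    by [].
  pose b0 := r^-1 c1; have b0X : b0 \in X'.
    by rewrite perm_closed // perm_onV // fr.1.
  exists (tperm p b0 * r); first by rewrite -X'X; apply: full_insert.
  left; have -> : k * (tperm p b0 * r) = s * tperm p q1 * tperm p c1.
    have -> : tperm p q1 = tperm p q ^ r by rewrite tpermJ rp.
    have -> : tperm p c1 = tperm p b0 ^ r by rewrite tpermJ rp permKV.
    by rewrite kE !conjgE /s -!mulgA !mulKVg.
  have pX1 : p \notin porbit s q1.
    by apply: contra pX' => /(subsetP (porbit_on_sub sX q1X)).
  have ps : porbit s p = [set p] by rewrite porbit_eq_id // (out_perm sX).
  have pE : porbit (s * tperm p q1) p = p |: porbit s q1.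
    by rewrite porbit_merge_r // ps.
  have pc : p \notin porbit (s * tperm p q1) c1.
    rewrite porbit_sym pE !inE negb_or c1q andbT.
    by apply: contraTneq c1X => ->.
  apply: (@full_intro _ _ p) => //.
    apply: perm_onM; last first.
      by apply: perm_on_sub (tperm_on _ _); rewrite -X'X setUS // sub1set.
    apply: perm_onM; last first.
      by apply: perm_on_sub (tperm_on _ _); rewrite -X'X setUS // sub1set.
    by apply: perm_on_sub sX; rewrite -X'X subsetUr.
  rewrite porbit_merge_r // pE -X'X.
  have -> : porbit (s * tperm p q1) c1 = porbit s c1.
    rewrite -porbitV invMg tpermV porbit_merge_out ?porbitV //.
    by rewrite ps inE; apply: contraTneq c1X => ->.
  by rewrite -setUA cU.
- have -> : X = [set p] by rewrite -(setD1K pX) X1 setU0.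
  have -> : k = 1.
    apply/permP => u; rewrite perm1; have [->|up] := eqVneq u p.
      have := perm_closed p kX; rewrite pX => kpX.
      apply/eqP; have : k p \notin X :\ p by rewrite X1 inE.
      by rewrite !inE kpX andbT negbK.
    apply: (out_perm kX); have : u \notin X :\ p by rewrite X1 inE.
    by rewrite !inE up.
  by exists 1; [exact: full1|left; rewrite mulg1; exact: full1].
Qed.

End TwoCycles.

(** * Completing a permutation by two full cycles *)

Section UpperBound.
Local Open Scope group_scope.
Variable T : finType.
Implicit Types (s t r k : {perm T}) (a b u v z : T) (S Z X Y O : {set T}).

Definition pure X s := [set porbit s u | u in X & porbit s u \subset X].

Definition leaving X s := [set a in X | s a \notin X].

Lemma pureP X s O : reflect (exists u, [/\ u \in X, porbit s u \subset X & O = porbit s u])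
  (O \in pure X s).
Proof.
apply: (iffP imsetP) => [[u /[!inE] /andP[uX sX] ->]|[u [uX sX ->]]].
  by exists u.
by exists u; rewrite // inE uX.
Qed.

(** Only the points that [s] maps to [b] or to [c] get a new image. The first is outside [X] and the
    second is mapped outside [X], so neither is on a cycle inside [X]. *)
Lemma pure_tperm X s b c : s^-1 b \notin X -> c \notin X ->
  pure X s \subset pure X (s * tperm b c).
Proof.
move=> sb cX; apply/subsetP => O /pureP[u [uX sX ->]]; apply/pureP; exists u.
have E : porbit s u = porbit (s * tperm b c) u.
  apply: (@porbit_eq_in _ _ _ (porbit s u)); rewrite ?porbit_id // => v vu.
    have sv : s v \in X by apply: (subsetP sX); rewrite mem_porbit1.
    rewrite permM tpermD //; last by apply: contraNneq cX => ->.
    by apply: contraNneq sb => ->; rewrite permK (subsetP sX).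
  by rewrite mem_porbit1.
by rewrite -E.
Qed.

Lemma pureN X s b O : s^-1 b \notin X -> b \in O -> O \notin pure X s.
Proof.
move=> sb bO; apply: contra sb => /pureP[u [uX sX OE]]; apply: (subsetP sX).
by rewrite -mem_porbit1 permKV -OE.
Qed.

Lemma leaving0P X s : reflect (forall u, u \in X -> s u \in X) (leaving X s == set0).
Proof.
apply: (iffP eqP) => [/setP E u uX|E].
  by have := E u; rewrite !inE uX => /negbFE.
by apply/setP => u; rewrite !inE; apply/negP => /andP[/E ->].
Qed.

Lemma pure_stable X s : leaving X s = set0 -> pure X s = porbit s @: X.
Proof.
move=> /eqP/leaving0P st; apply/setP => O; apply/pureP/imsetP.
  by move=> [u [uX _ ->]]; exists u.
by move=> [u uX ->]; exists u; rewrite porbit_stable.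
Qed.

Lemma card_pure_stable X s : (forall u, u \in X -> s u \in X) ->
  plen (restr_perm X s) + #|porbit s @: X| = #|X|.
Proof.
move=> st; have sN : s \in 'N(X | 'P).
  by rewrite inE; apply/andP; split; rewrite ?inE //; apply/subsetP => u uX; rewrite !inE; apply: st.
rewrite -(plen_on (restr_perm_on X s)); congr addn; congr #|pred_of_set _|.
apply: eq_in_imset => u uX; symmetry.
apply: (@porbit_eq_in _ _ _ X) => // v vX.
  by rewrite restr_permE.
by rewrite perm_closed ?restr_perm_on.
Qed.

(** If [k] preserves [X], this is the triangle inequality for lengths on [X], where [r] has length
    [#|X| - 1]; hence the extra 1. Otherwise a run of [k] inside [X] is closed into a cycle, which
    trades one passage for one cycle. *)
Lemma pure_bound X r k : X != set0 -> (forall u, u \in X -> porbit r u = X) ->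
  #|pure X k| + #|pure X (r * k)| + #|leaving X k| <= #|X| + (leaving X k == set0).
Proof.
move=> X0 pX; have rX u : (r u \in X) = (u \in X).
  apply/idP/idP => [|uX]; last by rewrite -(pX u uX) mem_porbit1 porbit_id.
  by move=> ruX; rewrite -(pX _ ruX) porbit_sym mem_porbit1 porbit_id.
have [n] := ubnP #|leaving X k|; elim: n k => // n IH k ltn.
have [L0|] := eqVneq (leaving X k) set0.
  have kX := L0; move/eqP/leaving0P in kX.
  have L0' : leaving X (r * k) = set0.
    by apply/eqP/leaving0P => u uX; rewrite permM kX ?rX.
  rewrite !pure_stable // L0 cards0 addn0.
  have := card_pure_stable kX.
  have := card_pure_stable (fun u uX => etrans (rX u) uX).
  have rkX : forall u, u \in X -> (r * k) u \in X.
    by move=> u uX; rewrite permM kX ?rX.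
  have := card_pure_stable rkX.
  have -> : porbit r @: X = [set X].
    have [u uX] := set0Pn _ X0; apply/setP => O; rewrite inE.
    by apply/imsetP/eqP => [[v vX ->]|->]; [apply: pX | exists u; rewrite ?pX].
  have -> : restr_perm X (r * k) = restr_perm X r * restr_perm X k.
    rewrite morphM //; rewrite inE; apply/andP; split; rewrite ?inE //;
      apply/subsetP => u uX; rewrite !inE /= /aperm ?rX //; exact: kX.
  rewrite cards1; have := plen_triangle (restr_perm X r) (restr_perm X k).
  set n1 := plen _; set n2 := plen _; set n3 := plen _; lia.
case/set0Pn => a aL; have /setIdP[aX kaX] := aL.
(* The run to be closed begins at [b], the first return to [X] after the exit at [a], and ends at
   [a'], the last point before the next exit. *)
have [i [i_gt ki ki_min]] : exists i, [/\ 0 < i, (k ^+ i) (k a) \in X &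
    forall j, j < i -> (k ^+ j) (k a) \notin X].
  have ex : exists i, (k ^+ i) (k a) \in X.
    have : a \in porbit k (k a) by rewrite porbit_sym mem_porbit1 porbit_id.
    by case/porbitP => i E; exists i; rewrite -E.
  case: (ex_minnP ex) => i ki mini; exists i; split=> //.
    by case: i ki {mini} => //; rewrite expg0 perm1 (negPf kaX).
  by move=> j ji; apply: contraL ji => /mini; rewrite -leqNgt.
set b := (k ^+ i) (k a) in ki.
have kbX : k^-1 b \notin X.
  have -> : b = k ((k ^+ i.-1) (k a)) by rewrite /b -{1}(prednK i_gt) expgSr permM.
  by rewrite permK; apply: ki_min; rewrite ltn_predL.
have [j [kj kj_min]] : exists j, k ((k ^+ j) b) \notin X /\
    forall l, l <= j -> (k ^+ l) b \in X.
  have ex : exists j, (k ^+ j) b \notin X.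
    have : k^-1 b \in porbit k b by rewrite -mem_porbit1 permKV porbit_id.
    by case/porbitP => j E; exists j; rewrite -E.
  case: (ex_minnP ex) => -[|j] kj minj; first by move: kj; rewrite expg0 perm1 ki.
  exists j; split; first by rewrite -permM -expgSr.
  by move=> l lj; apply: contraLR lj => /minj; rewrite -ltnNge.
set a' := (k ^+ j) b in kj.
have a'X : a' \in X by apply: kj_min.
pose k' := k * tperm b (k a').
have k'D v : v != a' -> k v != b -> k' v = k v.
  by move=> va vb; rewrite permM tpermD ?(inj_eq perm_inj) // eq_sym.
have k'a : k' a' = b by rewrite permM tpermR.
have LE : leaving X k' = leaving X k :\ a'.
  apply/setP => v; rewrite !inE; have [->|va] := eqVneq v a'.
    by rewrite k'a ki andbF.
  have [vb|vb] := eqVneq (k v) b; last by rewrite k'D.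
  by have -> : v \in X = false by rewrite -[v](permK k) vb; apply/negbTE.
have a'L : a' \in leaving X k by rewrite inE a'X kj.
have cL : #|leaving X k| = #|leaving X k'|.+1 by rewrite LE (cardsD1 a') a'L.
have P1 : #|pure X k| < #|pure X k'|.
  apply: proper_card; rewrite properE pure_tperm //=; apply/subsetPn.
  exists (porbit k' b); last by apply: pureN kbX _; rewrite porbit_id.
  apply/pureP; exists b; split=> //.
  pose S := [set (k ^+ (l : nat)) b | l : 'I_j.+1].
  have SX : S \subset X.
    by apply/subsetP => v /imsetP[l _ ->]; apply: kj_min; rewrite -ltnS.
  apply: subset_trans SX; apply: porbit_stable; last first.
    by apply/imsetP; exists ord0; rewrite ?expg0 ?perm1.
  move=> v /imsetP[l _ ->].
  have [lj|lj] := eqVneq (l : nat) j.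
    by rewrite lj k'a; apply/imsetP; exists ord0; rewrite ?expg0 ?perm1.
  have ltl : l.+1 < j.+1 by have := ltn_ord l; move/eqP: lj; lia.
  have kl : k ((k ^+ l) b) = (k ^+ l.+1) b by rewrite expgSr permM.
  rewrite k'D ?kl; first by apply/imsetP; exists (Ordinal ltl).
    apply: contraNneq kj => E; rewrite -/a' -E kl; exact: (kj_min l.+1).
  apply: contraNneq kbX => <-; rewrite -kl permK.
  by apply: kj_min; apply: ltnW.
have rkb : (r * k)^-1 b \notin X.
  by rewrite invMg permM -rX permKV.
have rkE : r * k' = r * k * tperm b (k a') by rewrite mulgA.
(* Closing the last run makes [X] stable under [r * k'], so a cycle inside [X] appears there as
   well; it pays for the extra 1 in the bound for [k']. *)
have P2 : #|pure X (r * k)| + (leaving X k' == set0) <= #|pure X (r * k')|.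
  have sub : pure X (r * k) \subset pure X (r * k') by rewrite rkE pure_tperm.
  have [L0|_] := eqVneq (leaving X k') set0; last by rewrite addn0 subset_leq_card.
  rewrite addn1; apply: proper_card; rewrite properE sub /=; apply/subsetPn.
  exists (porbit (r * k') b); last by apply: pureN rkb _; rewrite porbit_id.
  apply/pureP; exists b; split=> //; apply: porbit_stable => // u uX.
  by rewrite permM; move/eqP/leaving0P: L0; apply; rewrite rX.
have := IH k'; rewrite -ltnS -cL ltn => /(_ isT) {IH}.
move: P1 P2 cL; set n1 := #|pure X k|; set n2 := #|pure X k'|.
set n3 := #|pure X (r * k)|; set n4 := #|pure X (r * k')|.
case: (leaving X k' == set0); rewrite /= ?addn0; lia.
Qed.

End UpperBound.

(** * Lower bound for the completed length, and alternation *)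

Section LowerBound.
Local Open Scope group_scope.
Variable T : finType.
Implicit Types (s t r k : {perm T}) (a b u v z : T) (S Z X Y O : {set T}).

Definition mixed X s := [set porbit s u | u in X & ~~ (porbit s u \subset X)].

Lemma mixedP X s O : reflect (exists u, [/\ u \in X, ~~ (porbit s u \subset X) & O = porbit s u])
  (O \in mixed X s).
Proof.
apply: (iffP imsetP) => [[u /[!inE] /andP[uX sX] ->]|[u [uX sX ->]]].
  by exists u.
by exists u; rewrite // inE uX.
Qed.

Lemma mixed_le X s : #|mixed X s| <= #|leaving X s|.
Proof.
apply: leq_trans (leq_imset_card (porbit s) _); apply: subset_leq_card.
apply/subsetP => O /mixedP[u [uX nsub ->]].
have [/existsP[v /and3P[vu vX svX]]|/existsPn H] :=
    boolP [exists v, [&& v \in porbit s u, v \in X & s v \notin X]].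
  apply/imsetP; exists v; first by rewrite inE vX.
  by rewrite -eq_porbit_mem in vu; rewrite (eqP vu).
case/negP: nsub; apply/subsetP => v.
case/porbitP => i ->; elim: i => [|i IH]; first by rewrite expg0 perm1.
have := H ((s ^+ i) u); rewrite mem_porbit IH /= negbK.
by rewrite -permM -expgSr.
Qed.

(* Some cycle of s visits X, Y, X, Y in this cyclic order: cutting it at two
   points of X yields two cycles which both visit Y. *)
Definition alt X Y s := exists a a', [/\ a \in X, a' \in X, a != a',
  a \in porbit s a' & (exists2 y, y \in Y & y \in porbit (tperm a a' * s) a) /\
                      (exists2 y, y \in Y & y \in porbit (tperm a a' * s) a')].

Lemma leaving_tperm X s a b : a \in X -> b \in X ->
  #|leaving X (tperm a b * s)| = #|leaving X s|.
Proof.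
move=> aX bX; rewrite -[RHS](card_imset _ (@perm_inj _ (tperm a b))).
congr #|pred_of_set _|; have tX v : (tperm a b v \in X) = (v \in X).
  by case: tpermP => // ->; rewrite aX bX.
apply/setP => v; rewrite inE permM; apply/andP/imsetP => [[vX sv]|[w]].
  by exists (tperm a b v); rewrite ?tpermK // inE tX vX.
by rewrite inE => /andP[wX sw] ->; rewrite tX tpermK.
Qed.

(** Cutting the alternating cycle at its two points of [X] gives one more cycle meeting both sets
    and keeps the number of passages; [mixed_le] is applied after the cut. *)
Lemma mixed_alt X Y s : [disjoint X & Y] -> alt X Y s ->
  #|mixed X s| < #|leaving X s|.
Proof.
move=> dXY [a [a' [aX a'X ne aa' [[y yY ya] [y' y'Y y'a']]]]].
rewrite -(leaving_tperm s aX a'X); apply: leq_trans (mixed_le _ _).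
set t := _ * s in ya y'a' *.
have sE : s = tperm a a' * t by rewrite tpermKg.
have naa' : a \notin porbit t a'.
  by rewrite mem_porbit_plen // -sE (plen_split aa' ne) ltnNge leqnSn.
have nY u : u \in Y -> u \notin X by move=> uY; rewrite (disjointFl dXY).
have O1 : porbit t a \in mixed X t.
  apply/mixedP; exists a; split=> //; apply/subsetPn; exists y => //; exact: nY.
have O2 : porbit t a' \in mixed X t.
  apply/mixedP; exists a'; split=> //; apply/subsetPn; exists y' => //; exact: nY.
have O12 : porbit t a != porbit t a' by rewrite eq_porbit_mem.
have sub : mixed X s \subset porbit s a |: (mixed X t :\ porbit t a :\ porbit t a').
  apply/subsetP => O /mixedP[u [uX nsub ->]]; rewrite !inE.
  rewrite eq_porbit_mem {1}sE porbit_merge // inE.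
  have [uta|uta] /= := boolP (u \in porbit t a); first by [].
  have [uta'|uta'] /= := boolP (u \in porbit t a'); first by [].
  have uE : porbit s u = porbit t u by rewrite sE porbit_merge_out.
  rewrite uE !eq_porbit_mem uta uta' /=; apply/mixedP; exists u; split=> //.
  by rewrite -uE.
have := subset_leq_card sub; rewrite cardsU1.
have := cardsD1 (porbit t a) (mixed X t); rewrite O1.
have := cardsD1 (porbit t a') (mixed X t :\ porbit t a).
rewrite in_setD1 O2 andbT eq_sym O12; by case: (_ \notin _); rewrite /=; clear; lia.
Qed.

Definition alternates X Y s := alt X Y s \/ alt Y X s.

(** With passages, the least length of [rX * rY * k] over full cycles is this number or one more, as
    parity dictates; without passages it is two less. *)
Definition base X Y k := #|pure X k| + #|pure Y k| + #|leaving X k|.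

Lemma plen_ge X Y s : [disjoint X & Y] -> perm_on (X :|: Y) s ->
  #|X| + #|Y| <= plen s + #|pure X s| + #|pure Y s| + #|mixed X s|.
Proof.
move=> dXY sZ; have := plen_on sZ; rewrite cardsU disjoint_setI0 // cards0 subn0 => <-.
rewrite -!addnA leq_add2l.
have sub : porbit s @: (X :|: Y) \subset pure X s :|: (pure Y s :|: mixed X s).
  apply/subsetP => O /imsetP[u]; rewrite !inE => uZ ->.
  have mX v : v \in X -> (porbit s v \in pure X s) || (porbit s v \in mixed X s).
    move=> vX; have [sub|nsub] := boolP (porbit s v \subset X).
      by apply/orP; left; apply/pureP; exists v.
    by apply/orP; right; apply/mixedP; exists v.
  have [/existsP[v /andP[vu vX]]|/existsPn H] := boolP [exists v, (v \in porbit s u) && (v \in X)].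
    have := mX v vX; rewrite -eq_porbit_mem in vu; rewrite (eqP vu).
    by case/orP => ->; rewrite ?orbT.
  apply/orP; right; apply/orP; left.
  apply/pureP; exists u; split=> //.
    by case/orP: uZ => // uX; have := H u; rewrite porbit_id uX.
  apply/subsetP => v vu; have := H v; rewrite vu /= => vX.
  have : v \in X :|: Y by apply: subsetP vu; apply: porbit_on_sub; rewrite ?inE.
  by rewrite inE (negPf vX).
apply: leq_trans (subset_leq_card sub) _.
by rewrite !cardsU; clear; lia.
Qed.

Section Two.
Variables X Y : {set T}.
Hypotheses (dXY : [disjoint X & Y]) (X0 : X != set0) (Y0 : Y != set0).

(** A permutation enters a finite set as often as it leaves it. *)
Lemma card_leaving k : perm_on (X :|: Y) k -> #|leaving X k| = #|leaving Y k|.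
Proof.
move=> kZ; have -> : leaving X k = X :\: k @^-1: X.
  by apply/setP => u; rewrite !inE andbC.
have -> : leaving Y k = (k @^-1: X) :\: X.
  apply/setP => u; rewrite !inE; have := perm_closed u kZ; rewrite !inE.
  have := disjointFr dXY (x := u); have := disjointFr dXY (x := k u).
  case: (k u \in X) => [/(_ isT) ->|_]; case: (u \in X) => [/(_ isT) ->|_] //=.
    by move=> <-.
  by move=> <-; rewrite andbN.
have := cardsID (k @^-1: X) X; have := cardsID X (k @^-1: X).
rewrite (setIC X) card_preimset; last exact: perm_inj.
by clear; lia.
Qed.

Lemma full_prod rX rY : full_cycle X rX -> full_cycle Y rY ->
  [/\ forall u, u \in X -> porbit (rX * rY) u = X,
      forall u, u \in Y -> porbit (rX * rY) u = Y & perm_on (X :|: Y) (rX * rY)].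
Proof.
move=> [rXX pX] [rYY pY].
have EX u : u \in X -> (rX * rY) u = rX u.
  by move=> uX; rewrite permM (out_perm rYY) // (disjointFr dXY) // perm_closed.
have EY u : u \in Y -> (rX * rY) u = rY u.
  by move=> uY; rewrite permM (out_perm rXX) // (disjointFl dXY).
split.
- move=> u uX; rewrite -[RHS](pX u uX).
  by apply: (@porbit_eq_in _ _ _ X) => // v vX; rewrite EX // perm_closed.
- move=> u uY; rewrite -[RHS](pY u uY).
  by apply: (@porbit_eq_in _ _ _ Y) => // v vY; rewrite EY // perm_closed.
- by apply: perm_onM; [apply: perm_on_sub rXX; rewrite subsetUl
                      |apply: perm_on_sub rYY; rewrite subsetUr].
Qed.

Lemma plen_le_pure s : perm_on (X :|: Y) s ->
  plen s + #|pure X s| + #|pure Y s| <= #|X| + #|Y|.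
Proof.
move=> sZ; have := plen_on sZ; rewrite cardsU disjoint_setI0 // cards0 subn0 => <-.
rewrite -addnA leq_add2l.
have dP : pure X s :&: pure Y s = set0.
  apply/setP => O; rewrite !inE; apply/negP => /andP[/pureP[u [uX uS ->]]].
  case/pureP => v [vY vS E]; have := porbit_id s u; rewrite E => /(subsetP vS).
  by rewrite (disjointFr dXY).
rewrite -[leqLHS]subn0 -(cards0 {set T}) -dP -cardsU; apply: subset_leq_card.
rewrite subUset; apply/andP; split; apply/subsetP => O /pureP[u [uX uS ->]].
  by apply: imset_f; rewrite inE uX.
by apply: imset_f; rewrite inE uX orbT.
Qed.

Section Bounds.
Variables (k rX rY : {perm T}).
Hypotheses (kZ : perm_on (X :|: Y) k) (fX : full_cycle X rX) (fY : full_cycle Y rY).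

Lemma leaving_full : leaving X k != set0 ->
  #|leaving X (rX * rY * k)| = #|leaving X k|.
Proof.
have [pX _ _] := full_prod fX fY; set r := rX * rY in pX *; move=> _.
have rXX u : (r u \in X) = (u \in X).
  apply/idP/idP => [|uX]; last by rewrite -(pX u uX) mem_porbit1 porbit_id.
  by move=> ruX; rewrite -(pX _ ruX) porbit_sym mem_porbit1 porbit_id.
rewrite -(card_imset (leaving X (r * k)) (@perm_inj _ r)).
congr #|pred_of_set _|; apply/setP => v; apply/imsetP/setIdP => [[w]|[vX kv]].
  by rewrite inE permM => /andP[wX kw] ->; rewrite rXX.
by exists (r^-1 v); rewrite ?permKV // inE permM permKV kv -rXX permKV vX.
Qed.

(** The sum of [pure_bound] for [X] and for [Y] contains the passages twice. One copy pays for the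
    cycles meeting both sets, with one unit to spare when some cycle alternates; the other copy
    remains in [base]. *)
Lemma plen_full_ge : leaving X k != set0 ->
  base X Y k <= plen (rX * rY * k) /\
  (alternates X Y (rX * rY * k) -> base X Y k < plen (rX * rY * k)).
Proof.
move=> L0; have [pX pY rZ] := full_prod fX fY.
have lE := leaving_full L0.
have lXY := card_leaving kZ.
have LY0 : leaving Y k != set0 by rewrite -cards_eq0 -lXY cards_eq0.
have bX := pure_bound k X0 pX; have bY := pure_bound k Y0 pY.
rewrite (negPf L0) in bX; rewrite (negPf LY0) in bY.
set s := _ * k in lE bX bY *.
have := plen_ge dXY (perm_onM rZ kZ); rewrite -/s => G; rewrite /base.
have := mixed_le X s => M; split; first by move: G M bX bY lE lXY; clear; lia.
case=> [/(mixed_alt dXY)|]; first by move: G M bX bY lE lXY; clear; lia.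
have dYX : [disjoint Y & X] by rewrite disjoint_sym.
move=> /(mixed_alt dYX). have E := card_leaving (perm_onM rZ kZ). rewrite -/s in E.
have kZ' : perm_on (Y :|: X) s by rewrite setUC; apply: perm_onM.
have := plen_ge dYX kZ'; rewrite -/s; move: bX bY lE lXY E; clear; lia.
Qed.

(** The 2 counts the cycles of [rX * rY], whose length enters the triangle inequality. The bound is
    meant for the case without passages. *)
Lemma plen_full_ge0 : base X Y k <= plen (rX * rY * k) + 2 + #|leaving X k|.
Proof.
have [pX pY rZ] := full_prod fX fY.
have := plen_triangle (rX * rY) k; have := plen_le_pure kZ.
have := plen_on rZ; rewrite cardsU disjoint_setI0 // cards0 subn0.
have : #|porbit (rX * rY) @: (X :|: Y)| <= 2.
  apply: leq_trans (subset_leq_card (_ : _ \subset [set X; Y])) _.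
    apply/subsetP => O /imsetP[u /setUP[]uX ->]; rewrite !inE.
      by rewrite pX ?eqxx.
    by rewrite pY ?eqxx ?orbT.
  by rewrite cards2; case: (_ != _).
by rewrite /base; clear; lia.
Qed.

End Bounds.
End Two.
End LowerBound.

(** * Attaining the lower bound *)

Section Attained.
Local Open Scope group_scope.
Variable T : finType.
Implicit Types (s t r k : {perm T}) (a b u v z p q : T) (S Z X Y O : {set T}).

(** With passages, an excess of one over the bound is accepted only from a completion that
    alternates; parity tells later which case occurs. *)
Definition attains X Y k := exists rX rY,
  [/\ full_cycle X rX, full_cycle Y rY &
      if leaving X k == set0 then is_true (plen (rX * rY * k) + 2 <= base X Y k)
      else plen (rX * rY * k) <= base X Y k \/
           (plen (rX * rY * k) <= (base X Y k).+1 /\ alternates X Y (rX * rY * k))].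

Lemma disjoint_perm_comm X Y s t : [disjoint X & Y] -> perm_on X s -> perm_on Y t ->
  s * t = t * s.
Proof. by move=> dXY sX tY; apply: perm_onC sX tY dXY. Qed.

Lemma baseC X Y k : [disjoint X & Y] -> perm_on (X :|: Y) k ->
  base X Y k = base Y X k.
Proof. by move=> dXY kZ; rewrite /base (card_leaving dXY kZ) (addnC #|pure X k|). Qed.

Lemma attainsC X Y k : [disjoint X & Y] -> perm_on (X :|: Y) k ->
  attains X Y k -> attains Y X k.
Proof.
move=> dXY kZ [rX [rY [fX fY H]]]; exists rY, rX; split=> //.
rewrite -baseC // -(disjoint_perm_comm dXY fX.1 fY.1).
rewrite -cards_eq0 -(card_leaving dXY kZ) cards_eq0.
by case: ifP H => // _ [?|[? []]]; [left|right; split=> //; right|right; split=> //; left].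
Qed.

Lemma alt_mono X Y X' Y' s : X' \subset X -> Y' \subset Y -> alt X' Y' s -> alt X Y s.
Proof.
move=> sX sY [a [a' [aX a'X ne aa' [[y yY ya] [y' y'Y ya']]]]].
exists a, a'; split; rewrite ?(subsetP sX) //; split; [exists y | exists y'] => //;
  exact: (subsetP sY).
Qed.

Lemma alternates_mono X Y X' Y' s : X' \subset X -> Y' \subset Y ->
  alternates X' Y' s -> alternates X Y s.
Proof. by move=> sX sY [/(alt_mono sX sY)|/(alt_mono sY sX)]; [left|right]. Qed.

Lemma porbit_merge_sub_r p w s z : p \notin porbit s w ->
  porbit s z \subset porbit (s * tperm p w) z.
Proof.
by move=> pw; rewrite -porbitV -(porbitV (_ * _)) invMg tpermV porbit_merge_sub ?porbitV.
Qed.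

Lemma alt_fix X Y s p w : p \notin X -> s p = p -> p != w -> alt X Y s ->
  alt X Y (s * tperm p w).
Proof.
move=> pX sp pw [a [a' [aX a'X ne aa' [[y yY ya] [y' y'Y ya']]]]].
have H t : t p = p -> p \notin porbit t w.
  by move=> tp; rewrite porbit_sym porbit_eq_id // inE eq_sym.
have tp : (tperm a a' * s) p = p.
  by rewrite permM tpermD // ; apply: contraNneq pX => <-.
exists a, a'; rewrite mulgA; split=> //.
  exact: (subsetP (porbit_merge_sub_r _ (H _ sp))).
by split; [exists y | exists y'] => //; apply: (subsetP (porbit_merge_sub_r _ (H _ tp))).
Qed.

(** The fixed point [p] is inserted next to an arbitrary [q]: the length grows by one, and the cycle
    formed by [p] alone raises [base] at least as much. *)
Lemma attains_fix X Y k p : [disjoint X & Y] -> perm_on (X :|: Y) k ->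
  p \in X -> k p = p -> X :\ p != set0 -> attains (X :\ p) Y k -> attains X Y k.
Proof.
move=> dXY kZ pX kp X'0 [rX [rY [fX fY H]]].
have [q qX'] := set0Pn _ X'0.
have pX' : p \notin X :\ p by rewrite !inE eqxx.
have pY : p \notin Y by rewrite (disjointFr dXY).
have XE : p |: (X :\ p) = X by rewrite setD1K.
exists (rX * tperm p q), rY; split=> //; first by rewrite -[X in full_cycle X]XE; exact: full_insert_r.
have pw : p != k q.
  by apply: contraTneq qX' => E; rewrite -[q](permK k) -E -{1}kp permK (negPf pX').
have -> : rX * tperm p q * rY * k = rX * rY * k * tperm p (k q).
  rewrite -!mulgA; congr (_ * _).
  have -> : tperm p (k q) = tperm p q ^ k by rewrite tpermJ kp.
  rewrite conjgE !mulgA mulgK; congr (_ * _).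
  apply: (@disjoint_perm_comm X Y) => //; last exact: fY.1.
  by apply: perm_on_sub (tperm_on _ _); rewrite -XE setUS // sub1set.
set s := rX * rY * k in H *.
have sp : s p = p.
  by rewrite !permM (out_perm fX.1) // (out_perm fY.1) // kp.
have pws : p \notin porbit s (k q) by rewrite porbit_sym porbit_eq_id // inE eq_sym.
rewrite plen_merge_r //.
have LE : leaving (X :\ p) k = leaving X k.
  apply/setP => u; have kup : (k u == p) = (u == p) by rewrite -{1}kp (inj_eq perm_inj).
  rewrite !inE kup.
  by have [->|up] := eqVneq u p; rewrite /= ?andbF ?kp ?pX ?andbF.
rewrite LE in H.
have bE : base (X :\ p) Y k < base X Y k.
  rewrite /base LE ltn_add2r -addSn leq_add2r; apply: proper_card.
  rewrite properE; apply/andP; split.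
    apply/subsetP => O /pureP[u [uX uS ->]]; apply/pureP; exists u; split=> //.
      by apply: subsetP uX; rewrite subsetDl.
    by apply: subset_trans uS _; rewrite subsetDl.
  apply/subsetPn; exists [set p].
    by apply/pureP; exists p; rewrite porbit_eq_id // sub1set.
  apply/pureP => -[u [uX _ /setP/(_ u)]]; rewrite porbit_id inE => /eqP E.
  by rewrite E (negPf pX') in uX.
case: ifP H => _; first by move: bE; clear; lia.
case=> [H|[H al]]; [left|right; split]; try by move: bE H; clear; lia.
apply: (@alternates_mono _ _ (X :\ p) Y); rewrite ?subsetDl //.
by case: al => al; [left|right]; apply: alt_fix.
Qed.

(** Two consecutive points of a run are treated as one: making them adjacent in the rotation cancels
    [tperm p q], so the completed permutation is the same. *)
Lemma attains_run X Y k p q : [disjoint X & Y] -> perm_on (X :|: Y) k ->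
  p \in X -> q \in X -> p != q -> k p = q ->
  attains (X :\ q) Y (tperm p q * k) -> attains X Y k.
Proof.
move=> dXY kZ pX qX pq kp [rX [rY [fX fY H]]].
have XE : q |: (X :\ q) = X by rewrite setD1K.
exists (rX * tperm q p), rY; split=> //.
  by rewrite -[X in full_cycle X]XE; apply: full_insert_r; rewrite // !inE ?eqxx ?pq.
have -> : rX * tperm q p * rY * k = rX * rY * (tperm p q * k).
  rewrite -!mulgA; congr (_ * _); rewrite !mulgA (tpermC q); congr (_ * _).
  apply: (@disjoint_perm_comm X Y) => //; last exact: fY.1.
  by apply: perm_on_tperm.
set k' := tperm p q * k in H *.
have kq' : k' q = q by rewrite permM tpermR.
have k'q u : (k' u == q) = (u == q) by rewrite -{1}kq' (inj_eq perm_inj).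
have LE : #|leaving (X :\ q) k'| = #|leaving X k|.
  rewrite -[RHS](card_imset _ (@perm_inj _ (tperm p q))); congr #|pred_of_set _|.
  have tX v : (tperm p q v \in X) = (v \in X) by case: tpermP => // ->; rewrite pX qX.
  apply/setP => v; apply/idP/imsetP => [|[w]].
    rewrite !inE k'q => /andP[/andP[vq vX]]; rewrite vq /= => kv.
    by exists (tperm p q v); rewrite ?tpermK // inE tX vX /= -permM.
  rewrite inE => /andP[wX kw] ->; rewrite !inE k'q tX wX andbT.
  have wp : w != p by apply: contraNneq kw => ->; rewrite kp.
  have -> : tperm p q w != q by rewrite -{2}(tpermL p q) (inj_eq perm_inj).
  by rewrite permM tpermK.
rewrite -!cards_eq0 LE in H *.
have bE : base (X :\ q) Y k' <= base X Y k.
  rewrite /base LE leq_add2r; apply: leq_add; last first.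
    apply: subset_leq_card; apply/subsetP => O /pureP[u [uY uS ->]]; apply/pureP.
    exists u; have E : porbit k' u = porbit k u.
      apply: (@porbit_eq_in _ _ _ (porbit k' u)); rewrite ?porbit_id // => v vu.
        by rewrite permM tpermD //; have := subsetP uS _ vu; apply: contraTneq => <-;
          rewrite (disjointFr dXY).
      by rewrite mem_porbit1.
    by rewrite -E.
  (* A cycle of [k'] inside [X :\ q] is a cycle of [k] inside [X] from which [q] has been
     removed. *)
  apply: leq_trans (leq_imset_card (fun O => O :\ q) _); apply: subset_leq_card.
  have kE : k = tperm q p * k' by rewrite tpermC tpermKg.
  have qp : q \notin porbit k' p by rewrite porbit_sym porbit_eq_id // inE.
  have pqk : porbit k' q = [set q] by rewrite porbit_eq_id.
  apply/subsetP => O /pureP[u [uX uS ->]].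
  have /andP[uq uXX] : (u != q) && (u \in X) by rewrite -in_setD1.
  have qu : q \notin porbit k' u by apply/negP => /(subsetP uS); rewrite !inE eqxx.
  have [up|up] := boolP (u \in porbit k' p).
    have E : porbit k u = q |: porbit k' p.
      have : u \in porbit k q by rewrite kE porbit_merge // pqk inE up orbT.
      by rewrite -eq_porbit_mem => /eqP ->; rewrite kE porbit_merge // pqk.
    rewrite -eq_porbit_mem in up.
    apply/imsetP; exists (porbit k u).
      apply/pureP; exists u; split=> //; rewrite E subUset sub1set qX /= -(eqP up).
      by apply: subset_trans uS _; rewrite subsetDl.
    by rewrite E (eqP up) setU1K.
  have E : porbit k u = porbit k' u.
    by rewrite kE porbit_merge_out // pqk inE.
  apply/imsetP; exists (porbit k u).
    apply/pureP; exists u; split=> //; rewrite E.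
    by apply: subset_trans uS _; rewrite subsetDl.
  rewrite E; apply/setP => v; rewrite !inE andbC.
  by have [->|] := eqVneq v q; rewrite ?(negPf qu) // andbT.
case: ifP H => _; first by move: bE; clear; lia.
case=> [H|[H al]]; [left|right; split]; try by move: bE H; clear; lia.
by apply: (@alternates_mono _ _ (X :\ q) Y); rewrite ?subsetDl.
Qed.

End Attained.

Section Attained.
Local Open Scope group_scope.
Variable T : finType.
Implicit Types (s t r k : {perm T}) (a b u v z p q : T) (S Z X Y O : {set T}).

Lemma plen_swap X Y s : [disjoint X & Y] -> #|X| = #|Y| -> perm_on (X :|: Y) s ->
  (forall u, u \in X -> s u \in Y /\ s (s u) = u) ->
  plen s <= #|X| /\ (forall a b, a \in X -> b \in X -> a != b -> a \notin porbit s b).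
Proof.
move=> dXY cXY sZ sX; have sep a b : a \in X -> b \in X -> a != b -> a \notin porbit s b.
  move=> aX bX ab; have [sbY ssb] := sX b bX.
  have sub : porbit s b \subset [set b; s b].
    apply: porbit_stable; last by rewrite !inE eqxx.
    by move=> u /set2P[] ->; rewrite ?ssb !inE eqxx ?orbT.
  apply/negP => /(subsetP sub) /set2P[E|E]; first by rewrite E eqxx in ab.
  by rewrite -E (disjointFr dXY aX) in sbY.
split=> //; have := plen_on sZ; rewrite cardsU disjoint_setI0 // cards0 subn0 -cXY.
suff : #|X| <= #|porbit s @: (X :|: Y)| by clear; lia.
rewrite -[leqLHS](card_in_imset (f := porbit s)).
  by apply: subset_leq_card; apply: imsetS; apply: subsetUl.
move=> a b aX bX /eqP; rewrite eq_porbit_mem => ab.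
by apply/eqP; apply: contraLR ab => ne; apply: sep.
Qed.

(** [rX] comes from [full_cycle_product] for [k * k] on [X], and [rY] is defined so that the
    completed permutation squares to the identity on [X]: it is then a perfect matching of [X] with
    [Y]. For odd sign its square on [X] is a transposition, and two pairs of the matching are joined
    into a cycle through [X], [Y], [X], [Y]. *)
Lemma attains_swap X Y k : [disjoint X & Y] -> X != set0 -> perm_on (X :|: Y) k ->
  (forall u, u \in X -> k u \in Y) -> (forall u, u \in Y -> k u \in X) ->
  attains X Y k.
Proof.
move=> dXY X0 kZ kX kY.
have le1 : #|X| <= #|Y|.
  rewrite -(card_imset X (@perm_inj _ k)); apply: subset_leq_card.
  by apply/subsetP => _ /imsetP[u uX ->]; apply: kX.
have le2 : #|Y| <= #|X|.
  rewrite -(card_imset Y (@perm_inj _ k)); apply: subset_leq_card.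
  by apply/subsetP => _ /imsetP[u uX ->]; apply: kY.
have cXY : #|X| = #|Y| by apply/eqP; rewrite eqn_leq le1.
have YE : k @: X = Y.
  apply/eqP; rewrite eqEcard card_imset ?le2; last exact: perm_inj.
  by rewrite andbT; apply/subsetP => _ /imsetP[u uX ->]; apply: kX.
have nX u : u \in Y -> u \notin X by move=> uY; rewrite (disjointFl dXY).
have LE : leaving X k = X.
  by apply/setP => u; rewrite inE; case: (boolP (u \in X)) => //= uX; rewrite nX ?kX.
have bE : #|X| <= base X Y k by rewrite /base LE leq_addl.
pose b := restr_perm X (k * k).
have bX : perm_on X b by apply: restr_perm_on.
have bXE u : u \in X -> b u = k (k u).
  move=> uX; rewrite restr_permE ?permM // inE; apply/andP; split; rewrite ?inE //.
  by apply/subsetP => v vX; rewrite !inE /= /aperm permM kY ?kX.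
have [rX fX cX] := full_cycle_product X0 bX.
have rXX u : (rX u \in X) = (u \in X) by apply: perm_closed fX.1.
(* [t] is what [full_cycle_product] leaves over: the identity or a transposition. The square of the
   completed permutation on [X] is its inverse, conjugated. *)
have red t : full_cycle X (b * rX * t) -> perm_on X t ->
    exists2 rY, full_cycle Y rY & forall u, u \in X ->
      let s := rX * rY * k in [/\ s u \in Y & s (s u) = (t^-1 ^ rX^-1) u].
  move=> fz tX; have [rY rYE] : exists rY, rY = (b * rX * t)^-1 ^ k by eexists.
  have fY : full_cycle Y rY by rewrite rYE -YE; apply/fullJ/fullV.
  have rYY := fY.1; exists rY => // u uX.
  have E : (rX * rY * k) u = k (rX u).
    by rewrite !permM (out_perm rYY) // (disjointFr dXY) // rXX.
  cbv zeta; rewrite E; split; first by rewrite kX ?rXX.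
  rewrite !permM (out_perm fX.1) ?nX ?kX ?rXX // rYE permJ -bXE; last first.
    rewrite perm_closed ?rXX //; apply: perm_onV; exact: fz.1.
  by rewrite !invMg invgK !permM permKV.
rewrite /attains LE (negPf X0).
case: cX => [fz|[a [c [aX cX ac fz]]]].
  have [rY fY sE] := red 1 ltac:(by rewrite mulg1) (perm_on1 _).
  exists rX, rY; split=> //; left.
  have [_ _ rZ] := full_prod dXY fX fY.
  have sE' u : u \in X -> (rX * rY * k) u \in Y /\ (rX * rY * k) ((rX * rY * k) u) = u.
    by move=> /sE[? ->]; rewrite invg1 conj1g perm1.
  exact: leq_trans (plen_swap dXY cXY (perm_onM rZ kZ) sE').1 bE.
have tacX : perm_on X (tperm a c).
  by apply: perm_on_tperm.
have [rY fY sE] := red _ fz tacX.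
have {}sE : forall u, u \in X -> let s := rX * rY * k in s u \in Y /\
    s (s u) = tperm (rX^-1 a) (rX^-1 c) u.
  move=> u uX s; have [sY ->] := sE u uX.
  by rewrite tpermV tpermJ.
have [_ _ rZ] := full_prod dXY fX fY.
exists rX, rY; split=> //; right.
have sZ := perm_onM rZ kZ.
move: (rX * rY * k) sZ sE => s sZ; cbv zeta => sE.
set a' := rX^-1 a in sE; set c' := rX^-1 c in sE.
have a'X : a' \in X by rewrite -rXX permKV.
have c'X : c' \in X by rewrite -rXX permKV.
have ac' : a' != c' by rewrite (inj_eq perm_inj).
have tX u : (tperm a' c' u \in X) = (u \in X).
  by case: tpermP => // ->; rewrite a'X c'X.
pose s0 := tperm a' c' * s.
have tZ : perm_on (X :|: Y) (tperm a' c').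
  by apply: perm_on_tperm; rewrite inE ?a'X ?c'X.
have s0Z : perm_on (X :|: Y) s0 by apply: perm_onM tZ sZ.
have s0X u : u \in X -> s0 u \in Y /\ s0 (s0 u) = u.
  move=> uX; have [] := sE (tperm a' c' u); rewrite ?tX //= => sY ssE.
  rewrite /s0 !permM; split=> //.
  rewrite [tperm a' c' (s _)]tpermD ?ssE ?tpermK //.
    by apply: contraTneq sY => <-; apply: contraTN a'X => /nX.
  by apply: contraTneq sY => <-; apply: contraTN c'X => /nX.
have [le_s0 sep] := plen_swap dXY cXY s0Z s0X.
have sE0 : s = tperm a' c' * s0 by rewrite tpermKg.
split.
  by rewrite sE0 plen_merge ?sep // ltnS (leq_trans le_s0).
left; exists a', c'; split=> //.
  by rewrite mem_porbit_plen // -/s0 sE0 plen_merge ?sep.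
split; [exists (s0 a')|exists (s0 c')]; rewrite -?/s0 ?mem_porbit1 ?porbit_id //.
  exact: (s0X _ _).1.
exact: (s0X _ _).1.
Qed.

(** Fixed points and consecutive points inside one set are removed until [k] exchanges the two sets,
    or both are singletons and [k = 1]. *)
Lemma full_cycles_attain X Y k : [disjoint X & Y] -> X != set0 -> Y != set0 ->
  perm_on (X :|: Y) k -> attains X Y k.
Proof.
have [n] := ubnP (#|X| + #|Y|); elim: n X Y k => // n IH X Y k ltn dXY X0 Y0 kZ.
have step X' Y' p : #|X'| + #|Y'| < n.+1 -> [disjoint X' & Y'] -> Y' != set0 ->
    perm_on (X' :|: Y') k -> p \in X' -> k p \in X' -> X' != [set p] -> attains X' Y' k.
  move=> lt' d' Y'0 kZ' pX kpX X1.
  have c1 q : q \in X' -> #|X' :\ q| + #|Y'| < n.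
    by move=> qX; move: lt'; rewrite (cardsD1 q X') qX; clear; lia.
  have d1 q : [disjoint X' :\ q & Y'] by apply: disjointWl d'; rewrite subsetDl.
  have ZE q : q \in X' -> (X' :|: Y') :\ q = (X' :\ q) :|: Y'.
    move=> qX; rewrite setDUl; congr (_ :|: _); apply/setDidPl.
    by rewrite disjoint_sym disjoints1 (disjointFr d').
  have [kp|kp] := eqVneq (k p) p.
    have X'0 : X' :\ p != set0.
      by apply: contraNneq X1 => E; rewrite -(setD1K pX) E setU0.
    apply: (@attains_fix _ _ _ _ p) => //; apply: IH; rewrite ?c1 ?d1 //.
    by rewrite -ZE //; apply: perm_onD1.
  apply: (@attains_run _ _ _ _ p (k p)) => //; first by rewrite eq_sym.
  apply: IH; rewrite ?c1 ?d1 //.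
    by apply/set0Pn; exists p; rewrite !inE eq_sym kp.
  rewrite -ZE //; apply: perm_onD1; last by rewrite permM tpermR.
  by apply: perm_onM kZ'; apply: perm_on_tperm; rewrite inE ?pX ?kpX.
have dYX : [disjoint Y & X] by rewrite disjoint_sym.
have kZ' : perm_on (Y :|: X) k by rewrite setUC.
have [/existsP[p /and3P[pX kpX X1]]|/existsPn HX] :=
    boolP [exists p, [&& p \in X, k p \in X & X != [set p]]].
  exact: step pX kpX X1.
have [/existsP[p /and3P[pY kpY Y1]]|/existsPn HY] :=
    boolP [exists p, [&& p \in Y, k p \in Y & Y != [set p]]].
  by apply: (attainsC dYX kZ'); apply: step pY kpY Y1; rewrite // addnC.
have {}HX p : p \in X -> k p \in X -> X = [set p].
  by move=> pX kpX; apply/eqP; have := HX p; rewrite pX kpX negbK.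
have {}HY p : p \in Y -> k p \in Y -> Y = [set p].
  by move=> pY kpY; apply/eqP; have := HY p; rewrite pY kpY negbK.
have kcl u : (k u \in X) || (k u \in Y) = (u \in X) || (u \in Y).
  by have := perm_closed u kZ; rewrite !inE.
(* A point of [X] staying in [X] is now the only one, hence fixed; so [k] preserves [Y], which is a
   singleton for the same reason. *)
have [/existsP[p /andP[pX kpX]]|] := boolP [exists p, (p \in X) && (k p \in X)].
  have X1 := HX p pX kpX.
  have kp : k p = p by move: kpX; rewrite X1 => /set1P.
  have kY u : u \in Y -> k u \in Y.
    move=> uY; have := kcl u; rewrite uY orbT => /orP[] // kuX.
    have : k u = k p by rewrite kp; apply/set1P; rewrite -X1.
    by move/perm_inj => E; rewrite E (disjointFr dXY) in uY.
  have [q qY] := set0Pn _ Y0; have Y1 := HY q qY (kY q qY).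
  have kq : k q = q by have := kY q qY; rewrite Y1 => /set1P.
  have k1 : k = 1.
    apply/permP => u; rewrite perm1; have [->//|up] := eqVneq u p.
    have [->//|uq] := eqVneq u q; apply: (out_perm kZ).
    by rewrite X1 Y1 !inE negb_or up.
  exists 1, 1; split; rewrite ?X1 ?Y1; try exact: full1.
  have -> : leaving [set p] k == set0 by apply/leaving0P => u /set1P ->; rewrite kp inE.
  rewrite k1 !mulg1 plen1 /base.
  have pu (u : T) : pure [set u] 1 != set0.
    apply/set0Pn; exists [set u]; apply/pureP; exists u.
    by rewrite porbit_eq_id ?perm1 // inE eqxx.
  by have := pu p; have := pu q; rewrite -!card_gt0; clear; lia.
rewrite negb_exists => /forallP NX.
have kX u : u \in X -> k u \in Y.
  by move=> uX; have := kcl u; have := NX u; rewrite uX /= => /negPf ->.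
have [/existsP[p /andP[pY kpY]]|/existsPn NY] := boolP [exists p, (p \in Y) && (k p \in Y)].
  have Y1 := HY p pY kpY; have [u uX] := set0Pn _ X0.
  have : k u = k p.
    have := kX u uX; have := kpY; rewrite Y1 => /set1P -> /set1P -> //.
  by move/perm_inj => E; rewrite -E (disjointFr dXY uX) in pY.
apply: attains_swap => // u uY; have := kcl u; have := NY u.
by rewrite uY orbT /= => /negPf ->; rewrite orbF.
Qed.

End Attained.

(** * First return maps *)

Section Reduction.
Local Open Scope group_scope.
Variable T : finType.
Implicit Types (s t r k psi : {perm T}) (a b u v z p q : T) (S Z D X Y O : {set T}).

Lemma plen_split_r a b s : a \in porbit s b -> a != b ->
  plen s = (plen (s * tperm a b)).+1.
Proof. by move=> ab ne; rewrite plenC; apply: plen_split. Qed.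

(* k is the first return map of psi to Z; it is determined by the lengths. *)
Definition reduces D Z psi k (c : nat) : Prop :=
  perm_on Z k /\
  forall r, perm_on (~: (D :\: Z)) r -> plen (r * psi) = plen (r * k) + c.

(** The points of [D] outside [Z] are bypassed one at a time. Since [r] fixes such a point [d], the
    product [r * psi] sends [d] to [psi d], and bypassing a moved [d] costs exactly one unit of
    length, whatever [r] is. *)
Lemma reduction D Z psi : Z \subset D -> perm_on D psi ->
  exists k c, reduces D Z psi k c.
Proof.
have [n] := ubnP #|D :\: Z|; elim: n D psi => // n IH D psi ltn ZD psiD.
have [DZ|[d dDZ]] := set_0Vmem (D :\: Z).
  exists psi, 0; split; last by move=> r _; rewrite addn0.
  by apply: perm_on_sub psiD; rewrite -setD_eq0 DZ.
have /setDP[dD dZ] := dDZ.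
have ZD' : Z \subset D :\ d by rewrite subsetD1 ZD.
have sD' : D :\ d :\: Z \subset D :\: Z by rewrite setSD // subsetDl.
have ltn' : #|D :\ d :\: Z| < n.
  have : D :\ d :\: Z \proper D :\: Z.
    by rewrite properE sD'; apply/subsetPn; exists d; rewrite // !inE eqxx andbF.
  by move/proper_card => H; apply: leq_trans H _.
have pick_r r : perm_on (~: (D :\: Z)) r ->
    perm_on (~: (D :\ d :\: Z)) r /\ r d = d.
  move=> rQ; split; first by apply: perm_on_sub rQ; rewrite setCS.
  by apply: (out_perm rQ); rewrite inE negbK.
have [pd|pd] := eqVneq (psi d) d.
  have [k [c [kZ H]]] := IH _ _ ltn' ZD' (perm_onD1 psiD pd).
  by exists k, c; split=> // r /pick_r[rQ _]; apply: H.
have pdD : psi d \in D by rewrite perm_closed.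
have psi'D : perm_on (D :\ d) (psi * tperm d (psi d)).
  apply: perm_onD1; last by rewrite permM tpermR.
  by apply: perm_onM psiD _; apply: perm_on_tperm.
have [k [c [kZ H]]] := IH _ _ ltn' ZD' psi'D.
exists k, c.+1; split=> // r /pick_r[rQ rd].
rewrite addnS -H // mulgA; apply: plen_split_r; last by rewrite eq_sym.
by rewrite porbit_sym -{1}rd -permM mem_porbit1 porbit_id.
Qed.

(** Testing with the inverse of each candidate yields [c' = plen (k'^-1 * k) + c] and
    [c = plen (k^-1 * k') + c'], so both lengths vanish. *)
Lemma reduces_uniq D Z psi k k' c c' : 
  reduces D Z psi k c -> reduces D Z psi k' c' -> k = k' /\ c = c'.
Proof.
move=> [kZ H] [kZ' H'].
have sZ : Z \subset ~: (D :\: Z).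
  by apply/subsetP => u uZ; rewrite !inE uZ.
have kQ : perm_on (~: (D :\: Z)) k^-1 by apply: perm_on_sub (perm_onV kZ).
have kQ' : perm_on (~: (D :\: Z)) k'^-1 by apply: perm_on_sub (perm_onV kZ').
have := H _ kQ; have := H' _ kQ; have := H _ kQ'; have := H' _ kQ'.
rewrite !mulVg !plen1 !add0n => -> E1 -> E2.
have cc : c' = c by move: E1 E2; clear; lia.
have : plen (k'^-1 * k) = 0 by apply: (@addIn c); rewrite add0n -E1.
by move/plen_eq0 => /eqP; rewrite -eq_mulVg1 => /eqP ->.
Qed.

(** One factor is reduced at a time while the other, having disjoint support, is absorbed into
    [r]. *)
Lemma reduces_prod D1 D2 Z1 Z2 psi1 psi2 k1 k2 c1 c2 :
  [disjoint D1 & D2] -> Z1 \subset D1 -> Z2 \subset D2 ->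
  perm_on D1 psi1 -> perm_on D2 psi2 ->
  reduces D1 Z1 psi1 k1 c1 -> reduces D2 Z2 psi2 k2 c2 ->
  reduces (D1 :|: D2) (Z1 :|: Z2) (psi1 * psi2) (k1 * k2) (c1 + c2).
Proof.
move=> dD ZD1 ZD2 p1D p2D [k1Z H1] [k2Z H2].
split.
  apply: perm_onM; [apply: perm_on_sub k1Z|apply: perm_on_sub k2Z].
    exact: subsetUl.
  exact: subsetUr.
move=> r rQ.
have Q1 : ~: ((D1 :|: D2) :\: (Z1 :|: Z2)) \subset ~: (D1 :\: Z1).
  rewrite setCS; apply/subsetP => u; rewrite !inE negb_or => /andP[-> uD]; rewrite uD andbT.
  by apply/negP => /(subsetP ZD2); rewrite (disjointFr dD uD).
have Q2 : ~: ((D1 :|: D2) :\: (Z1 :|: Z2)) \subset ~: (D2 :\: Z2).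
  rewrite setCS; apply/subsetP => u; rewrite !inE negb_or => /andP[-> uD]; rewrite uD orbT !andbT.
  by apply/negP => /(subsetP ZD1) uD1; rewrite (disjointFr dD uD1) in uD.
have c12 : psi1 * psi2 = psi2 * psi1 by apply: disjoint_perm_comm p1D p2D.
have d21 : [disjoint D2 & D1] by rewrite disjoint_sym.
have k12 : psi2 * k1 = k1 * psi2.
  by apply: (disjoint_perm_comm d21) => //; apply: perm_on_sub k1Z.
rewrite c12 mulgA H1; last first.
  apply: perm_onM; first exact: perm_on_sub rQ.
  apply: perm_on_sub p2D; apply/subsetP => u uD; rewrite !inE negb_and.
  by rewrite (disjointFl dD uD) orbT.
rewrite -mulgA k12 mulgA H2 ?mulgA; last first.
  apply: perm_onM; first exact: perm_on_sub rQ.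
  apply: perm_on_sub k1Z; apply/subsetP => u /(subsetP ZD1) uD; rewrite !inE negb_and.
  by rewrite (disjointFr dD uD) orbT.
by rewrite -addnA (addnC c1).
Qed.

Lemma reduces_porbit D Z psi k c r u v : reduces D Z psi k c -> Z \subset D ->
  perm_on (~: (D :\: Z)) r -> u \in Z -> v \in Z ->
  (u \in porbit (r * psi) v) = (u \in porbit (r * k) v).
Proof.
move=> [kZ H] ZD rQ uZ vZ.
have [->|uv] := eqVneq u v; first by rewrite !porbit_id.
rewrite !mem_porbit_plen // !mulgA !H ?ltn_add2r //.
by apply: perm_onM rQ; apply: perm_on_tperm; rewrite !inE ?uZ ?vZ.
Qed.

Lemma reduces_alt D Z psi k c r X Y : reduces D Z psi k c -> Z \subset D ->
  perm_on (~: (D :\: Z)) r -> X \subset Z -> Y \subset Z ->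
  alt X Y (r * psi) <-> alt X Y (r * k).
Proof.
move=> red ZD rQ XZ YZ.
have P := reduces_porbit red ZD.
have tQ a a' : a \in X -> a' \in X -> perm_on (~: (D :\: Z)) (tperm a a' * r).
  by move=> aX a'X; apply: perm_onM rQ; apply: perm_on_tperm; rewrite !inE (subsetP XZ).
have XZ' := subsetP XZ; have YZ' := subsetP YZ.
split=> -[a [a' [aX a'X ne aa' [[y yY ya] [y' y'Y ya']]]]];
  move: (XZ' _ aX) (XZ' _ a'X) (YZ' _ yY) (YZ' _ y'Y) (tQ _ _ aX a'X) => aZ a'Z yZ y'Z taQ;
  exists a, a'; split=> //.
- by rewrite -P.
- by move: ya ya'; rewrite !mulgA !P // => ? ?; split; [exists y|exists y'].
- by rewrite P.
- by move: ya ya'; rewrite !mulgA -!P // => ? ?; split; [exists y|exists y'].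
Qed.

Lemma reduces_alternates D Z psi k c r X Y : reduces D Z psi k c -> Z \subset D ->
  perm_on (~: (D :\: Z)) r -> X \subset Z -> Y \subset Z ->
  alternates X Y (r * psi) <-> alternates X Y (r * k).
Proof.
move=> red ZD rQ XZ YZ; rewrite /alternates.
by rewrite (reduces_alt red ZD rQ XZ YZ) (reduces_alt red ZD rQ YZ XZ).
Qed.

(** For nonempty [X] and [Y], the parity of [plen (rX * rY * k) + base X Y k], common to all full
    cycles [rX] and [rY]. *)
Definition parity X Y k : bool := odd (base X Y k + #|X| + #|Y|) (+) odd_perm k.

(* 0: no face meets both terminals; 1: some face does; 2: some face does, and
   the parity forces an alternating face in an optimal completion. *)
Definition ftype X Y k : nat :=
  if leaving X k == set0 then 0 else if parity X Y k then 2 else 1%N.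

(** A side without passages is neutral; otherwise the parities add. *)
Definition comb (t1 t2 : nat) : nat :=
  if t1 == 0 then t2 else if t2 == 0 then t1 else
  if (t1 == 2) (+) (t2 == 2) then 2 else 1%N.

Section Two.
Variables X Y : {set T}.
Hypotheses (dXY : [disjoint X & Y]) (X0 : X != set0) (Y0 : Y != set0).

Lemma plen_parity k rX rY : full_cycle X rX -> full_cycle Y rY ->
  odd (plen (rX * rY * k) + base X Y k) = parity X Y k.
Proof.
move=> fX fY; rewrite /parity oddD -odd_plen !odd_permM !odd_plen.
have [[u uX] [v vY]] := (set0Pn _ X0, set0Pn _ Y0).
rewrite !oddD -(plen_full uX fX) -(plen_full vY fY) /=.
by do 6!case: (odd _).
Qed.

Section Spec.
Variables (D : {set T}) (psi k : {perm T}) (c : nat).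
Hypotheses (red : reduces D (X :|: Y) psi k c) (ZD : X :|: Y \subset D).

Lemma full_perm_on rX rY : full_cycle X rX -> full_cycle Y rY ->
  perm_on (~: (D :\: (X :|: Y))) (rX * rY).
Proof.
move=> fX fY; have [_ _] := full_prod dXY fX fY; apply: perm_on_sub.
by apply/subsetP => u uZ; rewrite !inE -in_setU uZ.
Qed.

(** [(t == 0).*2] is the gain of two units without passages and [t == 2] the unit lost to parity.
    Alternation is impossible in type 0 and costs an extra unit in type 1. *)
Lemma ftype_lower rX rY : full_cycle X rX -> full_cycle Y rY ->
  let t := ftype X Y k in
  c + base X Y k + (t == 2) <= plen (rX * rY * psi) + (t == 0).*2 /\
  (alternates X Y (rX * rY * psi) -> t != 2 ->
   c + base X Y k + (t == 2) < plen (rX * rY * psi) + (t == 0).*2).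
Proof.
move=> fX fY t; have [kZ H] := red.
have rQ := full_perm_on fX fY.
have al : alternates X Y (rX * rY * psi) -> leaving X k != set0 /\
    base X Y k < plen (rX * rY * k).
  move/(reduces_alternates red ZD rQ (subsetUl _ _) (subsetUr _ _)) => al.
  (* Without passages the completed permutation preserves [X], also after the cut in [alt], so no
     cycle meets both sets. *)
  have L0 : leaving X k != set0.
    apply/negP => /leaving0P L0; have [pX pY rZ] := full_prod dXY fX fY.
    have rX' u : u \in X -> (rX * rY) u \in X.
      by move=> uX; rewrite -[in X in _ \in X](pX _ uX) mem_porbit1 porbit_id.
    have rkX u : u \in X -> (rX * rY * k) u \in X.
      by move=> uX; rewrite permM L0 ?rX'.
    have rkt a a' s u : (forall w, w \in X -> s w \in X) -> a \in X -> a' \in X ->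
        u \in X -> (tperm a a' * s) u \in X.
      by move=> sX aX a'X uX; rewrite permM sX //; case: tpermP.
    case: al => -[a [a' [aX a'X _ _ [[y yY ya] _]]]].
      have := subsetP (porbit_stable (fun u => @rkt a a' _ u rkX aX a'X) aX) _ ya.
      by rewrite (disjointFl dXY).
    rewrite porbit_sym in ya.
    have st u : u \in X -> (tperm a a' * (rX * rY * k)) u \in X.
      move=> uX; rewrite permM; have -> : tperm a a' u = u; last exact: rkX.
      by rewrite tpermD //; apply: contraTneq uX => <-; rewrite (disjointFl dXY).
    by have := subsetP (porbit_stable st yY) _ ya; rewrite (disjointFl dXY aX).
  by split=> //; apply: (plen_full_ge dXY X0 Y0 kZ fX fY L0).2.
have par := plen_parity k fX fY; rewrite H // /t /ftype.
have ge0 := plen_full_ge0 dXY kZ fX fY.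
case: (altP (leaving X k =P set0)) => [L0|L0] in al *.
  rewrite L0 cards0 in ge0; split; first by move: ge0; clear; rewrite /=; lia.
  by move/al => [].
have [ge _] := plen_full_ge dXY X0 Y0 kZ fX fY L0.
split; first by move: par ge; case: (parity X Y k); rewrite /=; clear; lia.
by move/al => [_]; move: par; case: (parity X Y k); rewrite //=; clear; lia.
Qed.

(** In type 2 parity excludes the bound itself, which leaves the alternating case of [attains]; in
    type 1 parity excludes an excess of one. *)
Lemma ftype_attained : exists rX rY,
  let t := ftype X Y k in
  [/\ full_cycle X rX, full_cycle Y rY,
      c + base X Y k + (t == 2) = plen (rX * rY * psi) + (t == 0).*2 &
      t == 2 -> alternates X Y (rX * rY * psi)].
Proof.
have [kZ H] := red; have [rX [rY [fX fY A]]] := full_cycles_attain dXY X0 Y0 kZ.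
have rQ := full_perm_on fX fY.
exists rX, rY; cbv zeta; rewrite H //.
have [lo _] := ftype_lower fX fY; rewrite H // in lo.
have par := plen_parity k fX fY.
have al := reduces_alternates red ZD rQ (subsetUl X Y) (subsetUr X Y).
split=> //; move: lo; rewrite /ftype; move: A; case: ifP => _.
- by clear; rewrite /=; lia.
- by move: par; case: (parity X Y k); rewrite /=; clear => ? [|[]]; lia.
- by [].
- case: (parity X Y k) par => //= par A lo _; apply/al.
  by case: A => [A|[]//]; move: par A lo; clear; lia.
Qed.

End Spec.
End Two.

Section Union.
Variables X1 X2 Y1 Y2 : {set T}.
Hypotheses (d1 : [disjoint X1 & Y1]) (d2 : [disjoint X2 & Y2]).
Hypothesis dZ : [disjoint X1 :|: Y1 & X2 :|: Y2].
Variables k1 k2 : {perm T}.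
Hypotheses (k1Z : perm_on (X1 :|: Y1) k1) (k2Z : perm_on (X2 :|: Y2) k2).

Lemma prod_left u : u \in X1 :|: Y1 -> (k1 * k2) u = k1 u.
Proof.
by move=> uZ; rewrite permM (out_perm k2Z) // (disjointFr dZ) // perm_closed.
Qed.

Lemma prod_right u : u \in X2 :|: Y2 -> (k1 * k2) u = k2 u.
Proof. by move=> uZ; rewrite permM (out_perm k1Z) // (disjointFl dZ). Qed.

Lemma porbit_left u : u \in X1 :|: Y1 -> porbit (k1 * k2) u = porbit k1 u.
Proof.
move=> uZ; apply: (@porbit_eq_in _ _ _ (X1 :|: Y1)) => // v vZ.
  exact: prod_left.
by rewrite prod_left // perm_closed.
Qed.

Lemma porbit_right u : u \in X2 :|: Y2 -> porbit (k1 * k2) u = porbit k2 u.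
Proof.
move=> uZ; apply: (@porbit_eq_in _ _ _ (X2 :|: Y2)) => // v vZ.
  exact: prod_right.
by rewrite prod_right // perm_closed.
Qed.

Lemma pure_prod (A1 A2 : {set T}) : A1 \subset X1 :|: Y1 -> A2 \subset X2 :|: Y2 ->
  #|pure (A1 :|: A2) (k1 * k2)| = #|pure A1 k1| + #|pure A2 k2|.
Proof.
move=> s1 s2; have dA : [disjoint A1 & A2] by apply: disjointWl s1 (disjointWr s2 dZ).
have -> : pure (A1 :|: A2) (k1 * k2) = pure A1 k1 :|: pure A2 k2.
  have H1 u : u \in A1 -> (porbit k1 u \subset A1 :|: A2) = (porbit k1 u \subset A1).
    move=> uA; apply/idP/idP => sub; last by apply: subset_trans sub (subsetUl _ _).
    apply/subsetP => v vu; have /setUP[//|/(subsetP s2) vA] := subsetP sub _ vu.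
    have : v \in X1 :|: Y1 by apply: subsetP vu; apply: porbit_on_sub (subsetP s1 _ uA).
    by rewrite (disjointFl dZ).
  have H2 u : u \in A2 -> (porbit k2 u \subset A1 :|: A2) = (porbit k2 u \subset A2).
    move=> uA; apply/idP/idP => sub; last by apply: subset_trans sub (subsetUr _ _).
    apply/subsetP => v vu; have /setUP[/(subsetP s1) vA|//] := subsetP sub _ vu.
    have : v \in X2 :|: Y2 by apply: subsetP vu; apply: porbit_on_sub (subsetP s2 _ uA).
    by rewrite (disjointFr dZ).
  apply/setP => O; rewrite inE; apply/pureP/orP.
    move=> [u [/setUP[]uA sub ->]].
      left; apply/pureP; exists u; rewrite -H1 // -porbit_left ?(subsetP s1) //.
    by right; apply/pureP; exists u; rewrite -H2 // -porbit_right ?(subsetP s2).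
  case=> /pureP[u [uA sub ->]]; exists u; rewrite inE uA ?orbT.
    by rewrite porbit_left ?(subsetP s1) // H1.
  by rewrite porbit_right ?(subsetP s2) // H2.
rewrite cardsU; have -> : pure A1 k1 :&: pure A2 k2 = set0.
  apply/setP => O; rewrite !inE; apply/negP => /andP[/pureP[u [uX uS ->]]].
  case/pureP => v [vY vS E]; have := porbit_id k1 u; rewrite E => /(subsetP vS).
  by rewrite (disjointFr dA).
by rewrite cards0 subn0.
Qed.

Lemma leaving_prod : leaving (X1 :|: X2) (k1 * k2) = leaving X1 k1 :|: leaving X2 k2.
Proof.
have dX : [disjoint X1 & X2].
  by apply: disjointWl (subsetUl _ Y1) (disjointWr (subsetUl _ Y2) dZ).
apply/setP => u; rewrite !inE; have [uX|uX] := boolP (u \in X1).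
  have uZ : u \in X1 :|: Y1 by rewrite inE uX.
  have kuZ : k1 u \in X1 :|: Y1 by rewrite perm_closed.
  have := disjointFr dZ kuZ; rewrite in_setU => /norP[kuX2 _].
  by rewrite prod_left // (negPf kuX2) (disjointFr dX uX) /= !orbF.
have [uX2|//] := boolP (u \in X2); rewrite /=.
have uZ : u \in X2 :|: Y2 by rewrite inE uX2.
have kuZ : k2 u \in X2 :|: Y2 by rewrite perm_closed.
have := disjointFl dZ kuZ; rewrite in_setU => /norP[kuX1 _].
by rewrite prod_right // (negPf kuX1).
Qed.

Lemma base_prod : base (X1 :|: X2) (Y1 :|: Y2) (k1 * k2) = base X1 Y1 k1 + base X2 Y2 k2.
Proof.
rewrite /base !pure_prod ?subsetUl ?subsetUr // leaving_prod cardsU.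
have -> : leaving X1 k1 :&: leaving X2 k2 = set0.
  have dX : [disjoint X1 & X2].
    by apply: disjointWl (subsetUl _ Y1) (disjointWr (subsetUl _ Y2) dZ).
  apply/setP => u; rewrite !inE; apply/negP => /andP[/andP[uX _] /andP[]].
  by rewrite (disjointFr dX).
by rewrite cards0 subn0; clear; lia.
Qed.

Lemma parity_prod : parity (X1 :|: X2) (Y1 :|: Y2) (k1 * k2) =
  parity X1 Y1 k1 (+) parity X2 Y2 k2.
Proof.
rewrite /parity base_prod odd_permM !cardsU.
have -> : X1 :&: X2 = set0.
  by apply/disjoint_setI0/(disjointWl (subsetUl _ Y1) (disjointWr (subsetUl _ Y2) dZ)).
have -> : Y1 :&: Y2 = set0.
  by apply/disjoint_setI0/(disjointWl (subsetUr X1 _) (disjointWr (subsetUr X2 _) dZ)).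
rewrite cards0 !subn0 !oddD.
by clear; do 10?[case: (odd _)]; case: (odd_perm _); case: (odd_perm _).
Qed.

Hypotheses (X10 : X1 != set0) (Y10 : Y1 != set0) (X20 : X2 != set0) (Y20 : Y2 != set0).

(** Without passages some completion has length exactly two below [base]. *)
Lemma parity0 X Y k : [disjoint X & Y] -> X != set0 -> Y != set0 ->
  perm_on (X :|: Y) k -> leaving X k = set0 -> parity X Y k = false.
Proof.
move=> dXY X0 Y0 kZ L0; have [rX [rY [fX fY]]] := full_cycles_attain dXY X0 Y0 kZ.
rewrite L0 eqxx => A; have := plen_full_ge0 dXY kZ fX fY; rewrite L0 cards0.
by rewrite -(plen_parity X0 Y0 k fX fY); move: A; clear; lia.
Qed.

Lemma ftype_prod : ftype (X1 :|: X2) (Y1 :|: Y2) (k1 * k2) =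
  comb (ftype X1 Y1 k1) (ftype X2 Y2 k2).
Proof.
rewrite /ftype leaving_prod setU_eq0 parity_prod /comb.
have p1 := parity0 d1 X10 Y10 k1Z; have p2 := parity0 d2 X20 Y20 k2Z.
case: eqP => [/p1 -> /=|_]; first by case: eqP.
case: eqP => [/p2 ->|_] /=; first by rewrite addbF; case: (parity _ _ _).
by case: (parity _ _ _); case: (parity _ _ _).
Qed.

End Union.

Lemma base_swap a b : a != b -> base [set a] [set b] (tperm a b) = 1%N /\
  ftype [set a] [set b] (tperm a b) = 1%N.
Proof.
move=> ab.
have L : leaving [set a] (tperm a b) = [set a].
  apply/setP => u; rewrite !inE; case: eqP => //= ->.
  by rewrite tpermL eq_sym ab.
have P1 : pure [set a] (tperm a b) = set0.
  apply/setP => O; rewrite inE; apply/negP => /pureP[u [/set1P -> sub _]].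
  have : tperm a b a \in [set a] by apply: (subsetP sub); rewrite mem_porbit1 porbit_id.
  by rewrite tpermL inE eq_sym (negPf ab).
have P2 : pure [set b] (tperm a b) = set0.
  apply/setP => O; rewrite inE; apply/negP => /pureP[u [/set1P -> sub _]].
  have : tperm a b b \in [set b] by apply: (subsetP sub); rewrite mem_porbit1 porbit_id.
  by rewrite tpermR inE (negPf ab).
have B : base [set a] [set b] (tperm a b) = 1%N by rewrite /base L P1 P2 !cards0 cards1.
split=> //; rewrite /ftype /parity B L !cards1 odd_tperm ab.
by have -> : [set a] == set0 = false by apply/negbTE/set0Pn; exists a; rewrite inE.
Qed.

End Reduction.

(** * The genus inequality for permutations, and alternation by positions *)

Section Hurwitz.
Local Open Scope group_scope.
Variable T : finType.
Implicit Types (s t r k psi : {perm T}) (a b u v z p q d : T) (S Z D X Y O : {set T}).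

(* The values of h are the orbits of the group generated by s and t, each
   transposition of a minimal factorization of t joining at most two of them. *)
Lemma hurwitz s t : exists h : T -> T,
  [/\ forall d, h (s d) = h d, forall d, h (t d) = h d &
      #|T|.*2 <= plen s + plen t + plen (s * t) + #|codom h|.*2].
Proof.
elim/plen_ind: t => [|a b t abt [h [hs ht IH]]].
  pose h d := odflt d [pick u in porbit s d].
  have hP d : porbit s (h d) = porbit s d.
    rewrite /h; case: pickP => [u|] /= ; last by move/(_ d); rewrite porbit_id.
    by move=> ud; apply/eqP; rewrite eq_porbit_mem.
  exists h; split=> [d|d|]; last 1 first.
  - rewrite plen1 mulg1 addn0 addnn -doubleD leq_double.
    have : #|porbits s| <= #|codom h|.
      apply: leq_trans (leq_imset_card (porbit s) _); apply: subset_leq_card.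
      apply/subsetP => O /imsetP[d _ ->]; apply/imsetP; exists (h d); rewrite ?codom_f //.
    by rewrite card_porbits; have := plen_le s; clear; lia.
  - rewrite /h; have -> : porbit s (s d) = porbit s d.
      by apply/eqP; rewrite eq_porbit_mem mem_porbit1 porbit_id.
    by case: pickP => // /(_ d); rewrite porbit_id.
  - by rewrite perm1.
rewrite plen_merge //.
have E1 : plen (s * t) = plen (t * s) by apply: plenC.
have E2 : plen (s * (tperm a b * t)) = plen (tperm a b * (t * s)).
  by rewrite plenC mulgA.
rewrite E2.
have [hab|hab] := eqVneq (h a) (h b).
  exists h; split=> // [d|].
    by rewrite permM ht; case: tpermP => // ->.
  have := plen_tperm_le a b (tperm a b * (t * s)); rewrite tpermKg -E1.
  by move: IH; clear; lia.
exists (fun d => if h d == h b then h a else h d); split=> [d|d|].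
- by rewrite hs.
- rewrite permM ht; case: tpermP => // ->; rewrite eqxx; first by rewrite (negPf hab).
  by case: ifP.
have nab : a \notin porbit (t * s) b.
  apply: contra hab => /porbitP[i ->]; apply/eqP.
  elim: i => [|i IHi]; first by rewrite expg0 perm1.
  by rewrite expgSr permM permM hs ht.
rewrite plen_merge // -E1.
suff : #|codom h| <= #|codom (fun d => if h d == h b then h a else h d)|.+1.
  by move: IH; clear; lia.
have sub : codom h \subset h b |: [set u in codom (fun d => if h d == h b then h a else h d)].
  apply/subsetP => _ /codomP[d ->]; rewrite !inE; case: eqP => //= /eqP hd.
  by apply/codomP; exists d; rewrite (negPf hd).
apply: leq_trans (subset_leq_card sub) _.
by rewrite cardsU1 cardsE -add1n leq_add2r leq_b1.
Qed.

(** Positions are counted from the successor [u] of the first cutting point, which is therefore last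
    on the cycle. Cutting there and at position [q] separates the positions up to [q] from those
    after [q]. *)
Lemma altI X Y s u (p q r : nat) : p < q -> q < r -> r < #|porbit s u|.-1 ->
  (s ^+ p) u \in Y -> (s ^+ q) u \in X -> (s ^+ r) u \in Y -> s^-1 u \in X -> alt X Y s.
Proof.
move=> pq qr rN pY qX rY uX.
have N0 : 0 < #|porbit s u| by rewrite lt0n card_porbit_neq0.
pose N := #|porbit s u|.
have inj i j : i < N -> j < N -> (s ^+ i) u = (s ^+ j) u -> i = j.
  move=> iN jN E; apply/eqP; rewrite -(nth_uniq u _ _ (uniq_traject_porbit s u)) ?size_traject //.
  by rewrite !nth_traject // -!permX E.
have aE : s^-1 u = (s ^+ N.-1) u.
  by apply: (@perm_inj _ s); rewrite permKV -permM -expgSr prednK // permX iter_porbit.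
pose a' := (s ^+ q) u.
have qN : q < N.-1 by apply: ltn_trans qr rN.
have nN : N.-1 < N by rewrite ltn_predL.
have qN' : q < N := ltn_trans qN nN.
have ne : s^-1 u != a'.
  by apply/eqP => /esym; rewrite aE => /inj-/(_ qN' nN) E; rewrite E ltnn in qN.
pose t := tperm (s^-1 u) a' * s.
have tE i : i < N.-1 -> i != q -> t ((s ^+ i) u) = (s ^+ i.+1) u.
  move=> iN iq; have iN' := ltn_trans iN nN; rewrite permM tpermD ?expgSr ?permM //.
    by rewrite aE; apply/eqP => /inj-/(_ nN iN') E; rewrite E ltnn in iN.
  by apply: contra iq => /eqP/inj-/(_ qN' iN') ->.
exists (s^-1 u), a'; split=> //.
  by rewrite -mem_porbit1 permKV porbit_sym mem_porbit.
rewrite -/t; split.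
  exists ((s ^+ r) u) => //.
  have H i : q.+1 + i <= N.-1 -> (s ^+ (q.+1 + i)) u \in porbit t (s^-1 u).
    elim: i => [|i IHi] le; last first.
      rewrite addnS in le *; rewrite -tE // ?mem_porbit1 ?IHi ?(ltnW le) //.
      by rewrite neq_ltn addSn ltnS leq_addr orbT.
    rewrite addn0; have -> : (s ^+ q.+1) u = t (s^-1 u) by rewrite permM tpermL expgSr permM.
    by rewrite mem_porbit1 porbit_id.
  by have := H (r - q.+1); rewrite subnKC //; apply; apply: ltnW.
exists ((s ^+ p) u) => //.
have H i : i <= q -> (s ^+ i) u \in porbit t a'.
  elim: i => [|i IHi] le; last first.
    by rewrite -tE ?mem_porbit1 ?IHi ?(ltnW le) ?(ltn_trans le qN) ?neq_ltn ?le.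
  have -> : (s ^+ 0) u = t a' by rewrite expg0 perm1 permM tpermR permKV.
  by rewrite mem_porbit1 porbit_id.
by apply: H; apply: ltnW.
Qed.

Lemma altE X Y s : [disjoint X & Y] -> alt X Y s -> exists u (p q r : nat),
  [/\ p < q, q < r & r < #|porbit s u|.-1] /\
  [/\ (s ^+ p) u \in Y, (s ^+ q) u \in X, (s ^+ r) u \in Y & s^-1 u \in X].
Proof.
move=> dXY [a [a' [aX a'X ne aa' [[y yY ya] [y' y'Y ya']]]]].
pose u := s a; pose N := #|porbit s u|.
have au : s^-1 u = a by rewrite permK.
have N0 : 0 < N by rewrite lt0n card_porbit_neq0.
have inj i j : i < N -> j < N -> (s ^+ i) u = (s ^+ j) u -> i = j.
  move=> iN jN E; apply/eqP; rewrite -(nth_uniq u _ _ (uniq_traject_porbit s u)) ?size_traject //.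
  by rewrite !nth_traject // -!permX E.
have aE : a = (s ^+ N.-1) u.
  by apply: (@perm_inj _ s); rewrite -permM -expgSr prednK // permX iter_porbit.
have [q qN a'E] : exists2 q : nat, q < N.-1 & a' = (s ^+ q) u.
  have : a' \in porbit s u by rewrite porbit_sym mem_porbit1.
  rewrite porbit_traject => /trajectP[q qN E]; exists q; last by rewrite permX.
  rewrite -/N in qN; have : q != N.-1; last by move: qN N0; clear; lia.
  by apply: contraNneq ne => qE; rewrite E aE -permX qE.
have nN : N.-1 < N by rewrite ltn_predL.
have qN' : q < N := ltn_trans qN nN.
pose t := tperm a a' * s.
have tE i : i < N.-1 -> i != q -> t ((s ^+ i) u) = (s ^+ i.+1) u.
  move=> iN iq; have iN' := ltn_trans iN nN; rewrite permM tpermD ?expgSr ?permM //.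
    by rewrite aE; apply/eqP => /inj-/(_ nN iN') E; rewrite E ltnn in iN.
  by rewrite a'E; apply: contra iq => /eqP/inj-/(_ qN' iN') ->.
have [r [qr rN rE]] : exists r : nat, [/\ q < r, r < N.-1 & y = (s ^+ r) u].
  pose S := [set (s ^+ (i : nat)) u | i : 'I_N & q < i].
  have sub : porbit t a \subset S.
    apply: porbit_stable; last first.
      by apply/imsetP; exists (Ordinal nN); rewrite ?inE.
    move=> _ /imsetP[i /[!inE] qi ->].
    have [iN|iN] := ltnP i N.-1.
      have lt : i.+1 < N by move: iN; clear; lia.
      rewrite tE ?neq_ltn ?qi ?orbT //; apply/imsetP.
      by exists (Ordinal lt); rewrite ?inE //= ltnW.
    have -> : (s ^+ i) u = a.
      by rewrite aE; congr ((s ^+ _) _); move: (ltn_ord i) iN; clear; lia.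
    have lt : q.+1 < N by move: qN; clear; lia.
    apply/imsetP; exists (Ordinal lt); rewrite ?inE //=.
    by rewrite permM tpermL a'E expgSr permM.
  have /imsetP[r /[!inE] qr yE] := subsetP sub _ ya.
  exists r; split=> //; have := ltn_ord r; have : r != N.-1 :> nat; last by clear; lia.
  by apply/eqP => rE; move: yY; rewrite yE rE -aE (disjointFr dXY aX).
have [p pq pE] : exists2 p : nat, p < q & y' = (s ^+ p) u.
  pose S := [set (s ^+ (i : nat)) u | i : 'I_N & i <= q].
  have sub : porbit t a' \subset S.
    apply: porbit_stable; last first.
      by apply/imsetP; exists (Ordinal qN'); rewrite ?inE.
    move=> _ /imsetP[i /[!inE] qi ->].
    have [iq|iq] := eqVneq (i : nat) q.
      apply/imsetP; exists (Ordinal N0); rewrite ?inE //=.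
      by rewrite iq -a'E permM tpermR expg0 perm1.
    have lt : i.+1 < N by move/eqP: iq; move: qi qN; clear; lia.
    rewrite tE //; last by move: lt; clear; lia.
    apply/imsetP; exists (Ordinal lt); rewrite ?inE //=.
    by rewrite ltn_neqAle iq.
  have /imsetP[p /[!inE] pq yE] := subsetP sub _ ya'.
  exists p => //; rewrite ltn_neqAle pq andbT.
  by apply/eqP => pE; move: y'Y; rewrite yE pE -a'E (disjointFr dXY a'X).
exists u, p, q, r; split=> //.
by rewrite au -pE -rE -a'E.
Qed.

End Hurwitz.

Section Counting.
Variables (A : finType).

Lemma leq_card_imset_factor (B C : finType) (f : A -> B) (g : A -> C) (D : {set A}) :
  {in D &, forall a b, f a = f b -> g a = g b} -> #|g @: D| <= #|f @: D|.
Proof.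
move=> H; have [->|[d0 d0D]] := set_0Vmem D; first by rewrite !imset0 !cards0.
pose k o := if [pick d in D | f d == o] is Some d then g d else g d0.
apply: leq_trans (leq_imset_card k _); apply: subset_leq_card.
apply/subsetP => _ /imsetP[d dD ->]; apply/imsetP; exists (f d); first exact: imset_f.
rewrite /k; case: pickP => [d' /andP[d'D /eqP E]|/(_ d)]; first exact: H.
by rewrite dD eqxx.
Qed.

Lemma card_imset_factor (B C : finType) (f : A -> B) (g : A -> C) (D : {set A}) :
  {in D &, forall a b, f a = f b <-> g a = g b} -> #|f @: D| = #|g @: D|.
Proof.
move=> H; apply/eqP; rewrite eqn_leq !leq_card_imset_factor //.
  by move=> a b aD bD /H; apply.
by move=> a b aD bD /H; apply.
Qed.

Lemma subseq_consP (x0 a : A) (s L : seq A) :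
  reflect (exists2 i, i < size L & nth x0 L i = a /\ subseq s (drop i.+1 L))
          (subseq (a :: s) L).
Proof.
apply: (iffP idP) => [|[i iL [<- sub]]]; last first.
  rewrite -[L in subseq _ L](cat_take_drop i) (drop_nth x0 iL).
  apply: subseq_trans (suffix_subseq _ _).
  by rewrite /= eqxx.
elim: L => //= b L IH; case: eqP => [->|_] sub.
  by exists 0; rewrite //= drop0.
by have [i iL [E S]] := IH sub; exists i.+1.
Qed.

Lemma subseq_drop_cons (x0 a : A) (s L : seq A) (n i : nat) :
  n <= i -> i < size L -> nth x0 L i = a -> subseq s (drop i.+1 L) ->
  subseq (a :: s) (drop n L).
Proof.
move=> ni iL E S; apply/(subseq_consP x0); exists (i - n).
  by rewrite size_drop ltn_sub2r // (leq_ltn_trans ni).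
by rewrite nth_drop subnKC // drop_drop addSn subnK.
Qed.

End Counting.

(** * Euler's formula for the face permutation *)

Section GraphMaps.
Local Open Scope group_scope.
Variable T : finType.
Implicit Types (G H : graph T) (u v w : T) (d : T * T) (rho : {ffun T -> {perm T}}).

Lemma adjC G u v : adj G u v = adj G v u.
Proof. by rewrite /adj /= setUC. Qed.

Lemma mem_darts G u v : ((u, v) \in darts G) = adj G u v.
Proof. by rewrite inE. Qed.

Lemma mem_nbrs G u v : (u \in nbrs G v) = ((u, v) \in darts G).
Proof. by rewrite mem_darts adjC inE. Qed.

Lemma simple_adj G u v : simple_graph G -> adj G u v ->
  [/\ u != v, u \in vset G & v \in vset G].
Proof.
move=> /forall_inP sG /sG /andP[]; rewrite cards2; case: (u != v) => // _.
by move=> /subsetP sub; split=> //; apply: sub; rewrite !inE eqxx ?orbT.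
Qed.

Lemma simple_edge G e : simple_graph G -> e \in eset G ->
  exists u v, [/\ u != v, e = [set u; v], adj G u v, u \in vset G & v \in vset G].
Proof.
move=> sG eG; have /andP[/cards2P[u [v [uv eE]]] _] := forall_inP sG e eG.
exists u, v; have uvG : adj G u v by rewrite /adj /= -eE.
by have [] := simple_adj sG uvG.
Qed.

Lemma face_step_inj rho : injective (face_step rho).
Proof. by move=> [a b] [a' b'] [/= <- /perm_inj ->]. Qed.

Definition fstep rho : {perm T * T} := perm (@face_step_inj rho).

Lemma rot_step_inj rho : injective (fun d : T * T => (rho d.2 d.1, d.2)).
Proof. by move=> [a b] [a' b'] [/= E Eb]; rewrite -Eb in E *; rewrite (perm_inj E). Qed.

Definition rot_step rho : {perm T * T} := perm (@rot_step_inj rho).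

Lemma flip_inj : injective (fun d : T * T => (d.2, d.1)).
Proof. by move=> [a b] [a' b'] [<- <-]. Qed.

Definition flip : {perm T * T} := perm flip_inj.

Lemma restrE (A : finType) (D : {set A}) (s : {perm A}) a :
  (forall b, b \in D -> s b \in D) -> a \in D -> restr_perm D s a = s a.
Proof.
move=> st aD; rewrite restr_permE // inE; apply/andP; split; rewrite ?inE //.
by apply/subsetP => b bD; rewrite !inE; apply: st.
Qed.

Definition respects G rho := forall v u, u \in nbrs G v -> rho v u \in nbrs G v.

Section Respect.
Variables (G : graph T) (rho : {ffun T -> {perm T}}).
Hypothesis resp : respects G rho.

Lemma fstep_stable d : d \in darts G -> fstep rho d \in darts G.
Proof.
by case: d => u v; rewrite -mem_nbrs permE /face_step /= => /resp; rewrite inE mem_darts.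
Qed.

Lemma rot_step_stable d : d \in darts G -> rot_step rho d \in darts G.
Proof.
by case: d => u v; rewrite -mem_nbrs permE /= => /resp; rewrite mem_nbrs.
Qed.

Lemma flip_stable d : d \in darts G -> flip d \in darts G.
Proof. by case: d => u v; rewrite permE /= !mem_darts adjC. Qed.

(** The restriction turns the pairs that are not darts into fixed points, which do not count in
    lengths. *)
Definition fperm : {perm T * T} := restr_perm (darts G) (fstep rho).
Definition rperm : {perm T * T} := restr_perm (darts G) (rot_step rho).
Definition eperm : {perm T * T} := restr_perm (darts G) flip.

Lemma fpermE d : d \in darts G -> fperm d = face_step rho d.
Proof. by move=> dD; rewrite restrE ?permE //; apply: fstep_stable. Qed.

Lemma rpermE d : d \in darts G -> rperm d = (rho d.2 d.1, d.2).
Proof. by move=> dD; rewrite restrE ?permE //; apply: rot_step_stable. Qed.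

Lemma epermE d : d \in darts G -> eperm d = (d.2, d.1).
Proof. by move=> dD; rewrite restrE ?permE //; apply: flip_stable. Qed.

Lemma fperm_prod : fperm = rperm * eperm.
Proof.
have pD : forall s, perm_on (darts G) (restr_perm (darts G) s) by move=> s; apply: restr_perm_on.
apply/permP => d; rewrite permM; have [dD|dD] := boolP (d \in darts G); last first.
  by rewrite !(out_perm (pD _)) // (out_perm (pD _)).
have rD : rperm d \in darts G by rewrite perm_closed ?pD.
by rewrite fpermE // epermE // rpermE.
Qed.

Lemma fperm_iter d n : d \in darts G -> iter n (face_step rho) d = (fperm ^+ n) d.
Proof.
move=> dD; elim: n => [|n IH]; first by rewrite expg0 perm1.
rewrite iterS IH expgSr permM fpermE // .
elim: n {IH} => [|n IH]; first by rewrite expg0 perm1.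
by rewrite expgSr permM perm_closed // restr_perm_on.
Qed.

Lemma face_porbit d : d \in darts G -> face rho d = porbit fperm d.
Proof.
move=> dD; apply/setP => d'; rewrite inE -fconnect_orbit; apply/idP/porbitP.
  by move=> /iter_findex <-; eexists; rewrite fperm_iter.
by case=> i ->; rewrite -fperm_iter // fconnect_iter.
Qed.

Lemma orbit_traject d : d \in darts G ->
  fingraph.orbit (face_step rho) d = traject fperm d #|porbit fperm d|.
Proof.
move=> dD; have -> : #|porbit fperm d| = fingraph.order (face_step rho) d.
  by apply: eq_card => d'; rewrite -face_porbit // !inE -fconnect_orbit.
apply: (@eq_from_nth _ d); rewrite ?size_orbit ?size_traject // => i lt.
by rewrite !nth_traject // fperm_iter // permX.
Qed.

End Respect.

Definition rot_at G rho v := forall u, u \in nbrs G v -> porbit (rho v) u = nbrs G v.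

Lemma rot_at_respects G rho : (forall v, rot_at G rho v) -> respects G rho.
Proof. by move=> rot v u uv; rewrite -{1}(rot v u uv) mem_porbit1 porbit_id. Qed.

Lemma rotation_systemP G rho : simple_graph G ->
  reflect (forall v, rot_at G rho v) (rotation_system G rho).
Proof.
move=> sG; apply: (iffP forall_inP) => [rot v u uv|rot v _].
  have vG : v \in vset G.
    by rewrite inE in uv; have [] := simple_adj sG uv.
  by apply/eqP; apply: (forall_inP (rot v vG)).
by apply/forall_inP => u uv; apply/eqP; apply: rot.
Qed.

Lemma set2_eq u v a b : u != v -> [set a; b] = [set u; v] ->
  ((a, b) = (u, v)) \/ ((a, b) = (v, u)).
Proof.
move=> uv E.
have: a \in [set u; v] by rewrite -E !inE eqxx.
have: b \in [set u; v] by rewrite -E !inE eqxx orbT.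
have: u \in [set a; b] by rewrite E !inE eqxx.
have: v \in [set a; b] by rewrite E !inE eqxx orbT.
rewrite !inE => va ua /orP[]/eqP bE /orP[]/eqP aE; subst a b; auto.
  by rewrite orbb eq_sym (negPf uv) in va.
by rewrite orbb (negPf uv) in ua.
Qed.

Lemma card_darts G : simple_graph G -> #|darts G| = #|eset G|.*2.
Proof.
move=> sG; rewrite -sum1_card.
rewrite (partition_big (fun d : T * T => [set d.1; d.2]) (mem (eset G))) /=; last first.
  by move=> [u v]; rewrite mem_darts.
rewrite (eq_bigr (fun=> 2)) => [|e eG]; first by rewrite sum_nat_const muln2.
have [u [v [uv eE uvG _ _]]] := simple_edge sG eG.
rewrite sum1_card (eq_card (B := [set (u, v); (v, u)])) => [|[a b]].
  by rewrite cards2 xpair_eqE negb_and uv.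
rewrite !inE; apply/andP/orP => [[_ /eqP]|].
  by rewrite eE => /(set2_eq uv)[] ->; rewrite eqxx; auto.
by case=> /eqP[-> ->]; rewrite eE /= ?(setUC [set v]); split=> //; rewrite mem_darts // adjC.
Qed.

Section Euler.
Variables (G : graph T) (rho : {ffun T -> {perm T}}).
Hypotheses (sG : simple_graph G) (cG : connected_graph G).
Hypothesis rot : forall v, rot_at G rho v.
Variables (x y : T).
Hypotheses (xG : x \in vset G) (yG : y \in vset G) (xy : x != y).

Let resp := rot_at_respects rot.

Lemma connG u v : u \in vset G -> v \in vset G -> connect (adj G) u v.
Proof. by case/andP: cG => _ /forall_inP H uG vG; apply: (forall_inP (H u uG)). Qed.

(** The two distinct vertices [x] and [y] exclude a connected graph without edges, so the special
    case in [comp_faces] never arises. *)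
Lemma nbr_exists v : v \in vset G -> exists u, u \in nbrs G v.
Proof.
move=> vG; have [w wG wv] : exists2 w, w \in vset G & w != v.
  by have [xv|xv] := eqVneq x v; [exists y; rewrite // -xv eq_sym|exists x].
case/connectP: (connG vG wG) => -[|u p] /=; first by move=> _ wE; rewrite wE eqxx in wv.
by case/andP => vu _ _; exists u; rewrite inE.
Qed.

Lemma rperm_head n d : d \in darts G -> ((rperm G rho ^+ n) d).2 = d.2.
Proof.
move=> dD; suff : (rperm G rho ^+ n) d \in darts G /\ ((rperm G rho ^+ n) d).2 = d.2 by case.
elim: n => [|n [IHD IH]]; first by rewrite expg0 perm1.
by rewrite expgSr permM; split; [rewrite perm_closed ?restr_perm_on|rewrite rpermE].
Qed.

Lemma rperm_iter n u v : (u, v) \in darts G -> (rperm G rho ^+ n) (u, v) = ((rho v ^+ n) u, v).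
Proof.
move=> dD; elim: n => [|n IH]; first by rewrite !expg0 !perm1.
rewrite !expgSr !permM IH rpermE // -IH perm_closed //.
elim: n {IH} => [|n IH]; first by rewrite expg0 perm_on1.
by rewrite expgSr perm_onM // restr_perm_on.
Qed.

Lemma mem_porbit_rperm u v w t : (u, v) \in darts G -> (w, t) \in darts G ->
  ((w, t) \in porbit (rperm G rho) (u, v)) = (t == v).
Proof.
move=> uD wD; apply/porbitP/eqP => [[n E]|tv].
  by have := rperm_head n uD; rewrite -E.
rewrite tv in wD *; rewrite -!mem_nbrs in uD wD.
have : w \in porbit (rho v) u by rewrite rot.
by case/porbitP => n ->; exists n; rewrite rperm_iter // -mem_nbrs.
Qed.

Lemma plen_rperm : plen (rperm G rho) + #|vset G| = #|darts G|.
Proof.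
rewrite -(plen_on (restr_perm_on (darts G) (rot_step rho))); congr addn.
have <- : snd @: darts G = vset G.
  apply/setP => v; apply/imsetP/idP => [[[u w]]|vG].
    by rewrite mem_darts => /(simple_adj sG)[_ _ wG] ->.
  by have [u uv] := nbr_exists vG; exists (u, v); rewrite -?mem_nbrs.
symmetry; apply: card_imset_factor => -[u v] [w t] uD wD /=.
split=> [/eqP|vt]; first by rewrite eq_porbit_mem (mem_porbit_rperm wD uD) => /eqP.
by apply/eqP; rewrite eq_porbit_mem (mem_porbit_rperm wD uD) vt eqxx.
Qed.

Lemma porbit_eperm d : d \in darts G -> porbit (eperm G) d = [set d; (d.2, d.1)].
Proof.
move=> dD; have dD' : (d.2, d.1) \in darts G by case: d dD => u v; rewrite !mem_darts adjC.
apply/eqP; rewrite eqEsubset subUset !sub1set porbit_id /=; apply/andP; split.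
  apply: porbit_stable; last by rewrite !inE eqxx.
  by move=> e /set2P[] ->; rewrite epermE // !inE; case: (d) => a b /=; rewrite eqxx ?orbT.
by rewrite -(epermE dD) mem_porbit1 porbit_id.
Qed.

Lemma plen_eperm : plen (eperm G) + #|eset G| = #|darts G|.
Proof.
rewrite -(plen_on (restr_perm_on (darts G) flip)); congr addn.
have <- : (fun d : T * T => [set d.1; d.2]) @: darts G = eset G.
  apply/setP => e; apply/imsetP/idP => [[[u v]]|eG].
    by rewrite mem_darts => uvG ->.
  by have [u [v [uv eE uvG _ _]]] := simple_edge sG eG; exists (u, v); rewrite ?mem_darts.
symmetry; apply: card_imset_factor => -[u v] [w t] uD wD /=.
have uv : u != v by rewrite mem_darts in uD; have [] := simple_adj sG uD.
have wt : w != t by rewrite mem_darts in wD; have [] := simple_adj sG wD.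
split=> [/eqP|].
  by rewrite eq_porbit_mem porbit_eperm //= => /set2P[[-> ->]|[-> ->]] //; rewrite setUC.
move/(set2_eq wt) => H; apply/eqP; rewrite eq_porbit_mem porbit_eperm //= !inE.
by case: H => ->; rewrite eqxx ?orbT.
Qed.

(** The genus is nonnegative, so the subtraction of natural numbers in [comp_genus] truncates
    nothing. By connectedness the function given by [hurwitz] is constant on darts, and every other
    pair adds at most one value. *)
Lemma euler_le : #|vset G| + #|eset G| <= 2 + plen (fperm G rho).
Proof.
have [h [hs ht H]] := hurwitz (rperm G rho) (eperm G).
rewrite -fperm_prod // in H.
have hv : forall p u v w, path (adj G) v p -> (u, v) \in darts G ->
    (w, last v p) \in darts G -> h (u, v) = h (w, last v p).
  have same : forall u v w, (u, v) \in darts G -> (w, v) \in darts G -> h (u, v) = h (w, v).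
    move=> u v w uD wD; have := mem_porbit_rperm wD uD; rewrite eqxx => /porbitP[n ->].
    elim: n => [|n IH]; first by rewrite expg0 perm1.
    by rewrite expgSr permM hs.
  elim=> [|a p IH] u v w /=; first by move=> _; apply: same.
  case/andP => va pth uD wD.
  have vaD : (v, a) \in darts G by rewrite mem_darts.
  have avD : (a, v) \in darts G by rewrite mem_darts adjC.
  rewrite (same _ _ _ uD avD) -(IH v a w) // -ht epermE //.
have cst d d' : d \in darts G -> d' \in darts G -> h d = h d'.
  case: d d' => u v [w t] uD wD; have [uvG wtG] := (uD, wD).
  rewrite mem_darts in uvG; rewrite mem_darts in wtG.
  have [_ _ vG] := simple_adj sG uvG; have [_ _ tG] := simple_adj sG wtG.
  case/connectP: (connG vG tG) => p pth tE; rewrite tE in wD *.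
  exact: hv.
have cod : #|codom h| <= 1 + #|~: darts G|.
  have [u ux] := nbr_exists xG; rewrite mem_nbrs in ux.
  apply: leq_trans (subset_leq_card (_ : _ \subset h (u, x) |: h @: (~: darts G))) _.
    apply/subsetP => _ /codomP[d ->]; rewrite !inE.
    have [dD|dD] := boolP (d \in darts G); first by rewrite (cst _ _ dD ux) eqxx.
    by rewrite imset_f ?orbT // inE.
  rewrite cardsU1; apply: leq_add; first exact: leq_b1.
  exact: leq_imset_card.
have := plen_rperm; have := plen_eperm; have := card_darts sG; have := cardsC (darts G).
move: H cod; rewrite -cardsT.
set n1 := plen _; set n2 := plen _; set n3 := plen _; set n4 := #|darts G|.
set n5 := #|~: darts G|; clear; lia.
Qed.

Lemma components_connected : components G = [set vset G].
Proof.
apply/setP => C; rewrite inE; apply/imsetP/eqP => [[u uG ->]|->].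
  by apply/setP => v; rewrite inE; case: (boolP (v \in vset G)) => //= vG; apply: connG.
exists x => //; apply/setP => v; rewrite inE.
by case: (boolP (v \in vset G)) => //= vG; rewrite connG.
Qed.

Lemma emb_genusE :
  (emb_genus G rho).*2 + #|vset G| + #|eset G| = 2 + plen (fperm G rho).
Proof.
have EE : comp_edges G (vset G) = eset G.
  apply/setP => e; rewrite inE; case: (boolP (e \in eset G)) => //= eG.
  by have /andP[] := forall_inP sG e eG.
have E0 : eset G != set0.
  have [u] := nbr_exists xG; rewrite inE => ux; apply/set0Pn; eexists; exact: ux.
rewrite /emb_genus components_connected big_set1 /comp_genus /comp_faces EE (negPf E0).
have -> : #|[set face rho d | d in darts G & d.1 \in vset G]| = #|porbit (fperm G rho) @: darts G|.
  congr #|pred_of_set _|; apply/setP => O; apply/imsetP/imsetP => -[d].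
    by rewrite inE => /andP[dD _] ->; exists d => //; apply: face_porbit resp _ dD.
  move=> dD ->; exists d; last by rewrite (face_porbit resp dD).
  rewrite inE dD; case: d dD => u v; rewrite mem_darts => uvG.
  by have [] := simple_adj sG uvG.
have := plen_on (restr_perm_on (darts G) (fstep rho)); rewrite -/(fperm G rho).
(* Comparing signs shows that the halving in [comp_genus] is exact. *)
have par : odd (plen (fperm G rho)) = odd (plen (rperm G rho)) (+) odd (plen (eperm G)).
  by rewrite -!odd_plen -odd_permM -fperm_prod.
have := plen_rperm; have := plen_eperm; have := card_darts sG; have := euler_le.
move: par.
set n1 := plen _; set n2 := plen _; set n3 := plen _; set n4 := #|darts G|.
set n5 := #|_ @: _|; set V := #|vset G|; set E := #|eset G|; clear; lia.
Qed.

End Euler.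

End GraphMaps.

(** * Rotations at the terminals as full cycles of darts *)

Section Heads.
Local Open Scope group_scope.
Variable T : finType.
Implicit Types (G H : graph T) (u v w : T) (d : T * T) (rho : {ffun T -> {perm T}}).
Implicit Types r : {perm T * T}.

Definition heads G v := [set d in darts G | d.2 == v].

Lemma mem_heads G u v : ((u, v) \in heads G v) = (u \in nbrs G v).
Proof. by rewrite inE mem_nbrs eqxx andbT. Qed.

Lemma headsP G v d : d \in heads G v -> exists2 u, u \in nbrs G v & d = (u, v).
Proof.
by case: d => u w; rewrite inE /= => /andP[dD /eqP wv]; subst v; exists u; rewrite ?mem_nbrs.
Qed.

Lemma heads_sub G v : heads G v \subset darts G.
Proof. by apply/subsetP => d; rewrite inE => /andP[]. Qed.

Lemma disjoint_heads G v w : v != w -> [disjoint heads G v & heads G w].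
Proof.
move=> vw; rewrite -setI_eq0; apply/eqP/setP => d; rewrite !inE.
by apply/negP => /andP[/andP[_ /eqP E1] /andP[_ /eqP E2]]; rewrite -E1 -E2 eqxx in vw.
Qed.

Definition hperm G rho v := restr_perm (heads G v) (rot_step rho).

Lemma hpermE G rho v u : rot_at G rho v -> u \in nbrs G v ->
  hperm G rho v (u, v) = (rho v u, v).
Proof.
move=> rot uv; rewrite restrE ?mem_heads ?permE // => d /headsP[w wv ->].
by rewrite permE /= mem_heads -(rot w wv) mem_porbit1 porbit_id.
Qed.

Lemma hperm_full G rho v : rot_at G rho v -> full_cycle (heads G v) (hperm G rho v).
Proof.
move=> rot; split=> [|d /headsP[u uv ->]]; first exact: restr_perm_on.
have st n w : w \in nbrs G v -> (rho v ^+ n) w \in nbrs G v.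
  by move=> wv; rewrite -(rot w wv) mem_porbit.
have it n : (hperm G rho v ^+ n) (u, v) = ((rho v ^+ n) u, v).
  elim: n => [|n IH]; first by rewrite !expg0 !perm1.
  by rewrite !expgSr !permM IH hpermE ?st.
apply/setP => -[w t]; apply/porbitP/idP => [[n ->]|].
  by rewrite it mem_heads st.
rewrite inE /= => /andP[wD /eqP tv]; rewrite {t}tv -mem_nbrs in wD *.
by move: wD; rewrite -(rot u uv) => /porbitP[n ->]; exists n; rewrite it.
Qed.

Section HeadRotation.
Variables (G : graph T) (v : T) (r : {perm T * T}).
Hypothesis rX : perm_on (heads G v) r.

Lemma head_snd u : (r (u, v)).2 = v.
Proof.
have [uX|uX] := boolP ((u, v) \in heads G v); last by rewrite (out_perm rX).
have : r (u, v) \in heads G v by rewrite perm_closed.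
by case/headsP => w _ ->.
Qed.

Lemma head_rot_inj : injective (fun u => (r (u, v)).1).
Proof.
move=> u w /= E; suff : r (u, v) = r (w, v) by move/perm_inj => [].
by rewrite (surjective_pairing (r (u, v))) (surjective_pairing (r (w, v))) E !head_snd.
Qed.

Definition head_rot : {perm T} := perm head_rot_inj.

Lemma head_rotE u : r (u, v) = (head_rot u, v).
Proof. by rewrite permE [LHS]surjective_pairing head_snd. Qed.

Lemma head_rot_porbit u : full_cycle (heads G v) r -> u \in nbrs G v ->
  porbit head_rot u = nbrs G v.
Proof.
move=> [_ pX] uv; have it n : (r ^+ n) (u, v) = ((head_rot ^+ n) u, v).
  elim: n => [|n IH]; first by rewrite !expg0 !perm1.
  by rewrite !expgSr !permM IH head_rotE.
apply/setP => w; rewrite -[in RHS]mem_heads -(pX (u, v)) ?mem_heads //.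
by apply/porbitP/porbitP => -[n E]; exists n; [rewrite it E|have := it n; rewrite -E => -[]].
Qed.

End HeadRotation.

Section Terminals.
Variables x y : T.
Hypothesis xy : x != y.

(** The identity at both terminals lets the rotations there be split off as factors in front of
    [psi], and makes [psi] of a sum the product of those of its sides. *)
Definition base_rot rho : {ffun T -> {perm T}} :=
  [ffun v => if (v == x) || (v == y) then 1 else rho v].

Definition rot_off G rho := forall v, v != x -> v != y -> rot_at G rho v.

Lemma base_rot_respects G rho : rot_off G rho -> respects G (base_rot rho).
Proof.
move=> rot v u uv; rewrite ffunE; case: ifP => [_|/norP[vx vy]]; first by rewrite perm1.
by rewrite -(rot v vx vy u uv) mem_porbit1 porbit_id.
Qed.

Definition psi G rho := fperm G (base_rot rho).

Lemma psi_on G rho : perm_on (darts G) (psi G rho).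
Proof. exact: restr_perm_on. Qed.

Lemma psi_terminal G rho u v : rot_off G rho -> u \in nbrs G v -> (v == x) || (v == y) ->
  psi G rho (u, v) = (v, u).
Proof.
move=> rot uv vxy; rewrite /psi fpermE -?mem_nbrs //; last exact: base_rot_respects.
by rewrite /face_step ffunE /= vxy perm1.
Qed.

Lemma psi_other G rho u v : rot_off G rho -> u \in nbrs G v -> v != x -> v != y ->
  psi G rho (u, v) = (v, rho v u).
Proof.
move=> rot uv vx vy; rewrite /psi fpermE -?mem_nbrs //; last exact: base_rot_respects.
by rewrite /face_step ffunE /= (negPf vx) (negPf vy).
Qed.

Lemma fperm_rotate G rho rho' rX rY : rot_off G rho -> (forall v, rot_at G rho' v) ->
  perm_on (heads G x) rX -> perm_on (heads G y) rY ->
  (forall u, u \in nbrs G x -> rX (u, x) = (rho' x u, x)) ->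
  (forall u, u \in nbrs G y -> rY (u, y) = (rho' y u, y)) ->
  (forall v u, v != x -> v != y -> u \in nbrs G v -> rho' v u = rho v u) ->
  fperm G rho' = rX * rY * psi G rho.
Proof.
move=> rot rot' rXX rYY EX EY EO; apply/permP => d; rewrite !permM.
have resp := rot_at_respects rot'.
have [dD|dD] := boolP (d \in darts G); last first.
  have nX v : d \notin heads G v by apply: contra dD => /(subsetP (heads_sub _ _)).
  by rewrite (out_perm rXX) ?(out_perm rYY) ?(out_perm (psi_on _ _)) ?(out_perm (restr_perm_on _ _)).
rewrite fpermE //; case: d dD => u v dD; rewrite /face_step /=.
have uv : u \in nbrs G v by rewrite mem_nbrs.
have [vx|vx] := eqVneq v x.
  subst v; rewrite EX // (out_perm rYY); last by rewrite inE /= (negPf xy) andbF.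
  by rewrite psi_terminal ?eqxx // resp.
have [vy|vy] := eqVneq v y.
  subst v; rewrite (out_perm rXX); last by rewrite inE /= (negPf vx) andbF.
  by rewrite EY // psi_terminal ?eqxx ?orbT // resp.
rewrite (out_perm rXX); last by rewrite inE /= (negPf vx) andbF.
rewrite (out_perm rYY); last by rewrite inE /= (negPf vy) andbF.
by rewrite psi_other // EO.
Qed.

Lemma split_rot G rho : (forall v, rot_at G rho v) ->
  [/\ full_cycle (heads G x) (hperm G rho x), full_cycle (heads G y) (hperm G rho y) &
      fperm G rho = hperm G rho x * hperm G rho y * psi G rho].
Proof.
move=> rot; split; try exact: hperm_full.
apply: fperm_rotate => //; try exact: restr_perm_on.
by move=> u ux; rewrite hpermE.
by move=> u ux; rewrite hpermE.
Qed.

Lemma make_rot G rho rX rY : rot_off G rho ->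
  full_cycle (heads G x) rX -> full_cycle (heads G y) rY ->
  exists2 rho', (forall v, rot_at G rho' v) & fperm G rho' = rX * rY * psi G rho.
Proof.
move=> rot fX fY.
pose rho' : {ffun T -> {perm T}} := [ffun v => if v == x then head_rot fX.1
  else if v == y then head_rot fY.1 else rho v].
have rx : rho' x = head_rot fX.1 by rewrite ffunE eqxx.
have ry : rho' y = head_rot fY.1 by rewrite ffunE eq_sym (negPf xy) eqxx.
have ro v : v != x -> v != y -> rho' v = rho v.
  by move=> vx vy; rewrite ffunE (negPf vx) (negPf vy).
have rot' v : rot_at G rho' v.
  move=> u uv; have [vx|vx] := eqVneq v x.
    by subst v; rewrite rx head_rot_porbit.
  have [vy|vy] := eqVneq v y.
    by subst v; rewrite ry head_rot_porbit.
  by rewrite ro // rot.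
exists rho' => //; apply: fperm_rotate => //; rewrite ?fX.1 ?fY.1 //.
- by move=> u _; rewrite rx -head_rotE.
- by move=> u _; rewrite ry -head_rotE.
- by move=> v u vx vy _; rewrite ro.
Qed.

Section Alternating.
Variables (G : graph T) (rho : {ffun T -> {perm T}}).
Hypothesis rot : forall v, rot_at G rho v.
Let resp := rot_at_respects rot.
Local Notation f := (fperm G rho).
Local Notation X := (heads G x).
Local Notation Y := (heads G y).

Lemma fperm_on : perm_on (darts G) f. Proof. exact: restr_perm_on. Qed.

Lemma fpermX_in n d : d \in darts G -> (f ^+ n) d \in darts G.
Proof.
move=> dD; elim: n => [|n IH]; first by rewrite expg0 perm1.
by rewrite expgSr permM perm_closed ?fperm_on.
Qed.

Lemma fperm_fst d : d \in darts G -> (f d).1 = d.2.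
Proof. by move=> dD; rewrite fpermE. Qed.

Lemma fpermX_fst n d v : d \in darts G -> (((f ^+ n.+1) d).1 == v) = ((f ^+ n) d \in heads G v).
Proof.
by move=> dD; rewrite expgSr permM fperm_fst ?fpermX_in // inE fpermX_in.
Qed.

Lemma fpermV_fst d v : d \in darts G -> (d.1 == v) = (f^-1 d \in heads G v).
Proof.
move=> dD; have dD' : f^-1 d \in darts G by rewrite perm_closed // perm_onV ?fperm_on.
by rewrite -{1}[d](permKV f) fperm_fst // inE dD'.
Qed.

Lemma alternatingI d (i j k : nat) : d \in darts G -> 0 < i -> i < j -> j < k ->
  k < #|porbit f d| -> d.1 = x -> ((f ^+ i) d).1 = y -> ((f ^+ j) d).1 = x ->
  ((f ^+ k) d).1 = y -> alternating x y G rho.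
Proof.
move=> dD i0 ij jk kN d0 di dj dk; apply/existsP; exists d; rewrite dD /=.
rewrite (orbit_traject resp dD).
have sz : size [seq d'.1 | d' <- traject f d #|porbit f d|] = #|porbit f d|.
  by rewrite size_map size_traject.
have nt n : n < #|porbit f d| ->
    nth x [seq d'.1 | d' <- traject f d #|porbit f d|] n = ((f ^+ n) d).1.
  by move=> lt; rewrite (nth_map d) ?size_traject // nth_traject // permX.
have N0 : 0 < #|porbit f d| by apply: leq_ltn_trans kN.
have jN := ltn_trans jk kN; have iN := ltn_trans ij jN.
rewrite -[X in subseq _ X]drop0.
apply: (@subseq_drop_cons _ x _ _ _ _ 0); rewrite ?sz ?nt ?expg0 ?perm1 //.
apply: (@subseq_drop_cons _ x _ _ _ _ i); rewrite ?sz ?nt //.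
apply: (@subseq_drop_cons _ x _ _ _ _ j); rewrite ?sz ?nt //.
by apply: (@subseq_drop_cons _ x _ _ _ _ k); rewrite ?sz ?nt // sub0seq.
Qed.

(** [alternating] reads the origins of darts and [alternates] their heads; the origin of a dart is
    the head of its predecessor on the face, hence the shift of positions by one. *)
Lemma alternatingP : alternating x y G rho <-> alternates X Y f.
Proof.
have dXY := disjoint_heads G xy; have dYX : [disjoint Y & X] by rewrite disjoint_sym.
split=> [/existsP[d /andP[dD]]|[]].
- rewrite (orbit_traject resp dD).
  set L := map _ _.
  have sz : size L = #|porbit f d| by rewrite size_map size_traject.
  have nt n : n < #|porbit f d| -> nth x L n = ((f ^+ n) d).1.
    by move=> lt; rewrite (nth_map d) ?size_traject // nth_traject // permX.
  case/(subseq_consP x) => n1; rewrite sz => l1 [E1].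
  case/(subseq_consP x) => i2; rewrite size_drop sz => l2; rewrite nth_drop drop_drop => -[E2].
  case/(subseq_consP x) => i3; rewrite size_drop sz => l3; rewrite nth_drop drop_drop => -[E3].
  case/(subseq_consP x) => i4; rewrite size_drop sz => l4; rewrite nth_drop => -[E4 _].
  rewrite nt // in E1; rewrite nt in E2; last by move: l2; clear; lia.
  rewrite nt in E3; last by move: l3; clear; lia.
  rewrite nt in E4; last by move: l4; clear; lia.
  pose u := (f ^+ n1) d; have uD : u \in darts G by apply: fpermX_in.
  have fu n : (f ^+ n) u = (f ^+ (n1 + n)) d by rewrite expgD permM.
  left; apply: (@altI _ X Y f u i2 (i2 + i3.+1) (i2 + i3.+1 + i4.+1)).
  + by clear; lia.
  + by clear; lia.
  + by rewrite /u porbit_perm; move: l4; clear; lia.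
  + rewrite -fpermX_fst // fu -E2; apply/eqP; congr ((f ^+ _) d).1; by clear; lia.
  + rewrite -fpermX_fst // fu -E3; apply/eqP; congr ((f ^+ _) d).1; by clear; lia.
  + rewrite -fpermX_fst // fu -E4; apply/eqP; congr ((f ^+ _) d).1; by clear; lia.
  + by rewrite -fpermV_fst // E1.
- case/(altE dXY) => u [p [q [r [[pq qr rN] [pY qX rY uX]]]]].
  have uD : u \in darts G.
    have := subsetP (heads_sub G x) _ uX; rewrite perm_closed // perm_onV ?fperm_on //.
  rewrite -fpermV_fst // in uX; rewrite -fpermX_fst // in pY.
  rewrite -fpermX_fst // in qX; rewrite -fpermX_fst // in rY.
  by apply: (@alternatingI u p.+1 q.+1 r.+1) => //; [move: rN; clear; lia|exact/eqP..].
- case/(altE dYX) => u [p [q [r [[pq qr rN] [pX qY rX uY]]]]].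
  have uD : u \in darts G.
    have := subsetP (heads_sub G y) _ uY; rewrite perm_closed // perm_onV ?fperm_on //.
  rewrite -fpermV_fst // in uY; rewrite -fpermX_fst // in pX.
  rewrite -fpermX_fst // in qY; rewrite -fpermX_fst // in rX.
  (* Here the pattern begins at [y], so the walk is restarted at its first visit to [x]; the final
     [y] is reached on closing the face at [u]. *)
  pose d := (f ^+ p.+1) u; have dD : d \in darts G by apply: fpermX_in.
  have fd n : (f ^+ n) d = (f ^+ (p.+1 + n)) u by rewrite expgD permM.
  apply: (@alternatingI d (q - p) (r - p) (#|porbit f u| - p.+1)) => //.
  + by rewrite subn_gt0.
  + by move: pq qr; clear; lia.
  + by move: pq qr rN; clear; lia.
  + by rewrite /d porbit_perm; move: rN; clear; lia.
  + exact/eqP.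
  + by rewrite fd addSn subnKC ?(ltnW pq) //; exact/eqP.
  + by rewrite fd addSn subnKC ?(ltnW (ltn_trans pq qr)) //; exact/eqP.
  + by rewrite fd subnKC ?permX ?iter_porbit; [exact/eqP|move: pq qr rN; clear; lia].
Qed.

End Alternating.
End Terminals.
End Heads.

(** * Optimal embeddings and xy-sums *)

Section Profile.
Local Open Scope group_scope.
Variable T : finType.
Variables x y : T.
Hypothesis xy : x != y.
Implicit Types (G H : graph T) (u v w : T) (d : T * T) (rho : {ffun T -> {perm T}}).
Implicit Types r : {perm T * T}.

Lemma genus_le G rho : rotation_system G rho -> genus G <= emb_genus G rho.
Proof.
move=> rot; rewrite /genus; case: ex_minnP => m _; apply.
by apply/existsP; exists rho; rewrite rot eqxx.
Qed.

Lemma genus_attained G : exists2 rho, rotation_system G rho & emb_genus G rho = genus G.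
Proof.
rewrite /genus; case: ex_minnP => m /existsP[rho /andP[rot /eqP E]] _.
by exists rho.
Qed.

Definition terminals G := heads G x :|: heads G y.

Lemma terminals_sub G : terminals G \subset darts G.
Proof. by rewrite subUset !heads_sub. Qed.

(* t and g describe the best embedding among those with the same rotations
   outside of the terminals. *)
Definition profile (t : nat) G (g : nat) : Prop := exists rho k c,
  [/\ rot_off x y G rho, reduces (darts G) (terminals G) (psi x y G rho) k c,
      t = ftype (heads G x) (heads G y) k &
      g.*2 + #|vset G| + #|eset G| + (t == 0).*2 =
      2 + c + base (heads G x) (heads G y) k + (t == 2)].

Lemma ftype_range X Y (k : {perm T * T}) : ftype X Y k <= 2.
Proof. by rewrite /ftype; case: ifP => // _; case: ifP. Qed.

Lemma profile_range t G g : profile t G g -> t <= 2.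
Proof. by case=> rho [k [c [_ _ -> _]]]; apply: ftype_range. Qed.

Definition good G := [/\ simple_graph G, connected_graph G, x \in vset G & y \in vset G].

Section Good.
Variable G : graph T.
Hypothesis gG : good G.

Let sG : simple_graph G. Proof. by case: gG. Qed.
Let cG : connected_graph G. Proof. by case: gG. Qed.
Let xG : x \in vset G. Proof. by case: gG. Qed.
Let yG : y \in vset G. Proof. by case: gG. Qed.

Local Notation X := (heads G x).
Local Notation Y := (heads G y).

Lemma heads0 v : v \in vset G -> heads G v != set0.
Proof.
move=> vG; have [u uv] := nbr_exists cG xG yG xy vG.
by apply/set0Pn; exists (u, v); rewrite mem_heads.
Qed.

Let dXY : [disjoint X & Y]. Proof. exact: disjoint_heads. Qed.
Let X0 := heads0 xG.
Let Y0 := heads0 yG.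

Lemma genus_emb rho : (forall v, rot_at G rho v) ->
  (emb_genus G rho).*2 + #|vset G| + #|eset G| = 2 + plen (fperm G rho).
Proof. by move=> rot; apply: (emb_genusE sG cG rot xG yG xy). Qed.

Lemma reduction_optimal rho k c : rot_off x y G rho ->
  reduces (darts G) (terminals G) (psi x y G rho) k c ->
  exists2 rho', rotation_system G rho' &
    let t := ftype X Y k in
    (emb_genus G rho').*2 + #|vset G| + #|eset G| + (t == 0).*2 =
      2 + c + base X Y k + (t == 2) /\
    (t == 2 -> alternating x y G rho').
Proof.
move=> rot red.
have [rX [rY [fX fY E al]]] := ftype_attained dXY X0 Y0 red (terminals_sub G).
have [rho' rot' fE] := make_rot xy rot fX fY.
exists rho'; first exact/rotation_systemP.
split; first by rewrite genus_emb // fE; move: E; clear; lia.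
by move=> t2; apply/alternatingP => //; rewrite fE; apply: al.
Qed.

Lemma profile_rotation t g : profile t G g -> exists rho,
  [/\ rotation_system G rho, emb_genus G rho = g & t = 2 -> alternating x y G rho].
Proof.
move=> [rho [k [c [rot red -> E]]]].
have [rho' rot' [E' al]] := reduction_optimal rot red.
exists rho'; split=> //; last by move/eqP.
by move: E E'; clear; lia.
Qed.

Lemma profile_genus_le t g : profile t G g -> genus G <= g.
Proof. by case/profile_rotation => rho [rot <- _]; apply: genus_le. Qed.

(** The rotations at the terminals are replaced by optimal ones. An alternating embedding whose type
    is not 2 was not optimal, by [ftype_lower]. *)
Lemma rotation_has rho : rotation_system G rho -> exists t g,
  [/\ profile t G g, g <= emb_genus G rho &
      alternating x y G rho -> t != 2 -> g < emb_genus G rho].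
Proof.
move=> /rotation_systemP-/(_ sG) rot.
have [fX fY fE] := split_rot xy rot.
have off : rot_off x y G rho by move=> v _ _; apply: rot.
have [k [c red]] := reduction (terminals_sub G) (psi_on x y G rho).
have [rho' _ [E _]] := reduction_optimal off red.
exists (ftype X Y k), (emb_genus G rho').
have [lo al] := ftype_lower dXY X0 Y0 red (terminals_sub G) fX fY.
rewrite -fE in lo al; have emb := genus_emb rot.
split; first by exists rho, k, c.
  by move: lo emb E; clear; lia.
move=> /(alternatingP xy rot)/al H /H {H al}; move: emb E; clear; lia.
Qed.

Lemma genus_profile : exists t, profile t G (genus G).
Proof.
have [rho rot E] := genus_attained G.
have [t [g [hg le _]]] := rotation_has rot.
exists t; suff <- : g = genus G by [].
by apply/eqP; rewrite eqn_leq -{1}E le (profile_genus_le hg).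
Qed.

(** An alternating embedding of minimum genus has type 2, since otherwise better rotations at the
    terminals exist; conversely the optimal completion in type 2 alternates. *)
Lemma epsilonP : reflect (profile 2 G (genus G)) (epsilon x y G == 1%N).
Proof.
rewrite /epsilon eqb1; apply: (iffP existsP) => [[rho /and3P[rot /eqP E al]]|].
  have [t [g [hg le lt]]] := rotation_has rot.
  have [t2|t2] := eqVneq t 2; last first.
    by have := lt al t2; rewrite E ltnNge (profile_genus_le hg).
  rewrite -t2; suff <- : g = genus G by [].
  by apply/eqP; rewrite eqn_leq -{1}E le (profile_genus_le hg).
case/profile_rotation => rho [rot E al]; exists rho.
by rewrite rot E eqxx al.
Qed.

End Good.

(** * Edge-disjoint unions meeting in the terminals *)

Section Union.
Variables H1 H2 : graph T.
Hypotheses (g1 : good H1) (g2 : good H2).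
Hypothesis VI : vset H1 :&: vset H2 = [set x; y].
Hypothesis EI : eset H1 :&: eset H2 = set0.

Definition gunion H1 H2 := Graph (vset H1 :|: vset H2) (eset H1 :|: eset H2).

Local Notation H := (gunion H1 H2).

Lemma adj_union u v : adj H u v = adj H1 u v || adj H2 u v.
Proof. by rewrite /adj /= inE. Qed.

Lemma darts_union : darts H = darts H1 :|: darts H2.
Proof. by apply/setP => -[u v]; rewrite in_setU !mem_darts adj_union. Qed.

Lemma darts_disjoint : [disjoint darts H1 & darts H2].
Proof.
rewrite -setI_eq0; apply/eqP/setP => -[u v]; rewrite in_setI in_set0 !mem_darts.
apply/negP => /andP[e1 e2]; have := in_set0 [set u; v]; rewrite -EI inE.
by move: e1 e2; rewrite /adj /= => -> ->.
Qed.

Lemma heads_union v : heads H v = heads H1 v :|: heads H2 v.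
Proof. by apply/setP => d; rewrite /heads darts_union !inE andb_orl. Qed.

Lemma terminals_union : terminals H = terminals H1 :|: terminals H2.
Proof. by rewrite /terminals !heads_union setUACA. Qed.

Lemma terminals_disjoint : [disjoint terminals H1 & terminals H2].
Proof.
by apply: disjointWl (terminals_sub _) (disjointWr (terminals_sub _) darts_disjoint).
Qed.

Lemma good_union : good H.
Proof.
have [s1 c1 x1 y1] := g1; have [s2 c2 x2 y2] := g2.
split; rewrite /= ?inE ?x1 ?y1 //.
  apply/forall_inP => e; rewrite inE => /orP[] eH.
    have /andP[-> sub] := forall_inP s1 e eH.
    by apply: subset_trans sub (subsetUl _ _).
  have /andP[-> sub] := forall_inP s2 e eH.
  by apply: subset_trans sub (subsetUr _ _).
have ux u : u \in vset H -> connect (adj H) u x.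
  rewrite inE => /orP[] uH.
    have : connect (adj H1) u x by apply: connG.
    by apply: connect_sub => a b ab; apply: connect1; rewrite adj_union ab.
  have : connect (adj H2) u x by apply: connG.
  by apply: connect_sub => a b ab; apply: connect1; rewrite adj_union ab orbT.
apply/andP; split; first by apply/set0Pn; exists x; rewrite inE x1.
apply/forall_inP => u uH; apply/forall_inP => v vH.
apply: connect_trans (ux u uH) _; rewrite (sym_connect_sym (adjC H)).
exact: ux.
Qed.

Lemma card_vset_union : #|vset H| + 2 = #|vset H1| + #|vset H2|.
Proof. by rewrite -cardsUI VI cards2 xy. Qed.

Lemma card_eset_union : #|eset H| = #|eset H1| + #|eset H2|.
Proof. by rewrite -cardsUI EI cards0 addn0. Qed.

Lemma simple_nbr_vset G u v : simple_graph G -> u \in nbrs G v -> v \in vset G.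
Proof. by move=> sG; rewrite inE => /(simple_adj sG)[]. Qed.

Lemma nbrs_left v : v != x -> v != y -> v \in vset H1 -> nbrs H v = nbrs H1 v.
Proof.
move=> vx vy v1; apply/setP => u; rewrite !inE adj_union.
case: (boolP (adj H2 v u)) => [vu|]; last by rewrite orbF.
have [_ v2 _] := simple_adj (let: And4 s _ _ _ := g2 in s) vu.
have : v \in [set x; y] by rewrite -VI inE v1.
by rewrite !inE (negPf vx) (negPf vy).
Qed.

Lemma nbrs_right v : v != x -> v != y -> v \in vset H2 -> nbrs H v = nbrs H2 v.
Proof.
move=> vx vy v2; apply/setP => u; rewrite !inE adj_union.
case: (boolP (adj H1 v u)) => [vu|] //.
have [_ v1 _] := simple_adj (let: And4 s _ _ _ := g1 in s) vu.
have : v \in [set x; y] by rewrite -VI inE v1.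
by rewrite !inE (negPf vx) (negPf vy).
Qed.

Lemma psi_union rho : rot_off x y H rho -> rot_off x y H1 rho -> rot_off x y H2 rho ->
  psi x y H rho = psi x y H1 rho * psi x y H2 rho.
Proof.
move=> rot rot1 rot2; apply/permP => -[u v]; rewrite permM.
have p1 := psi_on x y H1 rho; have p2 := psi_on x y H2 rho.
have [D1|D1] := boolP ((u, v) \in darts H1).
  have D : (u, v) \in darts H by rewrite darts_union inE D1.
  rewrite (out_perm p2); last by rewrite (disjointFr darts_disjoint) // perm_closed.
  rewrite -mem_nbrs in D; rewrite -mem_nbrs in D1.
  have [vxy|] := boolP ((v == x) || (v == y)); first by rewrite !psi_terminal.
  by case/norP => vx vy; rewrite !psi_other.
rewrite (out_perm p1) //.
have [D2|D2] := boolP ((u, v) \in darts H2).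
  have D : (u, v) \in darts H by rewrite darts_union inE D2 orbT.
  rewrite -mem_nbrs in D; rewrite -mem_nbrs in D2.
  have [vxy|] := boolP ((v == x) || (v == y)); first by rewrite !psi_terminal.
  by case/norP => vx vy; rewrite !psi_other.
rewrite (out_perm p2) // (out_perm (psi_on _ _ _ _)) //.
by rewrite darts_union inE (negPf D1) (negPf D2).
Qed.

Lemma rot_off_union rho : rot_off x y H rho <-> rot_off x y H1 rho /\ rot_off x y H2 rho.
Proof.
split=> [rot|[rot1 rot2] v vx vy u].
  split=> v vx vy u uv.
    have v1 := simple_nbr_vset (let: And4 s _ _ _ := g1 in s) uv.
    by rewrite -nbrs_left // in uv *; apply: rot.
  have v2 := simple_nbr_vset (let: And4 s _ _ _ := g2 in s) uv.
  by rewrite -nbrs_right // in uv *; apply: rot.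
move=> uv; have : v \in vset H := simple_nbr_vset (let: And4 s _ _ _ := good_union in s) uv.
rewrite inE => /orP[v1|v2]; first by rewrite nbrs_left // in uv *; apply: rot1.
by rewrite nbrs_right // in uv *; apply: rot2.
Qed.

Section Data.
Variables (rho : {ffun T -> {perm T}}) (k1 k2 : {perm T * T}) (c1 c2 : nat).
Hypotheses (rot1 : rot_off x y H1 rho) (rot2 : rot_off x y H2 rho).
Hypothesis red1 : reduces (darts H1) (terminals H1) (psi x y H1 rho) k1 c1.
Hypothesis red2 : reduces (darts H2) (terminals H2) (psi x y H2 rho) k2 c2.

Lemma reduces_union :
  reduces (darts H) (terminals H) (psi x y H rho) (k1 * k2) (c1 + c2).
Proof.
have rot : rot_off x y H rho by apply/rot_off_union.
rewrite darts_union terminals_union psi_union //.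
by apply: reduces_prod red1 red2; rewrite ?terminals_sub ?psi_on ?darts_disjoint.
Qed.

Lemma heads0' G v : good G -> v \in [set x; y] -> heads G v != set0.
Proof. by move=> gG /set2P[] ->; apply: heads0 => //; case: gG. Qed.

Lemma base_union : base (heads H x) (heads H y) (k1 * k2) =
  base (heads H1 x) (heads H1 y) k1 + base (heads H2 x) (heads H2 y) k2.
Proof.
rewrite !heads_union; apply: base_prod; rewrite ?disjoint_heads //.
- exact: terminals_disjoint.
- exact: red1.1.
- exact: red2.1.
Qed.

Lemma ftype_union : ftype (heads H x) (heads H y) (k1 * k2) =
  comb (ftype (heads H1 x) (heads H1 y) k1) (ftype (heads H2 x) (heads H2 y) k2).
Proof.
rewrite !heads_union; apply: ftype_prod; rewrite ?disjoint_heads ?heads0' ?inE ?eqxx ?orbT //.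
- exact: terminals_disjoint.
- exact: red1.1.
- exact: red2.1.
Qed.

End Data.

(** Relative to [base], the optimal length is off by -2, 0 or 1 in types 0, 1 and 2. Two sides of
    type 2 give type 1 and save two units, one handle; a side of type 0 loses its gain of two units,
    one handle more. The two shared vertices balance the constant 2 of Euler's formula. *)
Definition gcomb (t1 t2 g1 g2 g : nat) : Prop :=
  g + ((t1 == 2) && (t2 == 2)) = g1 + g2 + ((t1 == 0) || (t2 == 0)).

Lemma profile_union t1 t2 a1 a2 : profile t1 H1 a1 -> profile t2 H2 a2 ->
  exists2 a, profile (comb t1 t2) H a & gcomb t1 t2 a1 a2 a.
Proof.
move=> [rho1 [k1 [d1 [rot1 red1 tE1 E1]]]] [rho2 [k2 [d2 [rot2 red2 tE2 E2]]]].
(* The choice at the two shared vertices is harmless: they are the terminals, where [psi] ignores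
   [rho]. *)
pose rho : {ffun T -> {perm T}} := [ffun v => if v \in vset H1 then rho1 v else rho2 v].
have e1 v : v \in vset H1 -> rho v = rho1 v by rewrite ffunE => ->.
have e2 v : v != x -> v != y -> v \in vset H2 -> rho v = rho2 v.
  move=> vx vy v2; rewrite ffunE; case: ifP => // v1.
  have : v \in [set x; y] by rewrite -VI inE v1.
  by rewrite !inE (negPf vx) (negPf vy).
have nv1 u v := @simple_nbr_vset H1 u v (let: And4 s _ _ _ := g1 in s).
have nv2 u v := @simple_nbr_vset H2 u v (let: And4 s _ _ _ := g2 in s).
have rot1' : rot_off x y H1 rho.
  by move=> v vx vy u uv; rewrite e1 ?(nv1 _ _ uv) // rot1.
have rot2' : rot_off x y H2 rho.
  by move=> v vx vy u uv; rewrite e2 ?(nv2 _ _ uv) // rot2.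
have psiE G (r r' : {ffun T -> {perm T}}) : rot_off x y G r -> rot_off x y G r' ->
    (forall u v, u \in nbrs G v -> v != x -> v != y -> r v = r' v) ->
    psi x y G r = psi x y G r'.
  move=> rr rr' er; apply/permP => -[u v].
  have [D|D] := boolP ((u, v) \in darts G); last by rewrite !(out_perm (psi_on _ _ _ _)).
  rewrite -mem_nbrs in D.
  have [vxy|] := boolP ((v == x) || (v == y)); first by rewrite !psi_terminal.
  by case/norP => vx vy; rewrite !psi_other // (er _ _ D).
have p1 : psi x y H1 rho = psi x y H1 rho1.
  by apply: psiE => // u v uv _ _; apply: e1; apply: nv1 uv.
have p2 : psi x y H2 rho = psi x y H2 rho2.
  by apply: psiE => // u v uv vx vy; apply: e2 => //; apply: nv2 uv.
rewrite -p1 in red1; rewrite -p2 in red2.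
have red := reduces_union rot1' rot2' red1 red2.
have rot : rot_off x y H rho by apply/rot_off_union.
have [rho' _ [E _]] := reduction_optimal good_union rot red.
exists (emb_genus H rho').
  exists rho, (k1 * k2), (d1 + d2); rewrite tE1 tE2 -(ftype_union red1 red2); split=> //.
move: E; rewrite (ftype_union red1 red2) (base_union red1 red2) -tE1 -tE2 card_eset_union.
have := card_vset_union; have r1 := ftype_range (heads H1 x) (heads H1 y) k1.
have r2 := ftype_range (heads H2 x) (heads H2 y) k2; rewrite -tE1 in r1; rewrite -tE2 in r2.
rewrite /gcomb /comb; move: E1 E2 r1 r2; clear.
by case: t1 => [|[|[|]]] //; case: t2 => [|[|[|]]] //=; lia.
Qed.

(** Both sides inherit the rotations of the union, and [reduces_uniq] identifies the first return
    map of the union with the product of theirs. *)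
Lemma profile_split t a : profile t H a -> exists t1 t2 a1 a2,
  [/\ profile t1 H1 a1, profile t2 H2 a2, t = comb t1 t2 & gcomb t1 t2 a1 a2 a].
Proof.
move=> [rho [k [d [rot red tE E]]]].
have [rot1 rot2] := (rot_off_union rho).1 rot.
have [k1 [d1 red1]] := reduction (terminals_sub H1) (psi_on x y H1 rho).
have [k2 [d2 red2]] := reduction (terminals_sub H2) (psi_on x y H2 rho).
have [kE dE] := reduces_uniq red (reduces_union rot1 rot2 red1 red2); subst k d.
have [rho1 _ [E1 _]] := reduction_optimal g1 rot1 red1.
have [rho2 _ [E2 _]] := reduction_optimal g2 rot2 red2.
exists (ftype (heads H1 x) (heads H1 y) k1), (ftype (heads H2 x) (heads H2 y) k2).
exists (emb_genus H1 rho1), (emb_genus H2 rho2).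
split; first by exists rho, k1, d1.
- by exists rho, k2, d2.
- by rewrite tE (ftype_union red1 red2).
move: E; rewrite tE (ftype_union red1 red2) (base_union red1 red2) card_eset_union.
have := card_vset_union; have r1 := ftype_range (heads H1 x) (heads H1 y) k1.
have r2 := ftype_range (heads H2 x) (heads H2 y) k2.
rewrite /gcomb /comb; move: E1 E2 r1 r2.
case: (ftype (heads H1 x) (heads H1 y) k1) => [|[|[|]]] //;
  case: (ftype (heads H2 x) (heads H2 y) k2) => [|[|[|]]] //=; clear; lia.
Qed.

End Union.
End Profile.

(** * The edge xy and the genus of a sum *)

Section Interface.
Local Open Scope group_scope.
Variable T : finType.
Variables x y : T.
Hypothesis xy : x != y.
Implicit Types (G H : graph T) (u v w : T) (d : T * T) (rho : {ffun T -> {perm T}}).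

(** Adding the edge xy is a sum with this graph; later the same device adds a bridge between two
    arbitrary vertices. *)
Definition K2 : graph T := Graph [set x; y] [set [set x; y]].

Lemma adj_K2 u v : adj K2 u v = ((u, v) == (x, y)) || ((u, v) == (y, x)).
Proof.
rewrite /adj /= inE; apply/eqP/orP => [/(set2_eq xy)[] ->|]; rewrite ?eqxx; auto.
by case=> /eqP[-> ->] //; rewrite setUC.
Qed.

Lemma good_K2 : good x y K2.
Proof.
split; rewrite ?inE ?eqxx ?orbT //.
  by apply/forall_inP => e; rewrite inE => /eqP ->; rewrite cards2 xy subxx.
have cxy : connect (adj K2) x y by apply: connect1; rewrite adj_K2 eqxx.
have cyx : connect (adj K2) y x by apply: connect1; rewrite adj_K2 eqxx orbT.
apply/andP; split; first by apply/set0Pn; exists x; rewrite !inE eqxx.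
by apply/forall_inP => u /set2P[] ->; apply/forall_inP => v /set2P[] ->.
Qed.

Lemma darts_K2 : darts K2 = [set (y, x); (x, y)].
Proof. by apply/setP => -[u v]; rewrite mem_darts adj_K2 !inE orbC. Qed.

Lemma heads_K2x : heads K2 x = [set (y, x)].
Proof.
apply/setP => -[u v]; rewrite inE darts_K2 !inE /= !xpair_eqE.
by case: (eqVneq v x) => [->|]; rewrite ?(negPf xy) ?andbF ?andbT ?orbF.
Qed.

Lemma heads_K2y : heads K2 y = [set (x, y)].
Proof.
apply/setP => -[u v]; rewrite inE darts_K2 !inE /= !xpair_eqE.
by case: (eqVneq v y) => [->|]; rewrite ?(eq_sym y x) ?(negPf xy) ?andbF ?andbT.
Qed.

Lemma psi_K2 rho : rot_off x y K2 rho -> psi x y K2 rho = tperm (y, x) (x, y).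
Proof.
move=> rot; have nx : y \in nbrs K2 x by rewrite mem_nbrs darts_K2 !inE eqxx.
have ny : x \in nbrs K2 y by rewrite mem_nbrs darts_K2 !inE eqxx orbT.
apply/permP => d; case: tpermP => [->|->|d1 d2].
- by rewrite psi_terminal ?eqxx.
- by rewrite psi_terminal ?eqxx ?orbT.
- apply: (out_perm (psi_on x y K2 rho)); rewrite darts_K2 !inE negb_or.
  by apply/andP; split; apply/eqP.
Qed.

Lemma profile_K2 t g : profile x y t K2 g <-> t = 1%N /\ g = 0%N.
Proof.
have ne : (y, x) != (x, y) by rewrite xpair_eqE negb_and eq_sym xy.
have [bE fE] := base_swap ne.
have cV : #|vset K2| = 2 by rewrite cards2 xy.
have cE : #|eset K2| = 1%N by rewrite cards1.
have red rho : rot_off x y K2 rho ->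
    reduces (darts K2) (terminals x y K2) (psi x y K2 rho) (tperm (y, x) (x, y)) 0.
  move=> rot; rewrite psi_K2 //; split=> [|r _]; last by rewrite addn0.
  by rewrite /terminals heads_K2x heads_K2y tperm_on.
split=> [[rho [k [c [rot red' tE E]]]]|[-> ->]].
  have [kE c0] := reduces_uniq red' (red rho rot); subst k c.
  rewrite heads_K2x heads_K2y fE in tE; subst t.
  by move: E; rewrite heads_K2x heads_K2y bE cV cE /=; split=> //; move: E; clear; lia.
pose rho : {ffun T -> {perm T}} := [ffun=> 1].
have rot : rot_off x y K2 rho.
  move=> v vx vy u; rewrite mem_nbrs darts_K2 !inE !xpair_eqE.
  by rewrite (negPf vx) (negPf vy) !andbF.
exists rho, (tperm (y, x) (x, y)), 0; split=> //; first exact: red.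
  by rewrite heads_K2x heads_K2y fE.
by rewrite heads_K2x heads_K2y bE cV cE.
Qed.

Lemma add_xyE G : x \in vset G -> y \in vset G -> add_xy x y G = gunion G K2.
Proof.
move=> xG yG; rewrite /add_xy /gunion; congr Graph; last by rewrite setUC.
by apply/esym/setUidPl/subsetP => u /set2P[] ->.
Qed.

Lemma add_xy_id G : [set x; y] \in eset G -> add_xy x y G = G.
Proof.
case: G => V E /= xyE; congr Graph.
by apply/setUidPr; rewrite sub1set.
Qed.

Section AddEdge.
Variable G : graph T.
Hypothesis gG : good x y G.
Let xG : x \in vset G. Proof. by case: gG. Qed.
Let yG : y \in vset G. Proof. by case: gG. Qed.

Let VI : vset G :&: vset K2 = [set x; y].
Proof. by apply/setIidPr/subsetP => u /set2P[] ->. Qed.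

Let EI : [set x; y] \notin eset G -> eset G :&: eset K2 = set0.
Proof. by move=> nxy; apply: disjoint_setI0; rewrite disjoint_sym disjoints1. Qed.

Lemma good_add : good x y (add_xy x y G).
Proof.
have [xyE|nxy] := boolP ([set x; y] \in eset G); first by rewrite add_xy_id.
by rewrite add_xyE //; apply: good_union gG good_K2.
Qed.

(** For adjacent terminals [psi] sends the dart into [x] along the edge xy to its reverse, a dart
    into [y], which is a passage. *)
Lemma has0_nadj g : profile x y 0 G g -> [set x; y] \notin eset G.
Proof.
move=> [rho [k [c [rot red tE _]]]]; apply/negP => xyE.
have yx : y \in nbrs G x by rewrite inE.
have dX : (y, x) \in heads G x by rewrite mem_heads.
have dY : (x, y) \in heads G y by rewrite mem_heads inE adjC.
have L0 : leaving (heads G x) k == set0.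
  by move: tE; rewrite /ftype; case: ifP => // _; case: ifP.
have : (x, y) \in porbit (1 * psi x y G rho) (y, x).
  rewrite mul1g -(psi_terminal rot yx) ?eqxx // mem_porbit1; exact: porbit_id.
rewrite (reduces_porbit red) ?terminals_sub ?perm_on1 ?in_setU ?dX ?dY ?orbT //.
rewrite mul1g => /(subsetP (porbit_stable (leaving0P _ _ L0) dX)).
by rewrite (disjointFl (disjoint_heads G xy) dY).
Qed.

(** The new edge has type 1 and genus 0, so it fits into a face at both terminals if there is one,
    and needs a handle in type 0. *)
Lemma profile_add t g : profile x y t G g -> 
  profile x y (if t == 0 then 1%N else t) (add_xy x y G) (g + (t == 0)).
Proof.
have [xyE|nxy] := boolP ([set x; y] \in eset G).
  rewrite add_xy_id //; case: eqP => [->|_]; last by rewrite addn0.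
  by move/has0_nadj; rewrite xyE.
move=> hg; have h2 := (profile_K2 1 0).2 (conj erefl erefl).
have [a ha] := profile_union xy gG good_K2 VI (EI nxy) hg h2.
rewrite -add_xyE // in ha; move: ha; rewrite /gcomb /comb orbF andbF !addn0 => ha E.
rewrite -E; move: ha (profile_range hg); clear.
by case: t => [|[|[|]]].
Qed.

Lemma profile_add_inv t g : profile x y t (add_xy x y G) g -> 0 < t /\
  (profile x y t G g \/ t = 1%N /\ exists2 g', profile x y 0 G g' & g = g'.+1).
Proof.
have [xyE|nxy] := boolP ([set x; y] \in eset G).
  rewrite add_xy_id // => hg; split; last by left.
  by rewrite lt0n; apply: contraTneq xyE => t0; rewrite t0 in hg; apply: has0_nadj hg.
rewrite add_xyE // => /(profile_split xy gG good_K2 VI (EI nxy)).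
move=> [t1 [t2 [a1 [a2 [h1 /profile_K2[-> ->] -> E]]]]].
have r1 := profile_range h1; move: E h1 r1; rewrite /gcomb /comb.
case: t1 => [|[|[|]]] //= E h1 _; rewrite !addn0 in E; split=> //.
- by right; split=> //; exists a1; rewrite // E addn1.
- by left; rewrite E.
- by left; rewrite E.
Qed.

Local Notation g := (genus G).
Local Notation gp := (genus (add_xy x y G)).
Local Notation ep := (epsilonp x y G).

Lemma genus_le_add : g <= gp.
Proof.
have [t ht] := genus_profile xy good_add; have [_ [h|[_ [g' h E]]]] := profile_add_inv ht.
  exact: profile_genus_le h.
by rewrite E; apply: leqW; apply: profile_genus_le h.
Qed.

Lemma genus_add_le : gp <= g.+1.
Proof.
have [t ht] := genus_profile xy gG; apply: leq_trans (profile_genus_le xy good_add (profile_add ht)) _.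
by rewrite -addn1 leq_add2l leq_b1.
Qed.

Lemma epsilonpP : reflect (profile x y 2 (add_xy x y G) gp) (ep == 1%N).
Proof. exact: epsilonP good_add. Qed.

Lemma epsilonp01 : (ep == 0) || (ep == 1%N).
Proof. by rewrite /epsilonp /epsilon; case: [exists _, _]. Qed.

Lemma epsilon01 : (epsilon x y G == 0) || (epsilon x y G == 1%N).
Proof. by rewrite /epsilon; case: [exists _, _]. Qed.

Lemma epsilon_add : epsilon x y G = 1%N -> gp = g /\ ep = 1%N.
Proof.
move=> /eqP/(epsilonP xy gG) h; have h' := profile_add h; rewrite /= addn0 in h'.
have E : gp = g.
  by apply/eqP; rewrite eqn_leq genus_le_add (profile_genus_le xy good_add h').
by split=> //; apply/eqP/epsilonpP; rewrite E.
Qed.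

Lemma epsilonp_eq : ep = 1%N -> gp = g -> epsilon x y G = 1%N.
Proof.
move=> /eqP/epsilonpP h E; apply/eqP/(epsilonP xy gG); rewrite -E.
by have [_ [//|[]]] := profile_add_inv h.
Qed.

End AddEdge.

Section Amalgam.
Variables G1 G2 : graph T.
Hypotheses (g1 : good x y G1) (g2 : good x y G2).
Hypothesis VI : vset G1 :&: vset G2 = [set x; y].
Hypothesis EI : eset G1 :&: eset G2 = set0.

Local Notation g := genus.
Local Notation gp G := (genus (add_xy x y G)).
Local Notation ep G := (epsilonp x y G).

Lemma genus_union_le : g (gunion G1 G2) <= (g G1 + g G2).+1.
Proof.
have [t1 h1] := genus_profile xy g1; have [t2 h2] := genus_profile xy g2.
have [a ha E] := profile_union xy g1 g2 VI EI h1 h2.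
apply: leq_trans (profile_genus_le xy (good_union g1 g2) ha) _.
by move: E; rewrite /gcomb; do !case: (_ == _) => /=; clear; lia.
Qed.

(** The genus with the edge xy is read off from a profile of [G] itself, type 0 being charged the
    handle that this edge needs. *)
Lemma profile_plus G : good x y G -> exists t a,
  [/\ profile x y t G a, a + (t == 0) = gp G & ep G = 1%N -> t = 2].
Proof.
move=> gG; have [e1|e1] := eqVneq (ep G) 1%N.
  have h := epsilonpP gG (introT eqP e1).
  have [_ [h'|[]//]] := profile_add_inv gG h.
  by exists 2, (gp G); rewrite addn0.
have [t h] := genus_profile xy (good_add gG).
have [t0 [h'|[t1 [g' h' E]]]] := profile_add_inv gG h.
  by exists t, (gp G); split=> //; rewrite ?eqn0Ngt ?t0 ?addn0 // => /eqP; rewrite (negPf e1).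
by exists 0, g'; split=> //; [rewrite addn1|move/eqP; rewrite (negPf e1)].
Qed.

Lemma genus_union_le_plus : g (gunion G1 G2) + ep G1 * ep G2 <= gp G1 + gp G2.
Proof.
have [t1 [a1 [h1 E1 e1]]] := profile_plus g1; have [t2 [a2 [h2 E2 e2]]] := profile_plus g2.
have [a ha E] := profile_union xy g1 g2 VI EI h1 h2.
have := profile_genus_le xy (good_union g1 g2) ha; rewrite -E1 -E2.
move: E; rewrite /gcomb; have := epsilonp01 G1; have := epsilonp01 G2.
have weak : a + ((t1 == 2) && (t2 == 2)) = a1 + a2 + ((t1 == 0) || (t2 == 0)) ->
    genus (gunion G1 G2) <= a ->
    genus (gunion G1 G2) <= a1 + (t1 == 0) + (a2 + (t2 == 0)).
  by case: (t1 == 0); case: (t2 == 0); case: (_ && _); clear; rewrite /=; lia.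
case/orP => /eqP b2; case/orP => /eqP b1 E le; rewrite b1 b2 ?muln0 ?addn0;
  try exact: weak.
by move: E le; rewrite (e1 b1) (e2 b2) /=; clear; lia.
Qed.

(** An optimal embedding of the union is split. A side of type 0 costs a handle, which gives the
    first case. Otherwise each side admits the edge xy at the same genus, and the handle saved by
    two sides of type 2 matters only if both are optimal, in which case both [epsilonp] are 1. *)
Lemma genus_union_ge : (g G1 + g G2 < g (gunion G1 G2)) ||
  (gp G1 + gp G2 <= g (gunion G1 G2) + ep G1 * ep G2).
Proof.
have [t h] := genus_profile xy (good_union g1 g2).
have [t1 [t2 [a1 [a2 [h1 h2 _ E]]]]] := profile_split xy g1 g2 VI EI h.
have l1 := profile_genus_le xy g1 h1; have l2 := profile_genus_le xy g2 h2.
have p1 := profile_genus_le xy (good_add g1) (profile_add g1 h1).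
have p2 := profile_genus_le xy (good_add g2) (profile_add g2 h2).
move: E; rewrite /gcomb.
have [t10|t10] := eqVneq t1 0.
  by rewrite t10 /= addn0 => E; apply/orP; left; move: E l1 l2; clear; lia.
have [t20|t20] := eqVneq t2 0.
  by rewrite t20 /= andbF addn0 => E; apply/orP; left; move: E l1 l2; clear; lia.
rewrite (negPf t10) addn0 in p1; rewrite (negPf t20) addn0 in p2.
rewrite /= addn0 => E; apply/orP; right.
have [/andP[/eqP t12 /eqP t22]|n22] := boolP ((t1 == 2) && (t2 == 2)); last first.
  by rewrite (negPf n22) addn0 in E; move: E p1 p2; clear; lia.
rewrite t12 t22 /= in E; rewrite t12 in h1; rewrite t22 in h2.
have [e1|e1] := eqVneq a1 (gp G1); last first.
  by move: E p1 p2 => E; rewrite leq_eqVlt eq_sym (negPf e1) /=; move: E; clear; lia.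
have [e2|e2] := eqVneq a2 (gp G2); last first.
  by move: E p1 p2 => E p1; rewrite leq_eqVlt eq_sym (negPf e2) /=; move: E p1; clear; lia.
have ee1 : ep G1 = 1%N by apply/eqP/(epsilonpP g1); rewrite -e1; have := profile_add g1 h1; rewrite addn0.
have ee2 : ep G2 = 1%N by apply/eqP/(epsilonpP g2); rewrite -e2; have := profile_add g2 h2; rewrite addn0.
by rewrite ee1 ee2 -e1 -e2 E.
Qed.

End Amalgam.
End Interface.

(** * Edges separating the terminals *)

Section Bars.
Local Open Scope group_scope.
Variable T : finType.
Implicit Types (G H : graph T) (u v w p q : T) (d : T * T) (rho : {ffun T -> {perm T}}).
Implicit Types S : {set T}.

Definition uncrossed G S := forall u v, adj G u v -> (u \in S) = (v \in S).

(* Each of the two cycles obtained by cutting an alternating face at p goes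
   from p to q, hence traverses the bar in the same direction. *)
Lemma bar_alt G rho S p q (b : {set T}) : (forall v, rot_at G rho v) -> p != q ->
  p \in S -> q \notin S ->
  (forall u v, adj G u v -> u \in S -> v \notin S -> [set u; v] = b) ->
  ~ alt (heads G p) (heads G q) (fperm G rho).
Proof.
move=> rot pq pS qS cross [a [a' [aX a'X ne aa' [[z zY za] [z' z'Y za']]]]].
set f := fperm G rho in aa' za za'; set t := tperm a a' * f in za za'.
have fD : perm_on (darts G) f by apply: restr_perm_on.
have resp := rot_at_respects rot.
have XD := subsetP (heads_sub G p).
have tD e : e \in darts G -> t e \in darts G /\ (t e).1 = e.2.
  move=> eD; have [e' [e'D e'E eE]] : exists e', [/\ e' \in darts G, e'.2 = e.2 & t e = f e'].
    exists (tperm a a' e); rewrite permM; split=> //; first by case: tpermP => // _; apply: XD.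
    have h2 (h : T * T) : h \in heads G p -> h.2 = p by rewrite inE => /andP[_ /eqP].
    by case: tpermP => // ->; rewrite !h2.
  by rewrite eE perm_closed // fpermE //= e'E.
have cr h h' : h \in heads G p -> h' \in heads G q -> h' \in porbit t h ->
    exists2 e, e \in porbit t h & [/\ e \in darts G, e.1 \in S & e.2 \notin S].
  move=> hX hY hh'.
  have [/existsP[e /and4P[? ? ? ?]]|/existsPn none] := boolP [exists e, [&& e \in porbit t h,
      e \in darts G, e.1 \in S & e.2 \notin S]]; first by exists e.
  pose Q := [set e in darts G | (e \in porbit t h) && (e.2 \in S)].
  have st e : e \in Q -> t e \in Q.
    move/setIdP => [eD /andP[eh eS]]; have [teD te1] := tD e eD; apply/setIdP; split=> //.
    have := none (t e); rewrite mem_porbit1 eh teD te1 eS /= negbK => ->.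
    by [].
  have hD : h \in Q.
    apply/setIdP; split; first exact: XD.
    by have [w wp hE] := headsP hX; rewrite porbit_id hE.
  have := subsetP (porbit_stable st hD) _ hh' => /setIdP[_ /andP[_]].
  by have [w _ ->] := headsP hY; rewrite /= (negPf qS).
have [[e1 e2] eP [eD eS1 eS2]] := cr _ _ aX zY za.
have [[e1' e2'] eP' [eD' eS1' eS2']] := cr _ _ a'X z'Y za'.
rewrite !mem_darts /= in eD eD' eS1 eS1' eS2 eS2'.
have E : (e1, e2) = (e1', e2').
  have ne' : e1' != e2' by apply: contraNneq eS2' => <-.
  have [//|[E1 E2]] := set2_eq ne' (etrans (cross _ _ eD eS1 eS2) (esym (cross _ _ eD' eS1' eS2'))).
  by rewrite E1 (negPf eS2') in eS1.
have : a \in porbit t a'.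
  by rewrite porbit_sym in eP; apply: porbit_trans eP _; rewrite E.
by rewrite mem_porbit_plen // tpermKg (plen_split aa' ne) ltnNge leqnSn.
Qed.

(** Type 2 survives the removal of the edge xy, so [epsilonp] equal to 1 would give an alternating
    embedding of [G] itself, against [bar_alt]. The complement of [S] serves for the opposite order
    of the terminals. *)
Lemma bar_epsilonp x y G S (b : {set T}) : x != y -> good x y G ->
  x \in S -> y \notin S ->
  (forall u v, adj G u v -> u \in S -> v \notin S -> [set u; v] = b) ->
  epsilonp x y G = 0.
Proof.
move=> xy gG xS yS cross; case/orP: (epsilonp01 x y G) => /eqP // e1.
have sG : simple_graph G by case: gG.
have h := epsilonpP xy gG (introT eqP e1).
have [_ [h'|[]//]] := profile_add_inv xy gG h.
have [rho [rot _ al]] := profile_rotation xy gG h'.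
have {}rot := rotation_systemP rho sG rot.
case: ((alternatingP xy rot).1 (al erefl)).
  by move/(bar_alt rot xy xS yS cross).
have cross' u v : adj G u v -> u \in ~: S -> v \notin ~: S -> [set u; v] = b.
  by rewrite !inE negbK setUC adjC => uv uS vS; apply: cross.
rewrite eq_sym in xy; have xS' : x \notin ~: S by rewrite inE negbK.
have yS' : y \in ~: S by rewrite inE.
by move/(bar_alt rot xy yS' xS' cross').
Qed.

(** * Bridges and the lengths of face permutations *)

Section Insertion.
Variable A : finType.
Implicit Types (f r s : {perm A}) (Q X : {set A}).

(** [f] traces the old faces; [d] and [e] are the darts of the new edge. Each is inserted into an
    old face, a merge unless its end was isolated, and [tperm d e] joins the two faces, which lie on
    different sides of [Q]. The places of insertion do not matter. *)
Lemma plen_bridge f (a b d e : A) Q : f d = d -> f e = e -> d != e ->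
  (forall z, z \in Q -> f z \in Q) -> e \notin Q -> b \notin Q -> b != d ->
  (a \in Q \/ a = d) -> a != e ->
  plen (tperm e b * tperm d a * f * tperm d e) = plen f + 1 + (a != d) + (b != e).
Proof.
move=> fd fe de Qst eQ bQ bd aQ ae; rewrite plenC.
have ab : a != b.
  by case: aQ => [aQ|->]; [apply: contraTneq aQ => -> | rewrite eq_sym].
have tt : tperm e b * tperm d a = tperm d a * tperm e b.
  apply: (perm_onC (tperm_on _ _) (tperm_on _ _)).
  rewrite -setI_eq0; apply/eqP/setP => z; rewrite !inE.
  apply/negP => /andP[/orP[]/eqP -> /orP[]/eqP E].
  - by rewrite E eqxx in de.
  - by rewrite E eqxx in ae.
  - by rewrite E eqxx in bd.
  - by rewrite E eqxx in ab.
rewrite tt -mulgA.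
pose s1 := tperm e b * f.
have l1 : plen s1 = plen f + (b != e).
  have [be|be] := eqVneq b e; first by rewrite /s1 be tperm1 mul1g addn0.
  rewrite /s1 plen_merge ?addn1 // porbit_sym porbit_eq_id // inE //.
have s1d : s1 d = d.
  by rewrite permM tpermD // eq_sym.
have l2 : plen (tperm d a * s1) = plen s1 + (a != d).
  have [->|ad] := eqVneq a d; first by rewrite tperm1 mul1g addn0.
  by rewrite plen_merge ?addn1 // porbit_sym porbit_eq_id // inE.
rewrite -/s1 plen_merge ?l2 ?l1; first by clear; lia.
set s2 := tperm d a * s1.
have Q2 z : z \in d |: Q -> s2 z \in d |: Q.
  have fQ (w : A) : w \in Q -> s1 w \in d |: Q.
    move=> wQ; rewrite permM tpermD; first by rewrite in_setU1 Qst ?orbT.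
      by apply: contraTneq wQ => <-.
    by apply: contraTneq wQ => <-.
  move=> zQ; rewrite permM; case: tpermP => [zd|za|zd za].
  - by case: aQ => [/fQ //|->]; rewrite s1d in_setU1 eqxx.
  - by rewrite s1d in_setU1 eqxx.
  - by move: zQ; rewrite in_setU1 => /orP[/eqP //|/fQ].
have dQ : d \in d |: Q by rewrite in_setU1 eqxx.
apply/negP; rewrite porbit_sym => /(subsetP (porbit_stable Q2 dQ)).
by rewrite in_setU1 eq_sym (negPf de) (negPf eQ).
Qed.

Lemma full_remove X r (a : A) : a \notin X -> full_cycle (a |: X) r ->
  exists b r0, [/\ full_cycle X r0, r = tperm a b * r0 &
                   if X == set0 then b = a else b \in X].
Proof.
move=> aX [rX pX]; have aaX : a \in a |: X by rewrite setU11.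
pose b := r^-1 a; exists b, (tperm a b * r); rewrite tpermKg.
have rb : r b = a by rewrite permKV.
set r0 := tperm a b * r.
have r0a : r0 a = a by rewrite permM tpermL rb.
have bX : b \in a |: X by rewrite perm_closed // perm_onV.
have XE : (a |: X) :\ a = X by rewrite setU1K.
have r0X : perm_on X r0.
  rewrite -XE; apply: perm_onD1 r0a; apply: perm_onM rX.
  by apply: perm_on_tperm.
have [X0|X0] := eqVneq X set0.
  split=> //; first by split=> // u; rewrite X0 inE.
  by move: bX; rewrite X0 setU0 inE => /eqP.
have ba : b != a.
  apply: contraNneq X0 => ba; have ra : r a = a by rewrite -{1}ba.
  have := pX a aaX; rewrite porbit_eq_id // => E.
  by rewrite -XE -E setDv.
have bX' : b \in X by move: bX; rewrite in_setU1 (negPf ba).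
split=> //; split=> // u uX; apply/eqP; rewrite eqEsubset.
rewrite porbit_on_sub //=.
have nab : a \notin porbit r0 b.
  by apply/negP => /(subsetP (porbit_on_sub r0X bX')); rewrite (negPf aX).
have E : a |: porbit r0 b = a |: X.
  by rewrite -(pX a aaX) -(porbit_eq_id r0a) -(porbit_merge nab) tpermKg.
have Eb : porbit r0 b = X by rewrite -XE -E setU1K.
have : u \in porbit r0 b by rewrite Eb.
by rewrite -eq_porbit_mem => /eqP ->; rewrite Eb.
Qed.

End Insertion.

Section Bridge.
Variables (G : graph T) (p q : T) (S : {set T}).
Hypotheses (pq : p != q) (pG : p \in vset G) (qG : q \in vset G).
Hypotheses (un : uncrossed G S) (pS : p \in S) (qS : q \notin S).

Local Notation H := (add_xy p q G).
Local Notation d := (p, q).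
Local Notation e := (q, p).

Lemma bridge_new : [set p; q] \notin eset G.
Proof. by apply/negP => pqG; have := @un p q pqG; rewrite pS (negPf qS). Qed.

Lemma bridge_disjoint : eset G :&: eset (K2 p q) = set0.
Proof. by apply: disjoint_setI0; rewrite disjoint_sym disjoints1; apply: bridge_new. Qed.

Lemma heads_bridge_p : heads H p = e |: heads G p.
Proof. by rewrite add_xyE // heads_union (heads_K2x pq) setUC. Qed.

Lemma heads_bridge_q : heads H q = d |: heads G q.
Proof. by rewrite add_xyE // heads_union (heads_K2y pq) setUC. Qed.

Lemma rot_off_bridge rho : rot_off p q H rho <-> rot_off p q G rho.
Proof.
have nE v : v != p -> v != q -> nbrs H v = nbrs G v.
  move=> vp vq; apply/setP => u; rewrite inE [RHS]inE add_xyE // adj_union adj_K2 //.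
  by rewrite !xpair_eqE (negPf vp) (negPf vq) !orbF.
by split=> rot v vp vq u; [rewrite -nE // => uv|rewrite nE // => uv]; apply: rot.
Qed.

Lemma rot_off_K2 rho : rot_off p q (K2 p q) rho.
Proof.
move=> v vp vq u; rewrite inE adj_K2 // !xpair_eqE.
by rewrite (negPf vp) (negPf vq).
Qed.

Lemma psi_bridge rho : rot_off p q G rho ->
  psi p q H rho = psi p q G rho * tperm d e.
Proof.
move=> rot; have rotH := (rot_off_bridge rho).2 rot; rewrite add_xyE // in rotH *.
rewrite psi_union ?bridge_disjoint //; last exact: rot_off_K2.
by rewrite psi_K2 //; [rewrite tpermC|exact: rot_off_K2].
Qed.

Lemma dartN : (d \notin darts G) * (e \notin darts G).
Proof.
have N : adj G p q = false by apply/negbTE/bridge_new.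
by rewrite !mem_darts (adjC G q) N.
Qed.

Lemma plen_bridge_graph rho0 rho rp rq a b :
  (forall v, rot_at G rho0 v) -> rot_off p q G rho ->
  full_cycle (heads G p) rp -> full_cycle (heads G q) rq ->
  fperm G rho0 = rp * rq * psi p q G rho ->
  (if heads G p == set0 then b = e else b \in heads G p) ->
  (if heads G q == set0 then a = d else a \in heads G q) ->
  plen (tperm e b * rp * (tperm d a * rq) * psi p q H rho) =
  plen (fperm G rho0) + 1 + (heads G q != set0) + (heads G p != set0).
Proof.
move=> rot0 rot fp fq fE bE aE; rewrite psi_bridge //.
have [dN eN] := dartN.
have de : d != e by rewrite xpair_eqE negb_and pq.
have aH : a \in heads H q.
  by rewrite heads_bridge_q in_setU1; case: eqP aE => [_ ->|_ ->]; rewrite ?eqxx ?orbT.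
have dH : d \in heads H q by rewrite heads_bridge_q in_setU1 eqxx.
have bH : b \in heads H p.
  by rewrite heads_bridge_p in_setU1; case: eqP bE => [_ ->|_ ->]; rewrite ?eqxx ?orbT.
have h2 z v : z \in heads H v -> z.2 = v by rewrite inE => /andP[_ /eqP].
have -> : tperm e b * rp * (tperm d a * rq) * (psi p q G rho * tperm d e) =
          tperm e b * tperm d a * fperm G rho0 * tperm d e.
  rewrite fE !mulgA; do 3!congr (_ * _); rewrite -!mulgA; congr (_ * _).
  apply: (disjoint_perm_comm (disjoint_heads H pq)).
    by apply: perm_on_sub fp.1; rewrite heads_bridge_p subsetUr.
  by apply: perm_on_tperm.
have fD : perm_on (darts G) (fperm G rho0) by apply: restr_perm_on.
(* Without the bridge every face stays on one side; [Q] holds the darts on the side of [q]. *)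
pose Q := [set z in darts G | z.2 \notin S].
have NQ z : z \notin darts G -> z \notin Q by apply: contra => /setIdP[].
rewrite (plen_bridge (Q := Q)) ?(out_perm fD) ?(NQ _ eN) //.
- have -> : (a != d) = (heads G q != set0).
    case: eqP aE => [_ ->|_ aG]; first by rewrite eqxx.
    by apply: contraTneq aG => ->; apply: contra dN => /(subsetP (heads_sub _ _)).
  have -> // : (b != e) = (heads G p != set0).
    case: eqP bE => [_ ->|_ bG]; first by rewrite eqxx.
    by apply: contraTneq bG => ->; apply: contra eN => /(subsetP (heads_sub _ _)).
- move=> [u v] /setIdP[zD zS]; have fzD : fperm G rho0 (u, v) \in darts G by rewrite perm_closed.
  apply/setIdP; split=> //; move: fzD; rewrite fpermE //; last exact: rot_at_respects.
  by rewrite mem_darts /face_step => /un /= <-.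
- by apply/negP => /setIdP[_ bS]; rewrite (h2 _ _ bH) pS in bS.
- by apply: contraNneq pq => E; have := h2 _ _ bH; rewrite E => /= ->.
- case: eqP aE => [_ ->|_ aG]; [by right|left; apply/setIdP; split].
    exact: (subsetP (heads_sub _ _) _ aG).
  by rewrite (h2 _ _ aH).
- by apply: contraNneq pq => E; have := h2 _ _ aH; rewrite E => /= ->.
Qed.

(** The change in length depends only on which ends are otherwise isolated. Together with
    [bridge_insert] this allows a bridge to be moved at constant genus. *)
Lemma bridge_remove rho : (forall v, rot_at H rho v) ->
  exists2 rho0, (forall v, rot_at G rho0 v) &
    plen (fperm H rho) =
    plen (fperm G rho0) + 1 + (heads G q != set0) + (heads G p != set0).
Proof.
move=> rot; have [fp fq fE] := split_rot pq rot.
have [dN eN] := dartN.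
have off : rot_off p q G rho by apply/rot_off_bridge => v _ _; apply: rot.
rewrite heads_bridge_p in fp; rewrite heads_bridge_q in fq.
have eNp : e \notin heads G p by apply: contra eN => /(subsetP (heads_sub _ _)).
have dNq : d \notin heads G q by apply: contra dN => /(subsetP (heads_sub _ _)).
have [b [rp [fp0 pE bE]]] := full_remove eNp fp.
have [a [rq [fq0 qE aE]]] := full_remove dNq fq.
have [rho0 rot0 fE0] := make_rot pq off fp0 fq0.
exists rho0 => //; rewrite fE pE qE.
exact: (plen_bridge_graph rot0 off fp0 fq0 fE0).
Qed.

Lemma bridge_insert rho0 : (forall v, rot_at G rho0 v) ->
  exists2 rho, (forall v, rot_at H rho v) &
    plen (fperm H rho) =
    plen (fperm G rho0) + 1 + (heads G q != set0) + (heads G p != set0).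
Proof.
move=> rot0; have [fp fq fE0] := split_rot pq rot0.
have [dN eN] := dartN.
have off : rot_off p q G rho0 by move=> v _ _; apply: rot0.
have offH : rot_off p q H rho0 by apply/rot_off_bridge.
have ins (X : {set T * T}) r (z : T * T) : z \notin X -> full_cycle X r -> exists2 b,
    full_cycle (z |: X) (tperm z b * r) & if X == set0 then b = z else b \in X.
  move=> zX fX; have [X0|X0] := eqVneq X set0; last first.
    by have [b bX] := set0Pn _ X0; exists b => //; apply: full_insert.
  exists z => //; rewrite tperm1 mul1g X0 setU0.
  have -> : r = 1; last exact: full1.
  by apply/permP => u; rewrite perm1 (out_perm fX.1) // X0 inE.
have eNp : e \notin heads G p by apply: contra eN => /(subsetP (heads_sub _ _)).
have dNq : d \notin heads G q by apply: contra dN => /(subsetP (heads_sub _ _)).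
have [b fp' bE] := ins _ _ _ eNp fp; have [a fq' aE] := ins _ _ _ dNq fq.
rewrite -heads_bridge_p in fp'; rewrite -heads_bridge_q in fq'.
have [rho rot fE] := make_rot pq offH fp' fq'.
exists rho => //; rewrite fE.
exact: (plen_bridge_graph rot0 off fp fq fE0).
Qed.

End Bridge.

Lemma del_edgeK G (b : {set T}) p q : b = [set p; q] -> b \in eset G ->
  add_xy p q (del_edge G b) = G.
Proof. by case: G => V E /= -> pqE; rewrite /add_xy /= setD1K. Qed.

Lemma heads_connect G p q : connect (adj G) p q -> p != q -> heads G p != set0.
Proof.
move=> /connectP[[|w r] /=]; first by move=> _ ->; rewrite eqxx.
case/andP => pw _ _ _; apply/set0Pn; exists (w, p).
by rewrite mem_heads inE.
Qed.

End Bars.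

Section Operations.
Variable T : finType.
Implicit Types (G H : graph T) (u v w p q : T) (d : T * T) (rho : {ffun T -> {perm T}}).
Implicit Types (S b e : {set T}).

Lemma connectC G u v : connect (adj G) u v = connect (adj G) v u.
Proof. exact: (sym_connect_sym (adjC G)). Qed.

Lemma adj_del G b u v : adj (del_edge G b) u v = ([set u; v] != b) && adj G u v.
Proof. by rewrite /adj /= !inE. Qed.

Lemma simple_del G b : simple_graph G -> simple_graph (del_edge G b).
Proof.
by move=> sG; apply/forall_inP => e; rewrite !inE => /andP[_ /(forall_inP sG)].
Qed.

(** Up to its first use of the deleted edge, a path to [u] survives, and there it has reached an end
    of that edge. *)
Lemma del_connect G u v w : connect (adj G) w u ->
  connect (adj (del_edge G [set u; v])) w u || connect (adj (del_edge G [set u; v])) w v.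
Proof.
case/connectP => p; elim: p w => [|w' p IH] w /=; first by move=> _ ->; rewrite connect0.
case/andP => ww' pth uE; have [wb|wb] := eqVneq [set w; w'] [set u; v].
  have : w \in [set u; v] by rewrite -wb !inE eqxx.
  by case/set2P => ->; rewrite connect0 ?orbT.
have ww0 : connect (adj (del_edge G [set u; v])) w w'.
  by apply: connect1; rewrite adj_del wb.
by case/orP: (IH w' pth uE) => C; rewrite (connect_trans ww0 C) ?orbT.
Qed.

Definition conn_side G u := [set w | connect (adj G) u w].

Lemma conn_side_uncrossed G u : uncrossed G (conn_side G u).
Proof.
move=> v w vw; rewrite !inE; apply/idP/idP => C; apply: connect_trans C _; apply: connect1 => //.
by rewrite adjC.
Qed.

Lemma uncrossed_connect G S u v : uncrossed G S -> connect (adj G) u v ->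
  (u \in S) = (v \in S).
Proof.
move=> un /connectP[p]; elim: p u => [|w p IH] u /=; first by move=> _ ->.
by case/andP => /un -> pth /(IH _ pth).
Qed.

Section Good.
Variables x y : T.
Hypothesis xy : x != y.

Lemma good_intro G w : simple_graph G -> x \in vset G -> y \in vset G ->
  (forall u, u \in vset G -> connect (adj G) u w) -> good x y G.
Proof.
move=> sG xG yG C; split=> //; apply/andP; split; first by apply/set0Pn; exists x.
apply/forall_inP => u uG; apply/forall_inP => v vG.
by apply: connect_trans (C u uG) _; rewrite connectC C.
Qed.

Section Bar.
Variables (G : graph T) (b : {set T}).
Hypotheses (gG : good x y G) (bG : b \in eset G).

Lemma good_del : (forall u v, b = [set u; v] -> connect (adj (del_edge G b)) u v) ->
  good x y (del_edge G b).
Proof.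
have [sG cG xG yG] := gG; have [u [v [uv bE _ uG vG]]] := simple_edge sG bG.
move=> /(_ u v bE) C; apply: (@good_intro _ v) => //; first exact: simple_del.
move=> w /= wG; have := del_connect v (connG cG wG uG); rewrite -bE.
by case/orP => // wu; apply: connect_trans wu C.
Qed.

Lemma cut_split u v : b = [set u; v] -> u \in vset G -> forall w, w \in vset G ->
  connect (adj (del_edge G b)) w u || connect (adj (del_edge G b)) w v.
Proof.
have [sG cG xG yG] := gG; move=> bE uG w wG; rewrite bE; apply: del_connect.
exact: connG.
Qed.

Hypothesis bar : ~~ connect (adj (del_edge G b)) x y.
Local Notation G0 := (del_edge G b).
Local Notation S := (conn_side G0 x).

Lemma bar_split : exists u v, [/\ b = [set u; v], u \in vset G /\ v \in vset G,
  connect (adj G0) x u, connect (adj G0) y v & v \notin S].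
Proof.
have [sG cG xG yG] := gG; have [u [v [uv bE _ uG vG]]] := simple_edge sG bG.
have cx := cut_split bE uG xG; have cy := cut_split bE uG yG.
have no w : connect (adj G0) x w -> connect (adj G0) y w -> False.
  by move=> xw yw; case/negP: bar; apply: connect_trans xw _; rewrite connectC.
case/orP: cx => xu; case/orP: cy => yv.
- by case: (no u).
- exists u, v; split=> //; rewrite inE; apply/negP => xv; exact: no yv.
- exists v, u; rewrite setUC; split=> //; rewrite inE; apply/negP => xv; exact: no yv.
- by case: (no v).
Qed.

Lemma good_bar_swap : good x y (add_xy x y G0).
Proof.
have [sG cG xG yG] := gG; have [u [v [bE [uG vG] xu yv _]]] := bar_split.
have K := good_K2 xy.
have sub w w' : connect (adj G0) w w' -> connect (adj (add_xy x y G0)) w w'.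
  apply: connect_sub => a a' aa'; apply: connect1; move: aa'.
  by rewrite /adj /= !inE => ->; rewrite orbT.
apply: (@good_intro _ x); rewrite ?inE ?eqxx ?xG ?yG ?orbT //.
  apply/forall_inP => e; rewrite in_setU1 => /orP[/eqP ->|].
    by rewrite cards2 xy; apply/subsetP => z /set2P[] ->.
  exact: (forall_inP (simple_del b sG)).
move=> w /= wG; case/orP: (cut_split bE uG wG) => C; apply: connect_trans (sub _ _ C) _.
  by apply: sub; rewrite connectC.
apply: (@connect_trans _ _ y); first by apply: sub; rewrite connectC.
by apply: connect1; rewrite adjC /adj /= !inE eqxx.
Qed.

(** The bar is a bridge between the side of [x] and the side of [y], and so is xy once the bar is
    gone: the bridge is taken out and put back between the terminals. *)
Lemma bar_swap : genus (add_xy x y G0) <= genus G.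
Proof.
have [sG cG xG yG] := gG; have [u [v [bE [uG vG] xu yv vS]]] := bar_split.
have uS : u \in S by rewrite inE.
have un := @conn_side_uncrossed G0 x.
have uv : u != v by apply: contraNneq vS => <-.
have xS : x \in S by rewrite inE connect0.
have yS : y \notin S by rewrite inE.
have GE : add_xy u v G0 = G by apply: del_edgeK.
have [rho rot E] := genus_attained G.
have {}rot := rotation_systemP rho sG rot.
have rotE : forall w, rot_at (add_xy u v G0) rho w by rewrite GE.
have [rho0 rot0 E0] := bridge_remove (G := G0) uv uG vG un uS vS rotE.
have [rho1 rot1 E1] := bridge_insert (G := G0) xy xG yG un xS yS rot0.
(* Old and new end on one side are equal or both have a neighbour, so the correction terms agree. *)
have hE p q : connect (adj G0) p q -> (heads G0 p != set0) = (heads G0 q != set0).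
  move=> C; have [->//|pq] := eqVneq p q.
  by rewrite (heads_connect C pq) (@heads_connect _ _ q p) // 1?connectC // eq_sym.
have xyN : [set x; y] \notin eset G0 := bridge_new un xS yS.
have gH := good_bar_swap; have [sH cH _ _] := gH.
apply: leq_trans (genus_le (introT (rotation_systemP rho1 sH) rot1)) _; rewrite -E.
have emb1 := genus_emb xy gH rot1.
have emb := genus_emb xy gG rot.
have cE : #|eset (add_xy x y G0)| = #|eset G|.
  by rewrite /= cardsU1 xyN (cardsD1 b (eset G)) bG.
rewrite cE E1 in emb1; rewrite GE -(hE _ _ xu) -(hE _ _ yv) in E0.
by move: emb1 emb E0; rewrite /=; clear; lia.
Qed.

End Bar.
End Good.
End Operations.

(** * Contracting a cut-edge *)

Section Contraction.
Variable T : finType.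
Variables x y : T.
Implicit Types (G H : graph T) (u v w p q : T) (d : T * T) (rho : {ffun T -> {perm T}}).
Implicit Types (S e : {set T}).

Lemma contr_rep_in e : e != set0 -> contr_rep x y e \in e.
Proof.
move=> e0; rewrite /contr_rep; case: ifP => // _; case: ifP => // _.
by case: pickP => //= H; have [z ze] := set0Pn _ e0; have := H z; rewrite ze.
Qed.

Section Adj.
Variables (G : graph T) (e : {set T}).
Hypothesis sG : simple_graph G.
Local Notation c := (contr_map x y e).
Local Notation G' := (contr_edge x y G e).

Lemma adj_contrP p w : reflect (p != w /\ exists a b, [/\ adj G a b, p = c a & w = c b])
  (adj G' p w).
Proof.
apply: (iffP idP) => [|[pw [a [b [ab pE wE]]]]]; rewrite /adj /= inE.
  case/andP => /imsetP[a' a'G E]; rewrite cards2; case: (boolP (p != w)) => // pw _.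
  have [a [b [_ aE ab _ _]]] := simple_edge sG a'G; split=> //.
  have {}E : [set c a; c b] = [set p; w] by rewrite E aE imsetU1 imset_set1.
  case: (set2_eq pw E) => -[ca cb]; first by exists a, b.
  by exists b, a; split=> //; rewrite setUC.
rewrite cards2 pw andbT; apply/imsetP; exists [set a; b] => //.
by rewrite imsetU1 imset_set1 pE wE.
Qed.

Lemma simple_contr : simple_graph G'.
Proof.
apply/forall_inP => e'; rewrite inE => /andP[/imsetP[a' a'G ->] ->] /=.
by apply: imsetS; have /andP[] := forall_inP sG _ a'G.
Qed.

Lemma connect_contr u v : connect (adj G) u v -> connect (adj G') (c u) (c v).
Proof.
case/connectP => p; elim: p u => [|w p IH] u /=; first by move=> _ ->; rewrite connect0.
case/andP => uw pth vE; apply: connect_trans (IH w pth vE).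
have [->|ne] := eqVneq (c u) (c w); first exact: connect0.
by apply: connect1; apply/adj_contrP; split=> //; exists u, w.
Qed.

Lemma connected_contr : connected_graph G -> connected_graph G'.
Proof.
move=> cG; apply/andP; split.
  have /andP[/set0Pn[w wG] _] := cG; apply/set0Pn; exists (c w); exact: imset_f.
apply/forall_inP => _ /imsetP[u uG ->]; apply/forall_inP => _ /imsetP[v vG ->].
exact/connect_contr/connG.
Qed.

Hypotheses (xy : x != y) (eG : e \in eset G) (exy : e != [set x; y]).

Lemma contr_x : c x = x.
Proof. by rewrite /contr_map /contr_rep; case: ifP => // ->. Qed.

(** [contr_rep] prefers [x], so [y] could be absorbed only by contracting the edge xy. *)
Lemma contr_y : c y = y.
Proof.
rewrite /contr_map; case: ifP => // ye; rewrite /contr_rep ye; case: ifP => // xe.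
have /andP[/eqP ce _] := forall_inP sG e eG; case/eqP: exy; apply/esym/eqP.
by rewrite eqEcard ce cards2 xy andbT; apply/subsetP => z /set2P[] ->.
Qed.

Lemma good_contr : good x y G -> good x y G'.
Proof.
case=> _ cG xG yG; split; [exact: simple_contr|exact: connected_contr| |].
  by apply/imsetP; exists x; rewrite ?contr_x.
by apply/imsetP; exists y; rewrite ?contr_y.
Qed.

End Adj.

Section Bridge.
Local Open Scope group_scope.
Variables (G : graph T) (u v : T) (S : {set T}).
Local Notation e := [set u; v].
Local Notation G0 := (del_edge G e).
Local Notation G' := (contr_edge x y G e).
Local Notation c := (contr_map x y e).
Hypotheses (sG : simple_graph G) (cG : connected_graph G) (uvG : adj G u v).
Hypotheses (un : uncrossed G0 S) (uS : u \in S) (vS : v \notin S).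
Hypothesis rep : contr_rep x y e = u.

Let uv : u != v. Proof. by apply: contraNneq vS => <-. Qed.
Let vu : v != u. Proof. by rewrite eq_sym. Qed.
Let uG : u \in vset G. Proof. by case: (simple_adj sG uvG). Qed.
Let vG : v \in vset G. Proof. by case: (simple_adj sG uvG). Qed.
Let s0 : simple_graph G0. Proof. exact: simple_del. Qed.
Let s' : simple_graph G'. Proof. exact: simple_contr. Qed.

Local Notation tau := (tperm u v).

Lemma contrE a : c a = if a == v then u else a.
Proof.
rewrite /contr_map !inE rep; case: (eqVneq a u) => [->|_]; first by rewrite (negPf uv).
by case: (eqVneq a v).
Qed.

Lemma contr_in a : a \in S -> c a = a.
Proof. by move=> aS; rewrite contrE; case: eqP => // av; case/negP: vS; rewrite -av. Qed.

Lemma contr_out a : a \notin S -> c a = tau a.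
Proof.
move=> aS; rewrite contrE; case: tpermP => [au|->|_ /eqP/negPf ->] //; last by rewrite eqxx.
by rewrite au uS in aS.
Qed.

Lemma adj0_sides a b : adj G0 a b -> (a \in S) = (b \in S).
Proof. exact: un. Qed.

Lemma adj_bridgeP p w : reflect (exists a b, [/\ adj G0 a b, p = c a & w = c b])
  (adj G' p w).
Proof.
apply: (iffP (adj_contrP e sG p w)) => [[pw [a [b [ab pE wE]]]]|[a [b [ab pE wE]]]].
  exists a, b; split=> //; rewrite adj_del ab andbT; apply: contraNneq pw => E.
  have [[aE bE]|[aE bE]] := set2_eq uv E; rewrite pE wE aE bE !contrE eqxx (negPf uv) //.
have [ab1 /adj0_sides sab] : adj G a b /\ adj G0 a b.
  by split=> //; move: ab; rewrite adj_del => /andP[].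
have [nab _ _] := simple_adj s0 ab.
split; last by exists a, b.
rewrite pE wE; have [bS|bS] := boolP (b \in S).
  by rewrite !contr_in // sab.
by rewrite !contr_out ?sab // (inj_eq perm_inj).
Qed.

Definition swap2 (z : T * T) := (tau z.1, tau z.2).

Lemma swap2K : involutive swap2.
Proof. by case=> a b; rewrite /swap2 /= !tpermK. Qed.

Definition far := [set z in darts G0 | z.2 \notin S].

(** The condition is symmetric in [z] and [swap2 z], which makes this an involution of all pairs of
    vertices and not just a map on darts. *)
Definition mu_fun z := if (z \in far) || (swap2 z \in far) then swap2 z else z.

Lemma mu_funK : involutive mu_fun.
Proof.
move=> z; rewrite {2}/mu_fun; case: ifP => H; last by rewrite /mu_fun H.
by rewrite /mu_fun swap2K orbC H.
Qed.

(* mu identifies the darts of G0 with those of G': it renames v into u in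
   the darts on the side of v. *)
Definition mu : {perm T * T} := perm (inv_inj mu_funK).

Lemma muK z : mu (mu z) = z. Proof. by rewrite !permE mu_funK. Qed.

Lemma muV : mu^-1 = mu.
Proof. by apply/permP => z; apply: (@perm_inj _ mu); rewrite permKV muK. Qed.

Lemma mu0 a b : (a, b) \in darts G0 -> mu (a, b) = (c a, c b).
Proof.
move=> D; have ab : adj G0 a b by rewrite -mem_darts.
rewrite permE /mu_fun; have [bS|bS] := boolP (b \in S).
  have aS : a \in S by rewrite (adj0_sides ab).
  rewrite !contr_in //; case: ifP => // /orP[/setIdP[_]|/setIdP[]]; first by rewrite /= bS.
  rewrite mem_darts /= => /adj0_sides E tbS; move: (tbS); rewrite -E; move: tbS.
  have tS z : z \in S -> tau z \notin S -> z = u.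
    move=> zS; case: tpermP => [->//|->|_ _]; first by rewrite uS.
    by rewrite zS.
  move=> /(tS _ bS) bu /(tS _ aS) au; have [] := simple_adj s0 ab.
  by rewrite au bu eqxx.
have aS : a \notin S by rewrite (adj0_sides ab).
by rewrite (_ : (a, b) \in far) ?contr_out //; apply/setIdP.
Qed.

Lemma darts_contr : darts G' = mu @: darts G0.
Proof.
apply/setP => -[p w]; rewrite mem_darts; apply/adj_bridgeP/imsetP.
  by move=> [a [b [ab -> ->]]]; exists (a, b); rewrite ?mem_darts // mu0 ?mem_darts.
by move=> [[a b] ab]; rewrite mu0 // => -[-> ->]; exists a, b; rewrite -mem_darts.
Qed.

Lemma mu_darts z : (mu z \in darts G') = (z \in darts G0).
Proof. by rewrite darts_contr mem_imset //; apply: perm_inj. Qed.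

Lemma mu_darts' z : (mu z \in darts G0) = (z \in darts G').
Proof. by rewrite -mu_darts muK. Qed.

Lemma mu_head p w : (p, w) \in darts G' -> w != u -> w != v ->
  mu (p, w) = if w \in S then (p, w) else (tau p, w).
Proof.
move=> D' wu wv; have D0 : mu (p, w) \in darts G0 by rewrite mu_darts'.
have tw : tau w = w by rewrite tpermD // eq_sym.
move: D0; rewrite permE /mu_fun; case: ifP => [/orP H|/negbT]; rewrite /swap2 /= tw.
  case: ifP => // wS.
  by case: H => /setIdP[_]; rewrite /= ?tw wS.
rewrite negb_or => /andP[H _] D0; case: ifP => // /negbT wS.
by case/negP: H; apply/setIdP.
Qed.

Lemma mu_tail w q : (w, q) \in darts G' -> w != u -> w != v ->
  mu (w, q) = if w \in S then (w, q) else (w, tau q).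
Proof.
move=> D' wu wv; have D0 : mu (w, q) \in darts G0 by rewrite mu_darts'.
have tw : tau w = w by rewrite tpermD // eq_sym.
move: D0; rewrite permE /mu_fun; case: ifP => [/orP H|/negbT]; rewrite /swap2 /= tw.
  case: ifP => // wS.
  by case: H => /setIdP[]; rewrite /swap2 /= ?tw mem_darts => /adj0_sides <-; rewrite wS.
rewrite negb_or => /andP[H _] D0; case: ifP => // /negbT wS.
case/negP: H; apply/setIdP; split=> //=; rewrite mem_darts in D0.
by rewrite -(adj0_sides D0).
Qed.

Lemma nbrs_near w : w != u -> w != v -> w \in S -> nbrs G' w = nbrs G0 w.
Proof.
move=> wu wv wS; apply/setP => q; rewrite !mem_nbrs; apply/idP/idP => D.
  by have := mu_head D wu wv; rewrite wS => E; rewrite -E mu_darts'.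
have qS : q \in S by rewrite mem_darts in D; rewrite (adj0_sides D).
by have := mu0 D; rewrite !contr_in // => E; rewrite -E mu_darts.
Qed.

Lemma nbrs_far w : w != u -> w != v -> w \notin S -> nbrs G' w = tau @: nbrs G0 w.
Proof.
move=> wu wv wS; have cw : c w = w by rewrite contrE (negPf wv).
apply/setP => q; apply/idP/imsetP => [|[p]]; rewrite mem_nbrs => D; last move=> ->.
  exists (tau q); rewrite ?tpermK // mem_nbrs.
  by have := mu_head D wu wv; rewrite (negPf wS) => <-; rewrite mu_darts'.
have pS : p \notin S by rewrite mem_darts in D; rewrite (adj0_sides D).
have := mu0 D; rewrite cw contr_out // => E.
by rewrite mem_nbrs -E mu_darts.
Qed.

Lemma heads_mu : mu @: heads G' u = terminals u v G0.
Proof.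
apply/setP => z; apply/imsetP/setUP => [[z' z'X ->]|zX].
  have D' : z' \in darts G' by apply: subsetP (heads_sub _ _) _ z'X.
  have D0 : mu z' \in darts G0 by rewrite mu_darts'.
  move: z'X; rewrite inE => /andP[_]; rewrite -[z' in z'.2]muK.
  case: (mu z') D0 => a b D0; rewrite mu0 //= contrE => cb.
  case: (eqVneq b v) cb => [bv _|_ bu]; [right|left]; apply/setIdP; split=> //=.
  exact/eqP.
exists (mu z); last by rewrite muK.
have [D0 z2] : z \in darts G0 /\ (z.2 == u) || (z.2 == v).
  by case: zX => /setIdP[-> ->]; rewrite ?orbT.
apply/setIdP; rewrite mu_darts; split=> //.
case: z D0 z2 {zX} => a b D0 /= b2; rewrite mu0 //= contrE.
by case/orP: b2 => /eqP ->; rewrite ?(negPf uv) eqxx.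
Qed.

Lemma heads_contr_v : heads G' v = set0.
Proof.
apply/setP => -[a b]; rewrite in_set0; apply/negP => /setIdP[/=].
rewrite mem_darts => /adj_bridgeP[a' [b' [_ _ ->]]]; rewrite contrE.
by case: (eqVneq b' v) => [_|/negPf ->]; rewrite ?(negPf uv).
Qed.

Section Rotation.
Variable rho' : {ffun T -> {perm T}}.
Hypothesis rot' : forall w, rot_at G' rho' w.

(** On the far side the vertex [u] of the contracted graph stands for [v], so rotations there are
    conjugated by [tau]. *)
Definition unfold_rot : {ffun T -> {perm T}} :=
  [ffun w => if w \in S then rho' w else rho' w ^ tau].

Lemma unfold_rot_off : rot_off u v G0 unfold_rot.
Proof.
move=> w wu wv p pw; rewrite ffunE; case: ifPn => wS.
  by rewrite -nbrs_near // in pw *; apply: rot'.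
have tw : tau p \in nbrs G' w by rewrite nbrs_far // imset_f.
rewrite -{1}(tpermK u v p) porbitJ rot' // nbrs_far // -imset_comp.
rewrite -[RHS]imset_id; apply: eq_imset => z /=; exact: tpermK.
Qed.

Lemma contr_face : (fperm G' rho') ^ mu =
  (hperm G' rho' u) ^ mu * psi u v G0 unfold_rot.
Proof.
have [_ _ ->] := split_rot uv rot'.
have -> : hperm G' rho' v = 1.
  apply/permP => z; rewrite perm1; apply: (out_perm (restr_perm_on _ _)).
  by rewrite heads_contr_v inE.
rewrite mulg1 conjMg; congr (_ * _).
have off' : rot_off u v G' rho' by move=> w _ _; apply: rot'.
apply/permP => z; rewrite conjgE muV !permM.
have [D0|N0] := boolP (z \in darts G0); last first.
  by rewrite (out_perm (psi_on u v G' rho')) ?mu_darts // muK (out_perm (psi_on u v G0 _)).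
case: z D0 => p w D0; have D' : mu (p, w) \in darts G' by rewrite mu_darts.
have pw : p \in nbrs G0 w by rewrite mem_nbrs.
rewrite mu0 // in D' *; have pw' : c p \in nbrs G' (c w) by rewrite mem_nbrs.
have [wuv|] := boolP ((w == u) || (w == v)).
  have cw : c w = u by rewrite contrE; case/orP: wuv => /eqP ->; rewrite ?(negPf uv) ?eqxx.
  rewrite cw in pw' *; rewrite (psi_terminal (unfold_rot_off)) // (psi_terminal off' pw') ?eqxx //.
  have D0' : (w, p) \in darts G0 by rewrite mem_darts adjC -mem_darts.
  by have E := mu0 D0'; rewrite cw in E; rewrite -E muK.
case/norP => wu wv; have cw : c w = w by rewrite contrE (negPf wv).
rewrite cw in pw' *.
rewrite (psi_other unfold_rot_off) // (psi_other off') // ffunE mu_tail //; last first.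
  by rewrite mem_darts adjC -mem_darts -mem_nbrs -(rot' pw') mem_porbit1 porbit_id.
have sp := adj0_sides (etrans (esym (mem_darts _ _ _)) D0).
case: ifPn => wS; first by rewrite contr_in // sp.
by rewrite contr_out ?sp // -{2}(tpermK u v p) permJ.
Qed.

End Rotation.

Lemma card_contr_vset : #|vset G'| + 1 = #|vset G|.
Proof.
rewrite (cardsD1 v (vset G)) vG addnC; congr addn; congr #|pred_of_set _|.
apply/setP => w; apply/imsetP/setD1P => [[a aG ->]|[wv wG]].
  rewrite contrE; case: (eqVneq a v) => [_|av]; first by rewrite uv.
  by [].
by exists w; rewrite // contrE (negPf wv).
Qed.

Lemma card_contr_eset : #|eset G'| + 1 = #|eset G|.
Proof.
have eG : e \in eset G by [].
rewrite (cardsD1 e (eset G)) eG addnC; congr addn.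
have := card_darts s'; have := card_darts s0; rewrite darts_contr card_imset; last exact: perm_inj.
by move=> -> /double_inj ->.
Qed.

(** The rotation at the merged vertex becomes one full cycle on the darts at both ends of the edge.
    By the triangle inequality it gives a length of at least the number of cycles of [k0] on these
    darts minus one, and optimal rotations at [u] and [v] in [G] reach the corresponding value of
    Euler's formula. *)
Lemma genus_bridge : genus G <= genus G'.
Proof.
(* Euler's formula for the contracted graph uses two distinct vertices, so a graph consisting of the
   edge alone is treated apart. *)
have [/existsP[w /and3P[wG wu wv]]|/existsPn H] := boolP [exists w, [&& w \in vset G, w != u & w != v]];
  last first.
  have VE w : w \in vset G -> w \in [set u; v].
    move=> wG; have := H w; rewrite wG /= negb_and !negbK !inE //.
  have GE : G = K2 u v.
    have V2 : vset G = [set u; v].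
      apply/eqP; rewrite eqEsubset; apply/andP; split; first by apply/subsetP => w /VE.
      by apply/subsetP => w /set2P[] ->.
    have E1 : eset G = [set [set u; v]].
      apply/setP => e'; rewrite inE; apply/idP/eqP => [e'G|-> //].
      have [a [b [ab -> _ /VE aV /VE bV]]] := simple_edge sG e'G.
      apply/eqP; rewrite eqEcard !cards2 ab uv andbT.
      by apply/subsetP => z /set2P[] ->.
    by case: (G) V2 E1 => V E /= -> ->.
  have h := (profile_K2 uv 1 0).2 (conj erefl erefl).
  have := profile_genus_le uv (good_K2 uv) h; rewrite -GE leqn0 => /eqP ->; exact: leq0n.
have gG : good u v G by split.
have cG' : connected_graph G' by apply: connected_contr.
have [rho' rot' E'] := genus_attained G'.
have {}rot' := rotation_systemP rho' s' rot'.
have uG' : u \in vset G' by apply/imsetP; exists u; rewrite ?contrE ?(negPf uv).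
have wG' : w \in vset G' by apply/imsetP; exists w; rewrite ?contrE ?(negPf wv).
have emb' := emb_genusE s' cG' rot' wG' uG' wu.
rewrite -(plenJ _ mu) contr_face // in emb'.
set r := hperm G' rho' u ^ mu in emb'; set ro := unfold_rot rho' in emb'.
have off : rot_off u v G0 ro by apply: unfold_rot_off.
have fr : full_cycle (terminals u v G0) r.
  by rewrite -heads_mu; apply/fullJ/hperm_full/rot'.
have [k0 [c0 red]] := reduction (terminals_sub u v G0) (psi_on u v G0 ro).
have dXY := disjoint_heads G0 uv.
have kZ : perm_on (heads G0 u :|: heads G0 v) k0 := red.1.
have sE r' := red.2 r'.
have rQ : perm_on (~: (darts G0 :\: terminals u v G0)) r.
  by apply: perm_on_sub fr.1; apply/subsetP => z zZ; rewrite in_setC in_setD zZ.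
rewrite red.2 // in emb'.
(* No face of [G0] reaches both sides of the bridge, so there are no passages. *)
have L0 : leaving (heads G0 u) k0 = set0.
  apply/eqP/leaving0P => z zX; apply/negPn/negP => kX.
  have zZ : z \in terminals u v G0 by rewrite inE zX.
  have kzZ : k0 z \in terminals u v G0 by rewrite (perm_closed _ kZ).
  have : k0 z \in porbit (1 * k0) z by rewrite mul1g mem_porbit1 porbit_id.
  rewrite -(reduces_porbit red) ?terminals_sub ?perm_on1 // mul1g.
  have st (d : T * T) : d \in [set d in darts G0 | d.2 \in S] ->
      psi u v G0 ro d \in [set d in darts G0 | d.2 \in S].
    case: d => a b /setIdP[dD /= bS].
    have D1 : psi u v G0 ro (a, b) \in darts G0 by rewrite perm_closed // psi_on.
    apply/setIdP; split=> //; move: D1; rewrite /psi fpermE //; last exact: base_rot_respects.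
    by rewrite mem_darts => /adj0_sides <-.
  have zS : z \in [set d in darts G0 | d.2 \in S].
    by apply/setIdP; case/setIdP: zX => -> /eqP ->.
  move/(subsetP (porbit_stable st zS)) => /setIdP[_].
  have /setUP[/idP|/setIdP[_ /eqP ->]] := kzZ; first by rewrite (negPf kX).
  by rewrite (negPf vS).
have pe := plen_le_pure dXY kZ; have pg := plen_ge dXY kZ.
have mx := mixed_le (heads G0 u) k0; rewrite L0 cards0 in mx.
have tri := plen_triangle r k0.
(* The third vertex [w] remains connected to [u] or to [v], so the merged vertex has darts and its
   rotation has the length of a full cycle. *)
have [Z0|/set0Pn[z zZ]] := eqVneq (terminals u v G0) set0.
  have wc := connG cG wG uG.
  have wc0 := del_connect v wc.
  case/orP: wc0 => C; rewrite connectC in C.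
    have /set0Pn[z zX] : heads G0 u != set0 by apply: heads_connect C _; rewrite eq_sym.
    by have := in_set0 z; rewrite -Z0 in_setU zX.
  have /set0Pn[z zX] : heads G0 v != set0 by apply: heads_connect C _; rewrite eq_sym.
  by have := in_set0 z; rewrite -Z0 in_setU zX orbT.
have lr := plen_full zZ fr; rewrite cardsU disjoint_setI0 // cards0 subn0 in lr.
have GE : G = add_xy u v G0 by rewrite del_edgeK.
have ne : (v, u) != (u, v) by rewrite xpair_eqE negb_and vu.
have offH : rot_off u v (add_xy u v G0) ro by apply/rot_off_bridge.
have redG : reduces (darts G) (terminals u v G) (psi u v G ro) (k0 * tperm (v, u) (u, v)) (c0 + 0).
  have dd := darts_disjoint (bridge_disjoint un uS vS).
  rewrite {1 2 3}GE (psi_bridge (S := S)) // (tpermC (u, v)) add_xyE // darts_union terminals_union.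
  apply: reduces_prod; rewrite ?terminals_sub ?psi_on //.
    by rewrite (darts_K2 uv) tperm_on.
  split=> [|r0 _]; last by rewrite addn0.
  by rewrite /terminals heads_K2x // heads_K2y // tperm_on.
have offG : rot_off u v G ro by move: offH; rewrite -GE.
have [rho rotr [E _]] := reduction_optimal uv gG offG redG.
have hu : heads G u = heads G0 u :|: [set (v, u)].
  by have := heads_bridge_p (G := G0) uv uG vG; rewrite -GE setUC.
have hv : heads G v = heads G0 v :|: [set (u, v)].
  by have := heads_bridge_q (G := G0) uv uG vG; rewrite -GE setUC.
have dZ : [disjoint heads G0 u :|: heads G0 v & [set (v, u)] :|: [set (u, v)]].
  have [dN eN] := dartN un uS vS.
  apply: disjointWl (terminals_sub u v G0) _; rewrite -setI_eq0; apply/eqP/setP => d.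
  rewrite in_set0 in_setI in_setU !in_set1; apply/negP => /andP[dD /orP[]/eqP dE].
    by rewrite dE (negPf eN) in dD.
  by rewrite dE (negPf dN) in dD.
have tZ : perm_on ([set (v, u)] :|: [set (u, v)]) (tperm (v, u) (u, v)) := tperm_on _ _.
have [bE fE] := base_swap ne.
have lE : leaving [set (v, u)] (tperm (v, u) (u, v)) != set0.
  by apply/set0Pn; exists (v, u); rewrite !inE tpermL eq_sym ne eqxx.
have BE : base (heads G u) (heads G v) (k0 * tperm (v, u) (u, v)) =
    #|pure (heads G0 u) k0| + #|pure (heads G0 v) k0| + 1.
  by rewrite hu hv (base_prod dZ kZ tZ) bE /base L0 cards0 addn0.
(* The edge supplies the passage. Without passages of [k0] its length and its cycles add up to the
   number of darts, so its parity is even. *)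
have FE : ftype (heads G u) (heads G v) (k0 * tperm (v, u) (u, v)) = 1%N.
  have pE : parity [set (v, u)] [set (u, v)] (tperm (v, u) (u, v)) = false.
    by move: fE; rewrite /ftype (negPf lE); case: (parity _ _ _).
  rewrite /ftype hu hv (leaving_prod dZ kZ tZ) setU_eq0 (negPf lE) andbF.
  rewrite (parity_prod dZ kZ tZ) pE addbF /parity odd_plen /base L0 cards0 addn0.
  rewrite -!oddD ifN //; move: pe pg mx; clear; lia.
rewrite FE BE /= in E.
have cV := card_contr_vset; have cE := card_contr_eset.
apply: leq_trans (genus_le rotr) _; rewrite -E'.
by move: emb' E cV cE lr tri pe; clear; rewrite /=; lia.
Qed.

End Bridge.
End Contraction.

(** * Minor operations on one side of a minor-tight sum *)

Section MinorTight.
Variable T : finType.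
Variables x y : T.
Hypothesis xy : x != y.
Implicit Types (G H A B : graph T) (u v w : T) (e b : {set T}) (mu : minor_op T).

Lemma genus_bridge_contr G e u v : simple_graph G -> connected_graph G ->
  e \in eset G -> e = [set u; v] -> ~~ connect (adj (del_edge G e)) u v ->
  genus G <= genus (contr_edge x y G e).
Proof.
move=> sG cG; have H a c : [set a; c] \in eset G ->
    ~~ connect (adj (del_edge G [set a; c])) a c -> contr_rep x y [set a; c] = a ->
    genus G <= genus (contr_edge x y G [set a; c]).
  move=> acG nac rep.
  apply: (@genus_bridge T x y G a c (conn_side (del_edge G [set a; c]) a)) => //.
  - exact: conn_side_uncrossed.
  - by rewrite inE connect0.
  - by rewrite inE.
move=> eG eE nuv; rewrite eE in eG nuv *.
have : contr_rep x y [set u; v] \in [set u; v].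
  by apply: contr_rep_in; apply/set0Pn; exists u; rewrite !inE eqxx.
case/set2P => rep; first exact: H.
by move: eG nuv rep; rewrite setUC connectC => ? ? ?; apply: H.
Qed.

Lemma app_op_union mu A B :
  app_op x y mu (gunion A B) = gunion (app_op x y mu A) (app_op x y mu B).
Proof.
case: mu => e; rewrite /= /del_edge /contr_edge /gunion /=; congr Graph.
- by rewrite setDUl.
- by rewrite imsetU.
- by apply/setP => a; rewrite imsetU !inE andb_orl.
Qed.

(** Applied to the side that does not contain [e]: of its vertices only terminals can lie in [e],
    and contraction fixes them. *)
Lemma op_id mu G e : mu = inl e \/ mu = inr e -> simple_graph G -> e \notin eset G ->
  (forall w, w \in vset G -> contr_map x y e w = w) -> app_op x y mu G = G.
Proof.
move=> muE sG eN fixV; have fixE (a : {set T}) : a \subset vset G -> contr_map x y e @: a = a.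
  move=> /subsetP aV; apply/setP => z; apply/imsetP/idP => [[w wa ->]|za].
    by rewrite fixV ?aV.
  by exists z; rewrite ?fixV ?aV.
case: G sG eN fixV fixE => V E /= sG eN _ fixE.
case: muE => -> /=; rewrite /del_edge /contr_edge /=; congr Graph.
- by apply/setDidPl; rewrite disjoint_sym disjoints1.
- exact: fixE.
- apply/setP => a; rewrite inE; apply/andP/idP => [[/imsetP[a' a'E ->] _]|aE].
    by have /andP[_ /fixE ->] := forall_inP sG _ a'E.
  have /andP[ca /fixE aV] := forall_inP sG _ aE.
  by split=> //; apply/imsetP; exists a.
Qed.

Lemma disjoint_edges A B : simple_graph A -> simple_graph B ->
  vset A :&: vset B = [set x; y] -> [set x; y] \notin eset B ->
  eset A :&: eset B = set0.
Proof.
move=> sA sB VI nxy; apply/setP => e; rewrite !inE; apply/negP => /andP[eA eB].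
have /andP[/eqP ce eVA] := forall_inP sA _ eA; have /andP[_ eVB] := forall_inP sB _ eB.
case/negP: nxy; have <- // : e = [set x; y].
by apply/eqP; rewrite eqEcard ce cards2 xy andbT -VI subsetI eVA eVB.
Qed.

Lemma minor_opsP mu G : mu \in minor_ops x y G -> exists2 e, e \in eset G &
  mu = inl e \/ (mu = inr e /\ e != [set x; y]).
Proof.
rewrite inE; case: mu => e; first by move=> eG; exists e; auto.
by case/andP => eG exy; exists e; auto.
Qed.

Lemma C0_intro (P : graph T -> int) G : Gxy0 x y G ->
  (forall mu, mu \in minor_ops x y G -> (P (app_op x y mu G) <= P G - Posz 1)%R) ->
  C0 x y P G.
Proof.
move=> GG H; split=> //; apply/setP => mu; rewrite [RHS]inE.
by apply/idP/andP => [muG|[//]]; split=> //; apply: H.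
Qed.

Lemma epsilonp_add G : epsilonp x y (add_xy x y G) = epsilonp x y G.
Proof. by rewrite /epsilonp [add_xy x y (add_xy x y G)]add_xy_id // !inE eqxx. Qed.

Lemma add_add G : add_xy x y (add_xy x y G) = add_xy x y G.
Proof. by rewrite add_xy_id // !inE eqxx. Qed.

(** * One side of a minor-tight sum *)

Section Side.
Variables G1 G2 H1 : graph T.
Hypotheses (g1 : good x y G1) (g2 : good x y G2).
Hypotheses (n1 : [set x; y] \notin eset G1) (n2 : [set x; y] \notin eset G2).
Hypothesis VI : vset G1 :&: vset G2 = [set x; y].
(** The edge xy, if the sum has it, is counted with the first side, so that the sum is an
    edge-disjoint union in both cases. *)
Hypothesis HE : H1 = G1 \/ H1 = add_xy x y G1.
Local Notation G := (gunion H1 G2).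
Hypothesis tight : minor_tight x y G1 G.

Local Notation g := genus.
Local Notation gp A := (genus (add_xy x y A)).
Local Notation ep A := (epsilonp x y A).

Let s1 : simple_graph G1. Proof. by case: g1. Qed.
Let s2 : simple_graph G2. Proof. by case: g2. Qed.
Let x1 : x \in vset G1. Proof. by case: g1. Qed.
Let y1 : y \in vset G1. Proof. by case: g1. Qed.

Lemma edge_neq e : e \in eset G1 -> e != [set x; y].
Proof. by move=> eG; apply: contraNneq n1 => <-. Qed.

Lemma edge_sub e : e \in eset G1 -> e \subset vset G1.
Proof. by case/(forall_inP s1)/andP. Qed.

Lemma contr_fix2 e w : e \in eset G1 -> w \in vset G2 -> contr_map x y e w = w.
Proof.
move=> eG w2; have [we|we] := boolP (w \in e); last by rewrite /contr_map (negPf we).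
have : w \in [set x; y] by rewrite -VI inE w2 (subsetP (edge_sub eG)).
case/set2P => ->; first exact: contr_x.
exact: (contr_y s1 xy eG (edge_neq eG)).
Qed.

Lemma op_G2 mu : mu \in minor_ops x y G1 -> app_op x y mu G2 = G2.
Proof.
case/minor_opsP => e eG muE; apply: (@op_id mu G2 e) => //.
- by case: muE => [|[]]; auto.
- have := disjoint_edges s1 s2 VI n2 => /setP/(_ e); rewrite !inE eG /= => ->.
  by [].
- by move=> w; apply: contr_fix2.
Qed.

Lemma op_add mu : mu \in minor_ops x y G1 -> vset (app_op x y mu G1) \subset vset G1 /\
  (x \in vset (app_op x y mu G1)) && (y \in vset (app_op x y mu G1)) ->
  app_op x y mu (add_xy x y G1) = add_xy x y (app_op x y mu G1).
Proof.
move=> muG [_ /andP[xm ym]]; rewrite add_xyE // app_op_union add_xyE //; congr gunion.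
have [sK _ _ _] := good_K2 xy.
have [e eG muE] := minor_opsP muG; apply: (@op_id mu _ e) => //.
- by case: muE => [|[]]; auto.
- by rewrite inE; apply: edge_neq.
- by move=> w /set2P[] ->; [exact: contr_x|exact: (contr_y s1 xy eG (edge_neq eG))].
Qed.

Lemma op_vset mu : mu \in minor_ops x y G1 -> vset (app_op x y mu G1) \subset vset G1 /\
  (x \in vset (app_op x y mu G1)) && (y \in vset (app_op x y mu G1)).
Proof.
case/minor_opsP => e eG [->|[-> exy]] /=; first by rewrite subxx x1 y1.
split.
  apply/subsetP => _ /imsetP[w wG ->]; rewrite /contr_map; case: ifP => // we.
  apply: (subsetP (edge_sub eG)); apply: contr_rep_in.
  by apply/set0Pn; exists w.
by apply/andP; split; apply/imsetP; [exists x|exists y];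
  rewrite ?contr_x ?(contr_y s1 xy eG exy).
Qed.

Lemma op_tight mu : mu \in minor_ops x y G1 -> g (app_op x y mu G) < g G.
Proof. by case/minor_opsP => e /tight[t1 t2] [->|[-> _]]. Qed.

(* The two ways in which a minor operation on G1 may decrease the genus of the
   sum, according to the two terms of the formula for the genus of the sum. *)
Lemma op_drop mu : mu \in minor_ops x y G1 -> good x y (app_op x y mu G1) ->
  let m := app_op x y mu G1 in
  g m < g G1 \/ gp m + ep G1 * ep G2 < gp G1 + ep m * ep G2.
Proof.
move=> muG gm m; have tg := op_tight muG; have vm := op_vset muG.
rewrite app_op_union (op_G2 muG) in tg.
have sm : simple_graph m by case: gm.
have VIm : vset m :&: vset G2 = [set x; y].
  apply/eqP; rewrite eqEsubset; apply/andP; split.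
    by rewrite -VI; apply: setSI; case: vm.
  have [_ _ x2 y2] := g2; have [_ /andP[xm ym]] := vm.
  by apply/subsetP => w /set2P[] ->; rewrite inE ?xm ?ym ?x2 ?y2.
have EI := disjoint_edges s1 s2 VI n2; have EIm := disjoint_edges sm s2 VIm n2.
have ub2 := genus_add_le xy g2.
case: HE => HE'; rewrite HE' in tg.
  have ge := genus_union_ge xy gm g2 VIm EIm.
  have le := genus_union_le xy g1 g2 VI EI.
  have lp := genus_union_le_plus xy g1 g2 VI EI.
  by case/orP: ge => ge; [left|right]; move: ge tg le lp; clear; rewrite -/m; lia.
(* With the edge xy in the sum, [G1] enters only through [gp G1]. The first term of the formula is
   handled by [gp G2 <= g G2 + 1], and both terms lead to the second alternative. *)
rewrite op_add // in tg.
have gam := good_add xy gm; have ga1 := good_add xy g1.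
have sam : simple_graph (add_xy x y m) by case: gam.
have sa1 : simple_graph (add_xy x y G1) by case: ga1.
have EIa := disjoint_edges sa1 s2 VI n2; have EIam := disjoint_edges sam s2 VIm n2.
have ge := genus_union_ge xy gam g2 VIm EIam.
have lp := genus_union_le_plus xy ga1 g2 VI EIa.
rewrite add_add epsilonp_add in ge; rewrite add_add epsilonp_add in lp.
right; case/orP: ge => ge; move: ge tg lp ub2; rewrite -/m; clear; nia.
Qed.

Definition bar b := ~~ connect (adj (del_edge G1 b)) x y.

Lemma good_op mu : mu \in minor_ops x y G1 ->
  good x y (app_op x y mu G1) \/ exists b, [/\ b \in eset G1, mu = inl b & bar b].
Proof.
case/minor_opsP => e eG [muE|[-> exy]]; last first.
  by left; apply: good_contr.
have [xyc|] := boolP (connect (adj (del_edge G1 e)) x y); last by right; exists e.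
left; rewrite muE /=; apply: good_del => // u v eE; apply: contraT => nuv.
have [uG vG] : u \in vset G1 /\ v \in vset G1.
  by split; apply: (subsetP (edge_sub eG)); rewrite eE !inE eqxx ?orbT.
have [_ t2] := tight eG; move: t2; rewrite ltnNge => /negP[].
have gG : good x y G.
  have gH : good x y H1 by case: HE => -> //; apply: good_add.
  exact: good_union.
have [sG cG _ _] := gG.
apply: (genus_bridge_contr sG cG _ eE).
  by case: HE => ->; rewrite /= !inE eG ?orbT.
pose S := conn_side (del_edge G1 e) x.
have un : uncrossed (del_edge G1 e) S by apply: conn_side_uncrossed.
have xS : x \in S by rewrite inE connect0.
have yS : y \in S by rewrite inE.
have S1 w : w \in vset G1 -> (w \in S :|: vset G2) = (w \in S).
  move=> w1; rewrite in_setU; case: (boolP (w \in vset G2)) => [w2|]; last by rewrite orbF.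
  have : w \in [set x; y] by rewrite -VI inE w1.
  by case/set2P => ->; rewrite ?xS ?yS.
(* Both terminals are in [S], so all of [G2] joins this side and [e] is a bridge of the whole sum,
   which tightness forbids. *)
have unG : uncrossed (del_edge G e) (S :|: vset G2).
  move=> a c; rewrite adj_del adj_union => /andP[ne /orP[acH|ac2]]; last first.
    by have [_ a2 c2] := simple_adj s2 ac2; rewrite !in_setU a2 c2 !orbT.
  have [ac1|acxy] : adj G1 a c \/ [set a; c] = [set x; y].
    case: HE acH => ->; first by left.
    by rewrite /adj /= in_setU1 => /orP[/eqP|]; auto.
    have [_ a1 c1] := simple_adj s1 ac1; rewrite !S1 //.
    by apply: un; rewrite adj_del ne.
  by case: (set2_eq xy acxy) => -[-> ->]; rewrite !in_setU xS yS.
apply/negP => /(uncrossed_connect unG); rewrite !S1 //.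
have := cut_split g1 eE uG x1.
have uE : (u \in S) = connect (adj (del_edge G1 e)) x u by rewrite inE.
have vE : (v \in S) = connect (adj (del_edge G1 e)) x v by rewrite inE.
rewrite -uE -vE => uv ES; have uS : u \in S by case/orP: uv => //; rewrite ES.
have vS : v \in S by rewrite -ES.
rewrite uE in uS; rewrite vE in vS; case/negP: nuv.
by apply: connect_trans vS; rewrite connectC.
Qed.

(** An edge other than [b] has both ends on one side of [S], so contracting it respects the sides
    and [b], or its image, remains the only crossing edge. *)
Lemma crossing_op (S : {set T}) b mu : uncrossed (del_edge G1 b) S -> b \in eset G1 ->
  mu \in minor_ops x y G1 -> mu != inl b -> mu != inr b ->
  exists b', forall u v, adj (app_op x y mu G1) u v -> u \in S -> v \notin S -> [set u; v] = b'.
Proof.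
move=> un bG muG nl nr.
have cross u v : adj G1 u v -> u \in S -> v \notin S -> [set u; v] = b.
  move=> uv uS vS; apply/eqP; apply: contraNT vS => ne.
  by rewrite -(un u v) // adj_del ne.
case/minor_opsP: muG => e eG [muE|[muE exy]]; rewrite muE in nl nr *.
  by exists b => u v; rewrite adj_del => /andP[_]; apply: cross.
exists (contr_map x y e @: b) => p w /(@adj_contrP T x y G1 e s1)[_ [a [a' [aa' -> ->]]]].
have eb : e != b by apply: contraNneq nr => ->.
have [u [v [_ eE uv _ _]]] := simple_edge s1 eG.
have uvS : (u \in S) = (v \in S) by apply: un; rewrite adj_del -eE eb.
have cS z : (contr_map x y e z \in S) = (z \in S).
  rewrite /contr_map; case: ifP => // ze.
  have : contr_rep x y e \in e by apply: contr_rep_in; apply/set0Pn; exists z.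
  by move: ze; rewrite {1 3}eE => /set2P[] -> /set2P[] ->; rewrite ?uvS.
by rewrite !cS => aS a'S; rewrite -(cross a a') // imsetU1 imset_set1.
Qed.

Lemma bar_op b mu : b \in eset G1 -> bar b -> mu \in minor_ops x y G1 ->
  mu != inl b -> mu != inr b -> good x y (app_op x y mu G1) ->
  ep (app_op x y mu G1) = 0.
Proof.
move=> bG barb muG nl nr gm.
have un := @conn_side_uncrossed T (del_edge G1 b) x.
have [b' cr] := crossing_op un bG muG nl nr.
by apply: (bar_epsilonp xy gm _ _ cr); rewrite inE ?connect0.
Qed.

Lemma inr_op b : b \in eset G1 -> inr b \in minor_ops x y G1.
Proof. by move=> bG; rewrite inE bG edge_neq. Qed.

(** Contracting [b] lowers neither g nor, as g and g+ agree on [G1], g+. The drop in [op_drop] must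
    then come from the products of the [epsilonp], and only these values allow it. *)
Lemma bar_drop b : b \in eset G1 -> bar b -> gp G1 = g G1 ->
  [/\ ep (contr_edge x y G1 b) = 1%N, ep G2 = 1%N & ep G1 = 0].
Proof.
move=> bG barb gE; have muG := inr_op bG.
have gm : good x y (contr_edge x y G1 b) by apply: good_contr => //; apply: edge_neq.
have [u [v [bE [uG vG] xu yv vS]]] := bar_split g1 bG barb.
have nuv : ~~ connect (adj (del_edge G1 b)) u v.
  by apply: contra barb => uv; apply: connect_trans xu (connect_trans uv _); rewrite connectC.
have [sG cG _ _] := g1.
have le := genus_bridge_contr sG cG bG bE nuv.
have := op_drop muG gm; rewrite /= => -[]; first by rewrite ltnNge le.
have := genus_le_add xy gm; rewrite gE => le2.
have := epsilonp01 x y G1; have := epsilonp01 x y G2; have := epsilonp01 x y (contr_edge x y G1 b).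
move: le le2 => le le2; case/orP => /eqP ->; case/orP => /eqP ->; case/orP => /eqP -> //;
  by move=> dr; exfalso; move: dr le le2; clear; lia.
Qed.

Local Notation in_main := (C0 x y (@par_g T) G1 \/ C0 x y (par_gp x y) G1).

Lemma GG1 : Gxy0 x y G1.
Proof. by rewrite /Gxy0 /Gxy s1 xy x1 y1 n1. Qed.

Lemma bar_cut b : b \in eset G1 -> bar b -> cut_edge G1 b.
Proof.
move=> bG barb; have [sG cG _ _] := g1; rewrite /cut_edge bG (components_connected cG x1) cards1.
pose K w := [set v in vset G1 | connect (adj (del_edge G1 b)) w v].
have sub : [set K x; K y] \subset components (del_edge G1 b).
  by apply/subsetP => C /set2P[] ->; apply/imsetP; [exists x|exists y].
have ne : K x != K y.
  apply: contraNneq barb => /setP/(_ y); rewrite !inE y1 connect0 /= => E.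
  by rewrite E.
by have := subset_leq_card sub; rewrite cards2 ne.
Qed.

Lemma side_bar b : b \in eset G1 -> bar b -> gp G1 = g G1 -> classD x y G1.
Proof.
move=> bG barb gE; have [eb e2 e1] := bar_drop bG barb gE.
have [_ cG _ _] := g1.
exists b; split=> //.
- by rewrite /dumbbell GG1 bar_cut //=; apply/andP; split; [apply: connG|exact: barb].
- by rewrite /theta /par_gp /par_g gE; lia.
apply/subsetP => mu; rewrite in_setD in_set2 negb_or => /andP[/andP[nl nr] muG].
rewrite inE muG /par_g; case: (good_op muG) => [gm|[b' [b'G muE barb']]].
  have em := bar_op bG barb muG nl nr gm.
  have := op_drop muG gm; rewrite /= em gE mul0n addn0 => dr.
  have le := genus_le_add xy gm.
  have : g (app_op x y mu G1) < g G1 by case: dr => // dr; move: dr le; clear; lia.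
  by clear; lia.
(* A second bar [b'] is impossible: contracting it would give [epsilonp] equal to 1, while the
   surviving bar [b] forces 0. *)
have [eb' _ _] := bar_drop b'G barb' gE.
have ne : b' != b by apply: contraNneq nl => E; rewrite muE E.
have := @bar_op b (inr b') bG barb (inr_op b'G).
have gm : good x y (contr_edge x y G1 b') by apply: good_contr => //; apply: edge_neq.
by rewrite /= eb' => /(_ isT) H; have := H ne gm.
Qed.

(** The hypothesis keeps the [epsilonp] terms from causing a drop on their own. If g = g+ on [G1],
    both alternatives of [op_drop] lower g, since g is at most g+ on the minor; if g < g+, both
    lower g+, since g+ is at most g + 1 on the minor. *)
Lemma side_main : (ep G2 == 0) || (ep G1 == 1%N) -> in_main.
Proof.
move=> eps; have := genus_le_add xy g1; rewrite leq_eqVlt => /orP[/eqP gE|gE].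
  left; apply: C0_intro; first exact: GG1.
  move=> mu muG; case: (good_op muG) => [gm|[b [bG muE barb]]].
    have le := genus_le_add xy gm; have := op_drop muG gm; rewrite /= /par_g => dr.
    suff : g (app_op x y mu G1) < g G1 by clear; lia.
    case: dr => // dr; move: dr le eps; rewrite gE.
    have := epsilonp01 x y (app_op x y mu G1); have := epsilonp01 x y G2.
    case/orP => /eqP ->; case/orP => /eqP ->; rewrite ?muln0 ?addn0 //=;
      try (by clear; lia); by move=> dr le /eqP e1; rewrite e1 in dr; move: dr le; clear; lia.
  have [_ e2 e1] := bar_drop bG barb (esym gE).
  by rewrite e1 e2 in eps.
right; apply: C0_intro; first exact: GG1.
move=> mu muG; rewrite /par_gp /par_g.
suff : gp (app_op x y mu G1) < gp G1 by clear; lia.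
case: (good_op muG) => [gm|[b [bG muE barb]]]; last first.
  (* Deleting a bar disconnects [G1], but with xy added the genus is at most [g G1], which is below
     [gp G1]. *)
  by rewrite muE /=; apply: leq_ltn_trans gE; apply: bar_swap.
have le := genus_add_le xy gm; have := op_drop muG gm; rewrite /= => -[dr|dr].
  by move: dr le gE; clear; lia.
move: dr eps; have := epsilonp01 x y (app_op x y mu G1); have := epsilonp01 x y G2.
have := epsilonp01 x y G1.
by case/orP => /eqP ->; case/orP => /eqP ->; case/orP => /eqP ->; clear; lia.
Qed.

(** Only [ep G2 = 1] with [ep G1 = 0] is left. A drop may now consist in [ep] rising from 0 to 1,
    and this is what the parameters diminished by epsilon record. *)
Lemma side_class : C0 x y (@par_g T) G1 \/ C0 x y (par_gp x y) G1 \/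
  C0 x y (par_ga x y) G1 \/ C0 x y (par_gap x y) G1 \/ classD x y G1.
Proof.
have [/side_main[]|] := boolP ((ep G2 == 0) || (ep G1 == 1%N)); [by left|by right; left|].
rewrite negb_or => /andP[e2 e1].
have {}e2 : ep G2 = 1%N by have := epsilonp01 x y G2; rewrite (negPf e2) => /eqP.
have {}e1 : ep G1 = 0 by have := epsilonp01 x y G1; rewrite (negPf e1) orbF => /eqP.
have := genus_le_add xy g1; rewrite leq_eqVlt => /orP[/eqP gE|gE]; last first.
  right; right; right; left; apply: C0_intro; first exact: GG1.
  move=> mu muG; rewrite /par_gap /par_ga /par_g -!/(epsilonp x y _) e1.
  suff : gp (app_op x y mu G1) < gp G1 + ep (app_op x y mu G1) by clear; lia.
  case: (good_op muG) => [gm|[b [bG muE barb]]]; last first.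
    rewrite muE /=; apply: ltn_addr; apply: leq_ltn_trans gE; exact: bar_swap.
  have le := genus_add_le xy gm; have := op_drop muG gm; rewrite /= e1 e2 => -[dr|dr].
    by move: dr le gE; clear; lia.
  by move: dr; clear; lia.
have [/existsP[b /andP[bG barb]]|/existsPn nobar] := boolP [exists b, (b \in eset G1) && bar b].
  by right; right; right; right; apply: side_bar bG barb (esym gE).
right; right; left; apply: C0_intro; first exact: GG1.
have eps1 : epsilon x y G1 = 0.
  have := epsilon01 x y G1 => /orP[/eqP //|/eqP H].
  by have [_] := epsilon_add xy g1 H; rewrite e1.
move=> mu muG; rewrite /par_ga /par_g eps1.
suff : g (app_op x y mu G1) < g G1 + epsilon x y (app_op x y mu G1) by clear; lia.
case: (good_op muG) => [gm|[b [bG muE barb]]]; last first.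
  by have := nobar b; rewrite bG => /negP[].
have le := genus_le_add xy gm; have := op_drop muG gm; rewrite /= e1 e2 -gE => -[dr|dr].
  exact: ltn_addr.
have := epsilonp01 x y (app_op x y mu G1) => /orP[/eqP em|/eqP em].
  by apply: ltn_addr; move: dr le; rewrite em; clear; lia.
(* If g and g+ agree on the minor, [ep] equal to 1 passes to [epsilon]; otherwise g is already below
   g+ there. *)
move: le; rewrite leq_eqVlt => /orP[/eqP gm'|lt].
  by rewrite (epsilonp_eq xy gm em (esym gm')); move: dr; rewrite em gm'; clear; lia.
by apply: ltn_addr; move: dr lt; rewrite em; clear; lia.
Qed.

End Side.
End MinorTight.

Theorem corollary29 (T : finType) (x y : T) (G G1 G2 : graph T)
  (conn1 : connected_graph G1) (conn2 : connected_graph G2)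
  (sumG : xy_sum x y G1 G2 G)
  (tight1 : minor_tight x y G1 G) (tight2 : minor_tight x y G2 G) :
  let in_class (H : graph T) : Prop :=
    C0 x y (@par_g T) H \/ C0 x y (par_gp x y) H \/ C0 x y (par_ga x y) H \/
    C0 x y (par_gap x y) H \/ classD x y H in
  let in_main (H : graph T) : Prop :=
    C0 x y (@par_g T) H \/ C0 x y (par_gp x y) H in
  [/\ in_class G1 /\ in_class G2,
      epsilonp x y G2 = 0%N -> in_main G1
    & in_main G1 \/ in_main G2].
Proof.
move=> in_class in_main.
case: sumG => /andP[/and4P[s1 xy x1 y1] n1] /andP[/and4P[s2 _ x2 y2] n2] VI GE.
have g1 : good x y G1 by [].
have g2 : good x y G2 by [].
have VI' : vset G2 :&: vset G1 = [set x; y] by rewrite setIC.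
have unionC A B : gunion A B = gunion B A :> graph T.
  by rewrite /gunion (setUC (vset A)) (setUC (eset A)).
(* An edge xy of the sum may be assigned to either side, so the results for one side apply to both
   [G1] and [G2]. *)
have [H1 [HE1 G1E]] : exists H1, (H1 = G1 \/ H1 = add_xy x y G1) /\ G = gunion H1 G2.
  case: GE => ->; [exists G1|exists (add_xy x y G1)]; split; auto.
  by rewrite /add_xy /gunion /= setUA.
have [H2 [HE2 G2E]] : exists H2, (H2 = G2 \/ H2 = add_xy x y G2) /\ G = gunion H2 G1.
  case: GE => ->; [exists G2|exists (add_xy x y G2)]; split; auto.
  by rewrite /add_xy /gunion /= (setUC (vset G1)) (setUC (eset G1)) setUA.
have t1 := tight1; rewrite G1E in t1; have t2 := tight2; rewrite G2E in t2.
have m1 := side_main xy g1 g2 n1 n2 VI HE1 t1.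
have m2 := side_main xy g2 g1 n2 n1 VI' HE2 t2.
split.
- split; first exact: (side_class xy g1 g2 n1 n2 VI HE1 t1).
  exact: (side_class xy g2 g1 n2 n1 VI' HE2 t2).
- by move=> e2; apply: m1; rewrite e2.
(* The value of [epsilonp] on [G1] decides: 1 puts [G1] itself in the main classes, 0 puts [G2]
   there. *)
- case/orP: (epsilonp01 x y G1) => e1; last by left; apply: m1; rewrite e1 orbT.
  by right; apply: m2; rewrite e1.
Qed.
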